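(* Let $\mathbb D\subset\mathbb C$ be contractible and let $\eta$ be a potential for some harmonic map $f:\mathbb D\to SO^+(1,n+3)/SO^+(1,3)\times SO(n)$. Let $\gamma$ be a conformal automorphism of $\mathbb D$ and assume that $$\gamma^*\eta=V_+^{-1}\,\eta\,V_++V_+^{-1}\,dV_+$$ holds for some $V_+\in(\Lambda^+SO^+(1,n+3,\mathbb C)_\sigma)^0$ (or $\tilde PV_+\in(\Lambda^+SO^+(1,n+3,\mathbb C)_\sigma)^0$). Then there exists some $\rho(\lambda)\in(\Lambda SO^+(1,n+3,\mathbb C)_\sigma)^0$ (or $\rho(\lambda)\tilde P\in(\Lambda SO^+(1,n+3,\mathbb C)_\sigma)^0$, respectively) such that the solution $C$ of $$dC=C\eta,\qquad C(z=0,\lambda)=I$$ satisfies $$\gamma^*C=\rho\,C\,V_+.\qquad(\ast)$$ Moreover, $\gamma$ induces a symmetry of the harmonic map $f$ associated with $\eta$ if and only if $V_+\in(\Lambda^+SO^+(1,n+3,\mathbb C)_\sigma)^0$ (or $\tilde PV_+\in(\Lambda^+SO^+(1,n+3,\mathbb C)_\sigma)^0$) satisfying $\gamma^*\eta=V_+^{-1}\,\eta\,V_++V_+^{-1}\,dV_+$, and $\rho=\rho(\lambda)$ independent of $z$, can be chosen such that $\rho(\lambda)\in(\Lambda SO^+(1,n+3)_\sigma)^0$ (or $\rho(\lambda)\tilde P\in(\Lambda SO^+(1,n+3)_\sigma)^0$) and $(\ast)$ holds. In this case $\gamma$ induces the symmetry $$\gamma^*f=\rho(\lambda)f$$ of the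 harmonic map $f$.
   Context: Fix $n\ge1$. $O^+(1,n+3)$ is the group of linear isometries of $\mathbb{R}^{n+4}$ with form $-x_0^2+x_1^2+\dots+x_{n+3}^2$ that preserve the forward light cone; $G=SO^+(1,n+3)$ is its identity component; $K=SO^+(1,3)\times SO(n)$ (block diagonal); $\sigma=\mathrm{Ad}\,\mathrm{diag}(-I_4,I_n)$; $G^{\mathbb C}=SO^+(1,n+3,\mathbb C)=SO(1,n+3,\mathbb C)$; $\mathfrak g=\mathfrak k\oplus\mathfrak p$ is the eigenspace decomposition of $\sigma$; $\tilde P=\mathrm{diag}(1,1,1,1,-1,1,\dots,1)$. An element $A\in O^+(1,n+3)$ acts on $G/K$ by $gK\mapsto AgK$ if $\det A=1$ and $gK\mapsto Ag\tilde PK$ if $\det A=-1$. ''$\gamma$ induces a symmetry of $f$'' means that there is $R\in O^+(1,n+3)$ with $f(\gamma(p))=Rf(p)$ for all $p\in\mathbb D$; conformal automorphisms are orientation preserving (holomorphic). Loop groups: $\Lambda G^{\mathbb C}_\sigma=\{g:S^1\to G^{\mathbb C}\mid\sigma(g(\lambda))=g(-\lambda)\}$; $\Lambda G_\sigma$ the loops with values in $G$; $\Lambda^+G^{\mathbb C}_\sigma$ the loops extending holomorphically to $|\lambda|<1$; $(\cdot)^0$ denotes the identity component. $V_+=V_+(z,\lambda)$ is a function of $z\in\mathbb D$ with values in the indicated loop group. Extended frame: for a lift $F:\mathbb D\to G$ of $f$ with $\alpha=F^{-1}dF=\alpha_{\mathfrak k}+\alpha'_{\mathfrak p}+\alpha''_{\mathfrak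 p}$ ($(1,0)$- and $(0,1)$-parts of the $\mathfrak p$-part) and $\alpha_\lambda=\lambda^{-1}\alpha'_{\mathfrak p}+\alpha_{\mathfrak k}+\lambda\alpha''_{\mathfrak p}$, the extended frame is the solution $F(z,\lambda)$ of $dF=F\alpha_\lambda$, $F(0,\lambda)=I$ ($0\in\mathbb D$ the base point, $f(0)=eK$); $f_\lambda=F(\cdot,\lambda)\bmod K$ is the associated family, and in $\gamma^*f=\rho(\lambda)f$ the map $f$ stands for $f_\lambda$. A potential for $f$ is a $\Lambda\mathfrak g^{\mathbb C}_\sigma$-valued holomorphic or meromorphic $(1,0)$-form $\eta$ on $\mathbb D$, with Fourier expansion in $\lambda$ involving only powers $\lambda^j$, $j\ge-1$ (for instance the normalized potential, which is $\lambda^{-1}\mathfrak p^{\mathbb C}$-valued), such that the solution $C$ of $dC=C\eta$, $C(0,\lambda)=I$, is holomorphic resp. meromorphic on $\mathbb D$ and satisfies (locally, away from poles) $C=FW_+$ with $F$ an extended frame of $f$ and $W_+\in\Lambda^+G^{\mathbb C}_\sigma$. *)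

(* Defs.v *)
From HB Require Import structures.
From mathcomp Require Import all_boot all_order all_algebra.
From mathcomp Require Import complex.
From mathcomp Require Import all_classical all_reals all_analysis.

Set Implicit Arguments.
Unset Strict Implicit.
Unset Printing Implicit Defensive.

Import Order.TTheory GRing.Theory Num.Theory numFieldNormedType.Exports.

Local Open Scope classical_set_scope.
Local Open Scope ring_scope.

(* R[i] bundled as a numClosedFieldType, so that the norm topology and the
   normed-module structures of MathComp-Analysis are found on it. *)
Definition cplx (R : realType) : numClosedFieldType := R[i].

Definition tocplx (R : realType) (x : R) : cplx R := x%:C%C.
Definition mkcplx (R : realType) (x y : R) : cplx R := (x +i* y)%C.
Definition recplx (R : realType) (z : cplx R) : R := complex.Re z.
Definition imcplx (R : realType) (z : cplx R) : R := complex.Im z.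

Definition cmx (R : realType) (m : nat) (A : 'M[R]_m) : 'M[cplx R]_m :=
  map_mx (@tocplx R) A.

Definition circle (R : realType) : set (cplx R) := [set l | `|l| = 1].
Definition odisc (R : realType) : set (cplx R) := [set l | `|l| < 1].
Definition cdisc (R : realType) : set (cplx R) := [set l | `|l| <= 1].

Section Groups.

Definition signmx (T : pzRingType) (m : nat) (p : pred nat) : 'M[T]_m :=
  diag_mx (\row_j (-1) ^+ p j).

Definition lorentz_form (T : pzRingType) (m : nat) : 'M[T]_m.+1 :=
  signmx T m.+1 (pred1 0%N).

Definition lorentz_isometry (T : pzRingType) (m : nat) : set 'M[T]_m.+1 :=
  [set A | A^T *m lorentz_form T m *m A = lorentz_form T m].

Definition forward_light_cone (R : realType) (m : nat) : set 'cV[R]_m.+1 :=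
  [set x | x^T *m lorentz_form R m *m x = 0 /\ 0 < x ord0 ord0].

(* O^+(1,m), acting on R^(m+1) *)
Definition Oplus (R : realType) (m : nat) : set 'M[R]_m.+1 :=
  [set A | lorentz_isometry A /\
    forall x, forward_light_cone x -> forward_light_cone (A *m x)].

(* SO^+(1,m) *)
Definition SOplus (R : realType) (m : nat) : set 'M[R]_m.+1 :=
  connected_component (@Oplus R m) 1%:M.

(* SO(1,m,C) *)
Definition SOC (R : realType) (m : nat) : set 'M[cplx R]_m.+1 :=
  [set A | lorentz_isometry A /\ \det A = 1].

Definition SO (R : realType) (m : nat) : set 'M[R]_m :=
  [set A | A^T *m A = 1%:M /\ \det A = 1].

(* K = SO^+(1,3) x SO(n) *)
Definition Kgrp (R : realType) (n : nat) : set 'M[R]_n.+4 :=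
  [set (block_mx a 0 0 b : 'M[R]_(4 + n)) | a in @SOplus R 3 & b in @SO R n].

(* sigma = Ad diag(-I_4, I_n), on group elements and on Lie algebra elements *)
Definition sigma (T : fieldType) (n : nat) (A : 'M[T]_n.+4) : 'M[T]_n.+4 :=
  let Q := signmx T n.+4 (fun i => i < 4)%N in Q *m A *m invmx Q.

Definition kpart (T : fieldType) (n : nat) (X : 'M[T]_n.+4) : 'M[T]_n.+4 :=
  2^-1 *: (X + sigma X).
Definition ppart (T : fieldType) (n : nat) (X : 'M[T]_n.+4) : 'M[T]_n.+4 :=
  2^-1 *: (X - sigma X).

(* diag(1,1,1,1,-1,1,...,1); it is the identity when n = 0 *)
Definition Ptilde (T : pzRingType) (n : nat) : 'M[T]_n.+4 :=
  signmx T n.+4 (pred1 4%N).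

(* The points of G/K are represented by the cosets g K, as sets of matrices. *)
Definition cosetK (R : realType) (n : nat) (g : 'M[R]_n.+4) : set 'M[R]_n.+4 :=
  [set g *m k | k in @Kgrp R n].

(* gK |-> A g K if det A = 1, and gK |-> A g Ptilde K otherwise; in the second
   case one uses that Ptilde normalises K, so that A g Ptilde K = A (g K) Ptilde *)
Definition act (R : realType) (n : nat) (A : 'M[R]_n.+4) (X : set 'M[R]_n.+4) :
    set 'M[R]_n.+4 :=
  if \det A == 1 then [set A *m x | x in X]
  else [set A *m x *m Ptilde R n | x in X].

End Groups.

(* Loops are functions on the plane of which only the restriction to the unit
   circle matters: all loop groups below are subspaces of the space of matrix
   functions with the topology of uniform convergence on the circle. *)
Section Loops.

Definition loops (R : realType) (T : uniformType) (n : nat) :=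
  {uniform` @circle R -> 'M[T]_n.+4}.

Definition LambdaGC (R : realType) (n : nat) : set (loops R (cplx R) n) :=
  [set g | [/\ {within @circle R, continuous (g : cplx R -> 'M[cplx R]_n.+4)},
    forall l, circle l -> @SOC R n.+3 (g l) &
    forall l, circle l -> sigma (g l) = g (- l)]].

Definition LambdaG (R : realType) (n : nat) : set (loops R R n) :=
  [set g | [/\ {within @circle R, continuous (g : cplx R -> 'M[R]_n.+4)},
    forall l, circle l -> @SOplus R n.+3 (g l) &
    forall l, circle l -> sigma (g l) = g (- l)]].

Definition LambdaplusGC (R : realType) (n : nat) : set (loops R (cplx R) n) :=
  [set g | @LambdaGC R n g /\
    exists h : cplx R -> 'M[cplx R]_n.+4,
      [/\ {within @cdisc R, continuous h},
          forall l, odisc l -> derivable h l 1,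
          forall l, cdisc l -> @SOC R n.+3 (h l) &
          forall l, circle l -> h l = g l]].

Definition LambdaGC0 (R : realType) (n : nat) : set (loops R (cplx R) n) :=
  connected_component (@LambdaGC R n) (fun=> 1%:M).
Definition LambdaG0 (R : realType) (n : nat) : set (loops R R n) :=
  connected_component (@LambdaG R n) (fun=> 1%:M).
Definition LambdaplusGC0 (R : realType) (n : nat) : set (loops R (cplx R) n) :=
  connected_component (@LambdaplusGC R n) (fun=> 1%:M).

Definition LambdagC (R : realType) (n : nat) : set (loops R (cplx R) n) :=
  [set X | [/\ {within @circle R, continuous (X : cplx R -> 'M[cplx R]_n.+4)},
    forall l, circle l -> (X l)^T *m lorentz_form (cplx R) n.+3
                          + lorentz_form (cplx R) n.+3 *m X l = 0 &
    forall l, circle l -> sigma (X l) = X (- l)]].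

Definition expi (R : realType) (t : R) : cplx R := mkcplx (cos t) (sin t).

Definition cintegral (R : realType) (A : set R) (f : R -> cplx R) : cplx R :=
  mkcplx (Rintegral lebesgue_measure A (fun t => recplx (f t)))
         (Rintegral lebesgue_measure A (fun t => imcplx (f t))).

Definition fourier (R : realType) (n : nat) (X : cplx R -> 'M[cplx R]_n.+4)
    (j : int) : 'M[cplx R]_n.+4 :=
  \matrix_(a, b) ((tocplx (2 * pi))^-1 *
    cintegral `[0, 2 * pi] (fun t => X (expi t) a b * expi t ^ (- j))).

(* holomorphic maps from the open set U into the space of continuous loops *)
Definition holo_loop (R : realType) (n : nat) (U : set (cplx R))
    (g : cplx R -> cplx R -> 'M[cplx R]_n.+4) : Prop :=
  [/\ forall z, U z -> {within @circle R, continuous (g z)},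
      {within U, continuous (g : cplx R -> loops R (cplx R) n)} &
      forall l, circle l -> forall z, U z -> derivable (fun w => g w l) z 1].

(* meromorphic on D with poles in S; holomorphic on D when S is empty *)
Definition mero_loop (R : realType) (n : nat) (D S : set (cplx R))
    (g : cplx R -> cplx R -> 'M[cplx R]_n.+4) : Prop :=
  holo_loop (D `\` S) g /\
  forall s, S s -> exists (k : nat) (U : set (cplx R))
      (h : cplx R -> cplx R -> 'M[cplx R]_n.+4),
    [/\ open U, U s, holo_loop U h &
        forall z, (U `&` (D `\` S)) z -> forall l, circle l ->
          h z l = (z - s) ^+ k *: g z l].

End Loops.

Section HarmonicMaps.

Definition contractible_set (T : topologicalType) (R : realType) (D : set T) :
    Prop :=
  exists (z0 : T) (H : R -> T -> T),
    [/\ D z0,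
        {within `[0, 1] `*` D, continuous (fun p : R * T => H p.1 p.2)},
        forall t z, t \in `[0, 1] -> D z -> D (H t z),
        forall z, D z -> H 0 z = z &
        forall z, D z -> H 1 z = z0].

(* real directional derivative: along 1 it is d/dx, along 'i it is d/dy *)
Definition rder (R : realType) (m : nat) (v : cplx R)
    (F : cplx R -> 'M[R]_m.+1) (z : cplx R) : 'M[R]_m.+1 :=
  derive1 (fun t : R => F (z + tocplx t * v)) 0.

Definition rderivable (R : realType) (m : nat) (v : cplx R)
    (F : cplx R -> 'M[R]_m.+1) (z : cplx R) : Prop :=
  derivable (fun t : R => F (z + tocplx t * v)) 0 1.

Fixpoint Ck (R : realType) (m : nat) (k : nat) (U : set (cplx R))
    (F : cplx R -> 'M[R]_m.+1) : Prop :=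
  {within U, continuous F} /\
  if k is k'.+1 then
    [/\ forall z, U z -> rderivable 1 F z /\ rderivable 'i F z,
        Ck k' U (rder 1 F) & Ck k' U (rder 'i F)]
  else True.

Definition smooth (R : realType) (m : nat) (U : set (cplx R))
    (F : cplx R -> 'M[R]_m.+1) : Prop := forall k, Ck k U F.

Definition is_lift (R : realType) (n : nat) (U : set (cplx R))
    (f : cplx R -> set 'M[R]_n.+4) (F : cplx R -> 'M[R]_n.+4) : Prop :=
  smooth U F /\
  forall z, U z -> @SOplus R n.+3 (F z) /\ f z = cosetK (F z).

(* alpha = F^-1 dF, evaluated on the tangent vector v *)
Definition mc_form (R : realType) (n : nat) (F : cplx R -> 'M[R]_n.+4)
    (v z : cplx R) : 'M[R]_n.+4 := invmx (F z) *m rder v F z.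

Definition lie (T : pzRingType) (m : nat) (X Y : 'M[T]_m) : 'M[T]_m :=
  X *m Y - Y *m X.

(* The lift identifies f^* T(G/K) with the trivial bundle with fibre p: the
   differential of f becomes the p-part of alpha, and the pull-back of the
   Levi-Civita connection of the symmetric space becomes d + ad (k-part). *)
Definition tension (R : realType) (n : nat) (F : cplx R -> 'M[R]_n.+4)
    (z : cplx R) : 'M[R]_n.+4 :=
  \sum_(v <- [:: 1; 'i])
    (rder v (fun w => ppart (mc_form F v w)) z
     + lie (kpart (mc_form F v z)) (ppart (mc_form F v z))).

Definition harmonic_map (R : realType) (n : nat) (D : set (cplx R))
    (f : cplx R -> set 'M[R]_n.+4) : Prop :=
  forall z, D z -> exists (U : set (cplx R)) (F : cplx R -> 'M[R]_n.+4),
    [/\ open U, U z, U `<=` D, is_lift U f F & forall w, U w -> tension F w = 0].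

(* coefficients of dz and of d(conj z) in the differential of F *)
Definition ddz (R : realType) (n : nat) (F : cplx R -> 'M[R]_n.+4)
    (z : cplx R) : 'M[cplx R]_n.+4 :=
  2^-1 *: (cmx (rder 1 F z) - 'i *: cmx (rder 'i F z)).
Definition ddzbar (R : realType) (n : nat) (F : cplx R -> 'M[R]_n.+4)
    (z : cplx R) : 'M[cplx R]_n.+4 :=
  2^-1 *: (cmx (rder 1 F z) + 'i *: cmx (rder 'i F z)).

(* coefficients of dz and of d(conj z) in
   alpha_lambda = lambda^-1 alpha'_p + alpha_k + lambda alpha''_p *)
Definition alpha_dz (R : realType) (n : nat) (F : cplx R -> 'M[R]_n.+4)
    (z l : cplx R) : 'M[cplx R]_n.+4 :=
  let A := invmx (cmx (F z)) *m ddz F z in l^-1 *: ppart A + kpart A.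
Definition alpha_dzbar (R : realType) (n : nat) (F : cplx R -> 'M[R]_n.+4)
    (z l : cplx R) : 'M[cplx R]_n.+4 :=
  let A := invmx (cmx (F z)) *m ddzbar F z in l *: ppart A + kpart A.

(* The lift of f from which alpha is formed is normalised to be I at the base
   point 0, hence equal to F(., 1). *)
Definition extended_frame (R : realType) (n : nat) (D : set (cplx R))
    (f : cplx R -> set 'M[R]_n.+4) (F : cplx R -> cplx R -> 'M[R]_n.+4) :
    Prop :=
  [/\ (forall z, D z -> @LambdaG R n (F z)) /\
      {within D, continuous (F : cplx R -> loops R R n)},
      is_lift D f (fun z => F z 1),
      forall l, circle l -> smooth D (fun z => F z l),
      forall l, circle l -> F 0 l = 1%:M &
      forall l, circle l -> forall z, D z ->
        ddz (fun w => F w l) z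
          = cmx (F z l) *m alpha_dz (fun w => F w 1) z l /\
        ddzbar (fun w => F w l) z
          = cmx (F z l) *m alpha_dzbar (fun w => F w 1) z l].

End HarmonicMaps.

Section Potentials.

(* closed discrete subsets of D, not containing the base point *)
Definition pole_set (R : realType) (D S : set (cplx R)) : Prop :=
  [/\ S `<=` D, forall z, D z -> ~ limit_point S z & ~ S 0].

(* dC = C eta, C(0, lambda) = I; the form eta is given by its dz-coefficient *)
Definition solution (R : realType) (n : nat) (D S : set (cplx R))
    (eta C : cplx R -> cplx R -> 'M[cplx R]_n.+4) : Prop :=
  [/\ mero_loop D S C,
      forall l, circle l -> C 0 l = 1%:M &
      forall l, circle l -> forall z, (D `\` S) z ->
        'D_1 (fun w => C w l) z = C z l *m eta z l].

(* potentials for f, with poles in S *)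
Definition potential (R : realType) (n : nat) (D S : set (cplx R))
    (f : cplx R -> set 'M[R]_n.+4)
    (eta : cplx R -> cplx R -> 'M[cplx R]_n.+4) : Prop :=
  [/\ mero_loop D S eta,
      forall z, (D `\` S) z -> @LambdagC R n (eta z),
      forall z, (D `\` S) z -> forall j : int, j < -1 ->
        fourier (eta z) j = 0 &
      exists (C : cplx R -> cplx R -> 'M[cplx R]_n.+4)
             (F : cplx R -> cplx R -> 'M[R]_n.+4),
        [/\ solution D S eta C, extended_frame D f F &
            forall z, (D `\` S) z ->
              exists2 W : cplx R -> 'M[cplx R]_n.+4, @LambdaplusGC R n W &
                forall l, circle l -> C z l = cmx (F z l) *m W l]].

Definition conformal_automorphism (R : realType) (D : set (cplx R))
    (gamma : cplx R -> cplx R) : Prop :=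
  exists delta : cplx R -> cplx R,
    [/\ forall z, D z -> D (gamma z) /\ D (delta z),
        forall z, D z -> delta (gamma z) = z /\ gamma (delta z) = z,
        forall z, D z -> derivable gamma z 1 &
        forall z, D z -> derivable delta z 1].

(* V_+ is only required to be defined where both eta and gamma^* eta are regular,
   that is on all of D when eta is holomorphic (S empty): for a meromorphic eta,
   V_+ = C^-1 rho^-1 gamma^* C in general has poles at the remaining points. *)
Definition regular_points (R : realType) (D S : set (cplx R))
    (gamma : cplx R -> cplx R) : set (cplx R) :=
  D `\` (S `|` gamma @^-1` S).

(* V_+ takes values in (Lambda^+ G^C_sigma)^0 if b = false,
   Ptilde V_+ does if b = true *)
Definition Vplus_class (R : realType) (n : nat) (D S : set (cplx R))
    (gamma : cplx R -> cplx R) (b : bool)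
    (V : cplx R -> cplx R -> 'M[cplx R]_n.+4) : Prop :=
  forall z, regular_points D S gamma z ->
    @LambdaplusGC0 R n (fun l => Ptilde (cplx R) n ^+ b *m V z l).

(* gamma^* eta = V^-1 eta V + V^-1 dV; in particular dV is of type (1,0) *)
Definition gauge_equation (R : realType) (n : nat) (D S : set (cplx R))
    (gamma : cplx R -> cplx R) (eta V : cplx R -> cplx R -> 'M[cplx R]_n.+4) :
    Prop :=
  forall l, circle l -> forall z, regular_points D S gamma z ->
    derivable (fun w => V w l) z 1 /\
    derive1 gamma z *: eta (gamma z) l
      = invmx (V z l) *m eta z l *m V z l
        + invmx (V z l) *m 'D_1 (fun w => V w l) z.

(* gamma^* C = rho C V *)
Definition monodromy_equation (R : realType) (n : nat) (D S : set (cplx R))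
    (gamma : cplx R -> cplx R) (C V : cplx R -> cplx R -> 'M[cplx R]_n.+4)
    (rho : cplx R -> 'M[cplx R]_n.+4) : Prop :=
  forall l, circle l -> forall z, regular_points D S gamma z ->
    C (gamma z) l = rho l *m C z l *m V z l.

Definition induces_symmetry (R : realType) (n : nat) (D : set (cplx R))
    (f : cplx R -> set 'M[R]_n.+4) (gamma : cplx R -> cplx R) : Prop :=
  exists2 A : 'M[R]_n.+4, @Oplus R n.+3 A &
    forall p, D p -> f (gamma p) = act A (f p).

(* rho is real: it is a loop in G up to Ptilde, with the same b as for V_+ *)
Definition real_monodromy (R : realType) (n : nat) (D S : set (cplx R))
    (gamma : cplx R -> cplx R) (eta C : cplx R -> cplx R -> 'M[cplx R]_n.+4)
    (V : cplx R -> cplx R -> 'M[cplx R]_n.+4) (rho : cplx R -> 'M[R]_n.+4) :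
    Prop :=
  [/\ exists b : bool, Vplus_class D S gamma b V /\
        @LambdaG0 R n (fun l => rho l *m Ptilde R n ^+ b),
      gauge_equation D S gamma eta V &
      monodromy_equation D S gamma C V (fun l => cmx (rho l))].

End Potentials.

(* Main.v *)
Require Import Defs.
From HB Require Import structures.
From mathcomp Require Import all_boot all_order all_algebra.
From mathcomp Require Import complex ring lra.
From mathcomp Require Import all_classical all_reals all_analysis.
Set Implicit Arguments.
Unset Strict Implicit.
Unset Printing Implicit Defensive.
Import Order.TTheory GRing.Theory Num.Theory numFieldNormedType.Exports.
Local Open Scope classical_set_scope.
Local Open Scope ring_scope.

(** Throughout, C = F W off the poles, where F is an extended frame of f and W is
a plus loop for each z. Everything rests on two principles. First, two solutions
of dX = X om with values in the isometries of the Lorentz form differ by a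
constant left factor on a connected domain (gauge_unique, gauge_unique_holo); the
domain used is D minus the poles and their preimages, which is connected because
a set without limit points in D does not disconnect D (connected_minus_discrete).
Secondly, a plus loop that is real on the circle is constant in lambda, since a
holomorphic function on the disc with real boundary values is constant
(disc_real_circle, from the mean value property).

Existence of rho. The gauge equation says that C o gamma and C V solve the same
equation, so C o gamma = rho C V with rho independent of z. At any regular z this
gives rho = C(gamma z) V(z)^-1 C(z)^-1, and C takes its values in the identity
component because C(0) = I and the regular set is connected.

From a symmetry to a real rho. If f o gamma = A f, then
T = F(gamma, 1)^-1 A F(., 1) takes values in K up to Ptilde, so T is fixed by
sigma. Comparing the p-parts in the equation for dT, and separating the (1,0)- and
(0,1)-parts, which is possible as gamma is holomorphic, one finds that
F(gamma z, l) T(z) and F(z, l) solve the same equation for every l on the circle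
(frame_transform). Hence F(gamma z, l) T(z) = rho(l) F(z, l) with the real loop
rho(l) = F(gamma 0, l) T(0). Solving the monodromy equation for V gives
V = W^-1 T^-1 W(gamma), a plus loop up to Ptilde. For gamma = id the same argument
shows that extended frames are unique up to right multiplication by maps into K.

From a real rho to a symmetry. Put
M(z, l) = F(gamma z, l)^-1 rho(l) F(z, l) Ptilde^b. This is a real loop, and by the
monodromy equation it is also the product of W(gamma), (Ptilde^b V)^-1 and
the conjugate of W^-1 by Ptilde^b, hence a plus loop. So it does not depend on l
and is fixed by sigma, that is, block diagonal. That its blocks have determinant 1
is where the identity components enter: the value at 0 of the extension of a plus
loop is block diagonal, the determinant of its first block is 1 or -1, and this
sign is locally constant, so it is 1 on the identity component
(eps_LambdaplusGC0). Thus M takes values in K at regular points, and everywhere by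
density. This is f_l(gamma z) = rho(l) f_l(z).

On the group side, membership in SO^+(1,m) is detected by the determinant and the
sign of one entry (SOplusP). *)

(** * Convergence and derivatives of matrix functions *)
Section MatrixCalculus.

(** The topology on matrices is generated by boxes of entries, so limits can be
taken entrywise. *)
Lemma cvg_mxP (U : Type) (T : topologicalType) m n (F : set_system U)
    {FF : Filter F} (f : U -> 'M[T]_(m, n)) (M : 'M[T]_(m, n)) :
  f x @[x --> F] --> M <-> forall i j, f x i j @[x --> F] --> M i j.
Proof.
split=> [fM i j P MP|fM P [Q MQ QP]].
  have H : nbhs M [set N : 'M[T]_(m, n) | P (N i j)].
    exists (fun i' j' => if (i' == i) && (j' == j) then P else setT).
      move=> i' j'; case: ifP => [/andP[/eqP-> /eqP->] //|_]; exact: filterT.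
    by move=> N /(_ i j); rewrite !eqxx.
  exact: (fM _ H).
apply: (@filterS _ F _ [set x | forall i j, Q i j (f x i j)]).
  by move=> x Qx; exact: QP.
apply: filter_forall => i; apply: filter_forall => j.
exact: (fM i j (Q i j) (MQ i j)).
Qed.

Lemma cvg_sumr (U I : Type) (K : numFieldType) (V : normedModType K)
    (F : set_system U) {FF : Filter F} (r : seq I) (P : pred I)
    (f : I -> U -> V) (l : I -> V) :
  (forall i, P i -> f i x @[x --> F] --> l i) ->
  \sum_(i <- r | P i) f i x @[x --> F] --> \sum_(i <- r | P i) l i.
Proof. by apply: cvg_big; exact: add_continuous. Qed.

Lemma cvg_prodr (U I : Type) (K : numFieldType) (F : set_system U)
    {FF : Filter F} (r : seq I) (P : pred I) (f : I -> U -> K) (l : I -> K) :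
  (forall i, P i -> f i x @[x --> F] --> l i) ->
  \prod_(i <- r | P i) f i x @[x --> F] --> \prod_(i <- r | P i) l i.
Proof. by apply: cvg_big; exact: mul_continuous. Qed.

Lemma cvg_mulmx (U : Type) (K : numFieldType) m n p (F : set_system U)
    {FF : Filter F} (f : U -> 'M[K]_(m, n)) (g : U -> 'M[K]_(n, p))
    (A : 'M[K]_(m, n)) (B : 'M[K]_(n, p)) :
  f x @[x --> F] --> A -> g x @[x --> F] --> B ->
  f x *m g x @[x --> F] --> A *m B.
Proof.
move=> /cvg_mxP fA /cvg_mxP gB; apply/cvg_mxP => i j.
rewrite mxE; under eq_fun do rewrite mxE.
by apply: cvg_sumr => k _; apply: cvgM; [exact: fA|exact: gB].
Qed.

Lemma cvg_scalemx (U : Type) (K : numFieldType) m n (F : set_system U)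
    {FF : Filter F} (k : U -> K) (f : U -> 'M[K]_(m, n)) (a : K) (A : 'M[K]_(m, n)) :
  k x @[x --> F] --> a -> f x @[x --> F] --> A ->
  k x *: f x @[x --> F] --> a *: A.
Proof.
move=> ka /cvg_mxP fA; apply/cvg_mxP => i j.
by rewrite mxE; under eq_fun do rewrite mxE; apply: cvgM => //; exact: fA.
Qed.

Lemma cvg_trmx (U : Type) (T : topologicalType) m n (F : set_system U)
    {FF : Filter F} (f : U -> 'M[T]_(m, n)) (A : 'M[T]_(m, n)) :
  f x @[x --> F] --> A -> (f x)^T @[x --> F] --> A^T.
Proof.
move=> /cvg_mxP fA; apply/cvg_mxP => i j.
by rewrite mxE; under eq_fun do rewrite mxE; exact: fA.
Qed.

Lemma cvg_det (U : Type) (K : numFieldType) m (F : set_system U)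
    {FF : Filter F} (f : U -> 'M[K]_m) (A : 'M[K]_m) :
  f x @[x --> F] --> A -> \det (f x) @[x --> F] --> \det A.
Proof.
move=> /cvg_mxP fA; apply: cvg_sumr => s _; apply: cvgM; first exact: cvg_cst.
apply: cvg_prodr => i _.
exact: fA.
Qed.

(** The library predicate bundles differentiability with the value of the
derivative; as a single limit it can be handled by the convergence lemmas. *)
Lemma is_deriveP (K : numFieldType) (V W : normedModType K) (f : V -> W) x v df :
  is_derive x v f df <->
  h^-1 *: (f (h *: v + x) - f x) @[h --> 0^'] --> df.
Proof.
split=> [[fl <-]|fl]; first exact: fl.
apply: DeriveDef; first by apply/cvg_ex; exists df.
exact: cvg_lim.
Qed.

Lemma is_derive_mxP (K : numFieldType) (V : normedModType K) m n
    (f : V -> 'M[K]_(m, n)) x v df :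
  is_derive x v f df <-> forall i j, is_derive x v (fun y => f y i j) (df i j).
Proof.
have qE i j h : (h^-1 *: (f (h *: v + x) - f x)) i j =
    h^-1 *: (f (h *: v + x) i j - f x i j) by rewrite !mxE.
rewrite is_deriveP cvg_mxP.
split => H i j; first by apply/is_deriveP; under eq_fun do rewrite -qE; exact: H.
by under eq_fun do rewrite qE; apply/is_deriveP; exact: H.
Qed.

Lemma is_derive_mulmx (K : numFieldType) (V : normedModType K) m n p
    (f : V -> 'M[K]_(m, n)) (g : V -> 'M[K]_(n, p)) x v df dg :
  is_derive x v f df -> is_derive x v g dg ->
  is_derive x v (fun y => f y *m g y) (df *m g x + f x *m dg).
Proof.
move=> /is_derive_mxP fA /is_derive_mxP gB; apply/is_derive_mxP => i j.
rewrite (_ : (fun y => _) = \sum_k ((fun y => f y i k) * (fun y => g y k j))).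
  rewrite !mxE -big_split /=.
  apply: is_derive_sum => k; apply: is_derive_eq.
  by rewrite addrC; congr (_ + _); rewrite mulrC.
by apply/funext => y; rewrite mxE fct_sumE.
Qed.

Lemma is_derive_trmx (K : numFieldType) (V : normedModType K) m n
    (f : V -> 'M[K]_(m, n)) x v df :
  is_derive x v f df -> is_derive x v (fun y => (f y)^T) df^T.
Proof.
move=> /is_derive_mxP fA; apply/is_derive_mxP => i j.
by rewrite mxE; under eq_fun do rewrite mxE; exact: fA.
Qed.

Lemma entry_continuous (T : topologicalType) m n i j :
  continuous (fun A : 'M[T]_(m, n) => A i j).
Proof. by move=> A; exact: (@cvg_mxP _ _ _ _ (nbhs A) (nbhs_filter A) id A).1. Qed.

End MatrixCalculus.

(** * Goursat's theorem for rectangles *)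
Section Integral.
Variable R : realType.
Implicit Types (a b c e : R) (f : R -> R).

Definition integral_itv a b f : R :=
  Rintegral (@lebesgue_measure R) `[a, b] f.

Lemma integrable_itv a b f : {within `[a, b], continuous f} ->
  (@lebesgue_measure R).-integrable `[a, b] (EFin \o f).
Proof. by apply: continuous_compact_integrable; exact: segment_compact. Qed.

Lemma integral_itv_split a b c f : a <= b -> b <= c ->
  {within `[a, c], continuous f} ->
  integral_itv a c f = integral_itv a b f + integral_itv b c f.
Proof.
move=> ab bc /integrable_itv fi.
have := @Rintegral_itvB R f (BLeft a) (BRight c) b fi.
rewrite !bnd_simp => /(_ ab bc) /eqP; rewrite subr_eq addrC => /eqP.
rewrite /integral_itv => ->; congr (_ + _).
apply: Rintegral_itv_obnd_cbnd.
apply: integrableS fi => //.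
by apply: subset_itvr; rewrite bnd_simp.
Qed.

(** All integrals below are estimated in this form, through a pointwise bound around
a constant. *)
Lemma integral_itv_near a b c e f : a <= b ->
  {within `[a, b], continuous f} ->
  (forall x, a <= x <= b -> `|f x - c| <= e) ->
  `|integral_itv a b f - c * (b - a)| <= e * (b - a).
Proof.
move=> ab fc fe.
have mI : measurable (`[a, b]%classic : set (measurableTypeR R)) by [].
have muE : fine (@lebesgue_measure R `[a, b]) = b - a.
  rewrite lebesgue_measure_itv /= lte_fin; case: ltP => //= ba.
  by apply/esym/eqP; rewrite subr_eq0 eq_le ab ba.
have cE (k : R) : integral_itv a b (fun=> k) = k * (b - a).
  by rewrite /integral_itv Rintegral_cst // muE.
have ci (k : R) : {within `[a, b], continuous (fun=> k : R)}.
  by apply: continuous_subspaceT; exact: cst_continuous.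
rewrite -!cE ler_distl; apply/andP; split.
- rewrite /integral_itv -RintegralB //; [|exact: integrable_itv..].
  apply: le_Rintegral => //; last 1 first.
  + by move=> x /=; rewrite in_itv /= => /fe; rewrite ler_distl => /andP[].
  + by apply: (@integrable_itv a b (fun=> c - e)); exact: ci.
  + exact: integrable_itv.
- rewrite /integral_itv -RintegralD //; [|exact: integrable_itv..].
  apply: le_Rintegral => //; last 1 first.
  + by move=> x /=; rewrite in_itv /= => /fe; rewrite ler_distl => /andP[].
  + exact: integrable_itv.
  + by apply: (@integrable_itv a b (fun=> c + e)); exact: ci.
Qed.

Lemma integral_itvB a b f g :
  {within `[a, b], continuous f} -> {within `[a, b], continuous g} ->
  integral_itv a b (fun x => f x - g x) = integral_itv a b f - integral_itv a b g.
Proof.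
by move=> fc gc; rewrite /integral_itv RintegralB //; exact: integrable_itv.
Qed.

End Integral.

Section Goursat.
Variable R : realType.
Implicit Types (s t a b e d : R) (p q : R -> R -> R).

(** Frechet differentiability in two real variables, with increments measured by the
sum of their absolute values; a and b are the partial derivatives. *)
Definition diff_at p s t a b := forall e, 0 < e -> exists2 d, 0 < d &
  forall s' t', `|s' - s| < d -> `|t' - t| < d ->
    `|p s' t' - p s t - (a * (s' - s) + b * (t' - t))| <=
      e * (`|s' - s| + `|t' - t|).

Lemma diff_at_continuous p s t a b : diff_at p s t a b ->
  forall e, 0 < e -> exists2 d, 0 < d &
    forall s' t', `|s' - s| < d -> `|t' - t| < d -> `|p s' t' - p s t| < e.
Proof.
move=> /(_ 1 ltr01)[d d0 dP] e e0.
pose M := 1 + `|a| + `|b|.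
have M0 : 0 < M by rewrite /M ltr_wpDr ?normr_ge0// ltr_wpDr ?normr_ge0.
exists (Num.min d (e / (4 * M))).
  by rewrite lt_min d0 divr_gt0// mulr_gt0.
move=> s' t'; rewrite !lt_min => /andP[sd se] /andP[td te].
have := dP _ _ sd td; rewrite mul1r => H.
have Hs : M * `|s' - s| < e / 4.
  by rewrite mulrC -ltr_pdivlMr//; move: se; rewrite invfM mulrA.
have Ht : M * `|t' - t| < e / 4.
  by rewrite mulrC -ltr_pdivlMr//; move: te; rewrite invfM mulrA.
have -> : p s' t' - p s t = (p s' t' - p s t - (a * (s' - s) + b * (t' - t))) +
  (a * (s' - s) + b * (t' - t)) by ring.
apply: le_lt_trans (ler_normD _ _) _.
have H2 : `|a * (s' - s) + b * (t' - t)| <= `|a| * `|s' - s| + `|b| * `|t' - t|.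
  by rewrite -!normrM; exact: ler_normD.
have := normr_ge0 a; have := normr_ge0 b.
have := normr_ge0 (s' - s); have := normr_ge0 (t' - t).
rewrite /M in Hs Ht; nra.
Qed.

Lemma diff_at_slice1 p s t a b : diff_at p s t a b -> {for s, continuous (p^~ t)}.
Proof.
move=> /diff_at_continuous H; apply/cvgrPdist_lt => e e0.
have [d d0 dP] := H e e0; near=> s'.
rewrite distrC; apply: dP; last by rewrite subrr normr0.
by rewrite distrC; near: s'; exact: cvgr_dist_lt.
Unshelve. all: by end_near. Qed.

Lemma diff_at_slice2 p s t a b : diff_at p s t a b -> {for t, continuous (p s)}.
Proof.
move=> /diff_at_continuous H; apply/cvgrPdist_lt => e e0.
have [d d0 dP] := H e e0; near=> s'.
rewrite distrC; apply: dP; first by rewrite subrr normr0.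
by rewrite distrC; near: s'; exact: cvgr_dist_lt.
Unshelve. all: by end_near. Qed.

(** The integral of p ds - q dt along the boundary of the rectangle Q, given by its
two pairs of coordinates. *)
Definition circulation p q (Q : (R * R) * (R * R)) : R :=
  integral_itv Q.1.1 Q.1.2 (fun s => p s Q.2.1 - p s Q.2.2) -
  integral_itv Q.2.1 Q.2.2 (fun t => q Q.1.2 t - q Q.1.1 t).

Definition in_rect (Q : (R * R) * (R * R)) s t :=
  Q.1.1 <= s <= Q.1.2 /\ Q.2.1 <= t <= Q.2.2.

(** The number b shared by the two derivatives says that p ds - q dt is closed at
each point. *)
Definition closed_form p q Q := forall s t, in_rect Q s t ->
  exists a b b', diff_at p s t a b /\ diff_at q s t (- b) b'.

Lemma closed_form_sub p q Q Q' : Q.1.1 <= Q'.1.1 -> Q'.1.2 <= Q.1.2 ->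
  Q.2.1 <= Q'.2.1 -> Q'.2.2 <= Q.2.2 -> closed_form p q Q -> closed_form p q Q'.
Proof.
move=> a b c d H s t [/andP[h1 h2] /andP[h3 h4]]; apply: H; split; apply/andP; split.
- exact: le_trans h1.
- exact: le_trans b.
- exact: le_trans h3.
- exact: le_trans d.
Qed.

Section slices.
Variables (p q : R -> R -> R) (Q : (R * R) * (R * R)).
Hypothesis cf : closed_form p q Q.

Lemma slice_p t : Q.2.1 <= t <= Q.2.2 ->
  {within `[Q.1.1, Q.1.2], continuous (p^~ t)}.
Proof.
move=> tQ; apply: continuous_in_subspaceT => s; rewrite inE /= in_itv /= => sQ.
by have [a [b [b' [/diff_at_slice1 + _]]]] := cf (conj sQ tQ).
Qed.

Lemma slice_q s : Q.1.1 <= s <= Q.1.2 ->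
  {within `[Q.2.1, Q.2.2], continuous (q s)}.
Proof.
move=> sQ; apply: continuous_in_subspaceT => t; rewrite inE /= in_itv /= => tQ.
by have [a [b [b' [_ /diff_at_slice2]]]] := cf (conj sQ tQ).
Qed.

End slices.

Lemma withinB (A : set R) (f g : R -> R) : {within A, continuous f} ->
  {within A, continuous g} -> {within A, continuous (fun x => f x - g x)}.
Proof. by move=> fA gA x; apply: cvgB; [exact: fA|exact: gA]. Qed.

Lemma circulation_split1 p q s1 s s2 t1 t2 : s1 <= s -> s <= s2 -> t1 <= t2 ->
  closed_form p q ((s1, s2), (t1, t2)) ->
  circulation p q ((s1, s2), (t1, t2)) =
  circulation p q ((s1, s), (t1, t2)) + circulation p q ((s, s2), (t1, t2)).
Proof.
move=> s1s ss2 t12 cf; rewrite /circulation /=.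
rewrite (integral_itv_split s1s ss2); last first.
  by apply: withinB; [apply: (slice_p cf)|apply: (slice_p cf)] => /=; rewrite lexx ?t12.
have qc x : s1 <= x <= s2 -> {within `[t1, t2], continuous (q x)}.
  by move=> xs; exact: (slice_q cf).
have qB x y : s1 <= x <= s2 -> s1 <= y <= s2 ->
    integral_itv t1 t2 (fun t => q y t - q x t) =
    integral_itv t1 t2 (q y) - integral_itv t1 t2 (q x).
  by move=> xs ys; apply: integral_itvB; exact: qc.
have s1I : s1 <= s1 <= s2 by rewrite lexx (le_trans s1s).
have sI : s1 <= s <= s2 by rewrite s1s.
have s2I : s1 <= s2 <= s2 by rewrite lexx (le_trans s1s).
by rewrite !qB//; ring.
Qed.

Lemma circulation_split2 p q s1 s2 t1 t t2 : s1 <= s2 -> t1 <= t -> t <= t2 ->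
  closed_form p q ((s1, s2), (t1, t2)) ->
  circulation p q ((s1, s2), (t1, t2)) =
  circulation p q ((s1, s2), (t1, t)) + circulation p q ((s1, s2), (t, t2)).
Proof.
move=> s12 t1t tt2 cf; rewrite /circulation /=.
rewrite (integral_itv_split t1t tt2); last first.
  by apply: withinB; [apply: (slice_q cf)|apply: (slice_q cf)] => /=; rewrite lexx ?s12.
have pc x : t1 <= x <= t2 -> {within `[s1, s2], continuous (p^~ x)}.
  by move=> xs; exact: (slice_p cf).
have pB x y : t1 <= x <= t2 -> t1 <= y <= t2 ->
    integral_itv s1 s2 (fun s => p s x - p s y) =
    integral_itv s1 s2 (p^~ x) - integral_itv s1 s2 (p^~ y).
  by move=> xt yt; apply: integral_itvB; exact: pc.
have t1I : t1 <= t1 <= t2 by rewrite lexx (le_trans t1t).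
have tI : t1 <= t <= t2 by rewrite t1t.
have t2I : t1 <= t2 <= t2 by rewrite lexx (le_trans t1t).
by rewrite !pB//; ring.
Qed.

Definition semiperimeter (Q : (R * R) * (R * R)) := (Q.1.2 - Q.1.1) + (Q.2.2 - Q.2.1).

(** The affine parts of p and q at a point of the rectangle contribute nothing,
since the closedness condition makes their circulations cancel; only the two
remainders are left. *)
Lemma circulation_small p q s1 s2 t1 t2 s t a b b' e d :
  closed_form p q ((s1, s2), (t1, t2)) ->
  in_rect ((s1, s2), (t1, t2)) s t ->
  (forall s' t', `|s' - s| < d -> `|t' - t| < d ->
    `|p s' t' - p s t - (a * (s' - s) + b * (t' - t))| <=
      e * (`|s' - s| + `|t' - t|)) ->
  (forall s' t', `|s' - s| < d -> `|t' - t| < d ->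
    `|q s' t' - q s t - ((- b) * (s' - s) + b' * (t' - t))| <=
      e * (`|s' - s| + `|t' - t|)) ->
  0 <= e -> s2 - s1 < d -> t2 - t1 < d ->
  `|circulation p q ((s1, s2), (t1, t2))| <=
    2 * e * semiperimeter ((s1, s2), (t1, t2)) ^+ 2.
Proof.
move=> cf [/= /andP[s1s ss2] /andP[t1t tt2]] pP qP e0 sd td.
set L := semiperimeter _.
have LE : L = (s2 - s1) + (t2 - t1) by [].
have s12 := le_trans s1s ss2; have t12 := le_trans t1t tt2.
have bnd (r : R -> R -> R) (x y : R) s' t' :
    (forall s' t', `|s' - s| < d -> `|t' - t| < d ->
    `|r s' t' - r s t - (x * (s' - s) + y * (t' - t))| <=
      e * (`|s' - s| + `|t' - t|)) -> s1 <= s' <= s2 -> t1 <= t' <= t2 ->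
    `|r s' t' - r s t - (x * (s' - s) + y * (t' - t))| <= e * L.
  move=> rP /andP[s1s' s's2] /andP[t1t' t't2].
  have hs : `|s' - s| <= s2 - s1 by rewrite ler_norml; apply/andP; split; lra.
  have ht : `|t' - t| <= t2 - t1 by rewrite ler_norml; apply/andP; split; lra.
  apply: le_trans (rP _ _ _ _) _; [exact: le_lt_trans hs sd|exact: le_lt_trans ht td|].
  by rewrite ler_wpM2l// LE lerD.
have I1 : `|integral_itv s1 s2 (fun s => p s t1 - p s t2) -
     (b * (t1 - t2)) * (s2 - s1)| <= (2 * e * L) * (s2 - s1).
  apply: integral_itv_near => //.
    by apply: withinB; [apply: (slice_p cf)|apply: (slice_p cf)] => /=; rewrite lexx ?t12.
  move=> x xs.
  have := bnd p a b x t1 pP xs; rewrite lexx t12 => /(_ isT); rewrite ler_norml => /andP[h1 h2].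
  have := bnd p a b x t2 pP xs; rewrite lexx t12 => /(_ isT); rewrite ler_norml => /andP[h3 h4].
  by rewrite ler_norml; apply/andP; split; lra.
have I2 : `|integral_itv t1 t2 (fun t => q s2 t - q s1 t) -
     ((- b) * (s2 - s1)) * (t2 - t1)| <= (2 * e * L) * (t2 - t1).
  apply: integral_itv_near => //.
    by apply: withinB; [apply: (slice_q cf)|apply: (slice_q cf)] => /=; rewrite lexx ?s12.
  move=> x xs.
  have := bnd q (- b) b' s1 x qP; rewrite lexx s12 => /(_ isT xs); rewrite ler_norml => /andP[h1 h2].
  have := bnd q (- b) b' s2 x qP; rewrite lexx s12 => /(_ isT xs); rewrite ler_norml => /andP[h3 h4].
  by rewrite ler_norml; apply/andP; split; lra.
rewrite /circulation /=.
move: I1 I2; rewrite !ler_norml => /andP[i1 i2] /andP[i3 i4].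
have -> : 2 * e * L ^+ 2 = 2 * e * L * (s2 - s1) + 2 * e * L * (t2 - t1).
  by rewrite {2 3}LE LE; ring.
apply/andP; split; nra.
Qed.

(** If the circulation exceeds c times the squared semiperimeter, it does so on one
of the four quarters: the circulation is additive and the squared semiperimeter is
divided by exactly 4. *)
Lemma halving_step p q (Q : (R * R) * (R * R)) (c : R) :
  Q.1.1 <= Q.1.2 -> Q.2.1 <= Q.2.2 -> closed_form p q Q ->
  c * semiperimeter Q ^+ 2 < `|circulation p q Q| ->
  exists Q' : (R * R) * (R * R),
    [/\ Q.1.1 <= Q'.1.1 /\ Q'.1.2 <= Q.1.2, Q.2.1 <= Q'.2.1 /\ Q'.2.2 <= Q.2.2,
      Q'.1.2 - Q'.1.1 = (Q.1.2 - Q.1.1) / 2, Q'.2.2 - Q'.2.1 = (Q.2.2 - Q.2.1) / 2 &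
      c * semiperimeter Q' ^+ 2 < `|circulation p q Q'|].
Proof.
case: Q => -[s1 s2] [t1 t2] /= s12 t12 cf.
pose s := (s1 + s2) / 2; pose t := (t1 + t2) / 2.
have s1s : s1 <= s by rewrite /s; lra.
have ss2 : s <= s2 by rewrite /s; lra.
have t1t : t1 <= t by rewrite /t; lra.
have tt2 : t <= t2 by rewrite /t; lra.
rewrite (circulation_split1 s1s ss2)//.
rewrite (circulation_split2 s1s t1t tt2); last exact: closed_form_sub cf.
rewrite (circulation_split2 ss2 t1t tt2); last exact: closed_form_sub cf.
move=> H; apply/not_existsP => no.
have small Q' : [/\ s1 <= Q'.1.1 /\ Q'.1.2 <= s2, t1 <= Q'.2.1 /\ Q'.2.2 <= t2,
      Q'.1.2 - Q'.1.1 = (s2 - s1) / 2 & Q'.2.2 - Q'.2.1 = (t2 - t1) / 2] ->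
      `|circulation p q Q'| <= c * ((s2 - s1 + (t2 - t1)) / 2) ^+ 2.
  move=> [h1 h2 h3 h4]; rewrite leNgt; apply/negP => h5; apply: (no Q').
  by split => //; rewrite /semiperimeter h3 h4 -mulrDl.
have H1 : `|circulation p q ((s1, s), (t1, t))| <= c * ((s2 - s1 + (t2 - t1)) / 2) ^+ 2.
  by apply: small; split => //=; rewrite ?lexx /s /t; lra.
have H2 : `|circulation p q ((s1, s), (t, t2))| <= c * ((s2 - s1 + (t2 - t1)) / 2) ^+ 2.
  by apply: small; split => //=; rewrite ?lexx /s /t; lra.
have H3 : `|circulation p q ((s, s2), (t1, t))| <= c * ((s2 - s1 + (t2 - t1)) / 2) ^+ 2.
  by apply: small; split => //=; rewrite ?lexx /s /t; lra.
have H4 : `|circulation p q ((s, s2), (t, t2))| <= c * ((s2 - s1 + (t2 - t1)) / 2) ^+ 2.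
  by apply: small; split => //=; rewrite ?lexx /s /t; lra.
have : `|circulation p q (s1, s, (t1, t)) + circulation p q (s1, s, (t, t2)) +
      (circulation p q (s, s2, (t1, t)) + circulation p q (s, s2, (t, t2)))| <=
   4 * (c * ((s2 - s1 + (t2 - t1)) / 2) ^+ 2).
  apply: le_trans (ler_normD _ _) _.
  apply: le_trans (lerD (ler_normD _ _) (ler_normD _ _)) _.
  lra.
move=> H5; have := lt_le_trans H H5; rewrite /semiperimeter /=.
suff -> : 4 * (c * ((s2 - s1 + (t2 - t1)) / 2) ^+ 2) = c * (s2 - s1 + (t2 - t1)) ^+ 2.
  by rewrite ltxx.
by field.
Qed.

(** Goursat's argument: a nonzero circulation would survive, relative to the squared
size, on a nested sequence of rectangles shrinking to a point, against the
differentiability there. *)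
Theorem goursat p q s1 s2 t1 t2 : s1 < s2 -> t1 < t2 ->
  closed_form p q ((s1, s2), (t1, t2)) ->
  circulation p q ((s1, s2), (t1, t2)) = 0.
Proof.
move=> s12 t12 cf; apply/eqP; rewrite -normr_le0 leNgt; apply/negP => neq.
set Q0 := ((s1, s2), (t1, t2)) in cf neq *.
pose L := semiperimeter Q0.
have L0 : 0 < L by rewrite /L /semiperimeter /=; lra.
(* The factor 2 makes the inequality to be propagated strict at the start. *)
pose c := `|circulation p q Q0| / (2 * L ^+ 2).
have c0 : 0 < c by rewrite divr_gt0// mulr_gt0// exprn_gt0.
have bad0 : c * semiperimeter Q0 ^+ 2 < `|circulation p q Q0|.
  have -> : c * semiperimeter Q0 ^+ 2 = `|circulation p q Q0| / 2.
    by rewrite /c -/L; field; rewrite gt_eqF.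
  by rewrite ltr_pdivrMr//; lra.
pose good (Q : (R * R) * (R * R)) := [/\ Q.1.1 <= Q.1.2, Q.2.1 <= Q.2.2, closed_form p q Q &
  c * semiperimeter Q ^+ 2 < `|circulation p q Q|].
have /choice[next nextP] : forall Q, exists Q', good Q ->
   [/\ Q.1.1 <= Q'.1.1 /\ Q'.1.2 <= Q.1.2, Q.2.1 <= Q'.2.1 /\ Q'.2.2 <= Q.2.2,
      Q'.1.2 - Q'.1.1 = (Q.1.2 - Q.1.1) / 2, Q'.2.2 - Q'.2.1 = (Q.2.2 - Q.2.1) / 2 &
      good Q'].
  move=> Q; have [gQ|] := pselect (good Q); last by exists Q.
  have [Q1 Q2 Q3 Q4] := gQ; have [Q' [h1 h2 h3 h4 h5]] := halving_step Q1 Q2 Q3 Q4.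
  exists Q' => _; split=> //; split => //.
  - by rewrite -subr_ge0 h3 divr_ge0// subr_ge0.
  - by rewrite -subr_ge0 h4 divr_ge0// subr_ge0.
  - by apply: closed_form_sub Q3; [case: h1|case: h1|case: h2|case: h2].
pose Qn k := iter k next Q0.
have gQ k : good (Qn k).
  elim: k => [|k ih]; first by split => //=; exact: ltW.
  by have [] := nextP _ ih.
have stepP k := nextP _ (gQ k).
have size1 k : (Qn k).1.2 - (Qn k).1.1 = (s2 - s1) / 2 ^+ k.
  elim: k => [|k ih]; first by rewrite expr0 divr1.
  by have [_ _ + _ _] := stepP k; rewrite -/(Qn k.+1) ih => ->; rewrite exprSr invfM mulrA.
have size2 k : (Qn k).2.2 - (Qn k).2.1 = (t2 - t1) / 2 ^+ k.
  elim: k => [|k ih]; first by rewrite expr0 divr1.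
  by have [_ _ _ + _] := stepP k; rewrite -/(Qn k.+1) ih => ->; rewrite exprSr invfM mulrA.
have mono k j : (k <= j)%N -> [/\ (Qn k).1.1 <= (Qn j).1.1, (Qn j).1.2 <= (Qn k).1.2,
   (Qn k).2.1 <= (Qn j).2.1 & (Qn j).2.2 <= (Qn k).2.2].
  elim: j => [|j ih]; first by rewrite leqn0 => /eqP ->.
  rewrite leq_eqVlt => /predU1P[->//|]; rewrite ltnS => /ih[a1 a2 a3 a4].
  have [[b1 b2] [b3 b4] _ _ _] := stepP j; rewrite -/(Qn j.+1) in b1 b2 b3 b4.
  by split; [exact: le_trans b1|exact: le_trans a2|exact: le_trans b3|exact: le_trans a4].
have cross k j : (Qn k).1.1 <= (Qn j).1.2 /\ (Qn k).2.1 <= (Qn j).2.2.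
  have [a1 a2 a3 a4] := mono k (maxn k j) (leq_maxl _ _).
  have [b1 b2 b3 b4] := mono j (maxn k j) (leq_maxr _ _).
  have [c1 c2 _ _] := gQ (maxn k j).
  by split; [exact: le_trans a1 (le_trans c1 b2)|exact: le_trans a3 (le_trans c2 b4)].
pose s := sup (range (fun k => (Qn k).1.1)).
pose t := sup (range (fun k => (Qn k).2.1)).
have sP k : (Qn k).1.1 <= s <= (Qn k).1.2.
  apply/andP; split.
    by apply: ub_le_sup; [exists (Qn k).1.2 => _ [j _ <-]; case: (cross j k)|exists k].
  by apply: ge_sup; [exists s1, 0%N|move=> _ [j _ <-]; case: (cross j k)].
have tP k : (Qn k).2.1 <= t <= (Qn k).2.2.
  apply/andP; split.
    by apply: ub_le_sup; [exists (Qn k).2.2 => _ [j _ <-]; case: (cross j k)|exists k].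
  by apply: ge_sup; [exists t1, 0%N|move=> _ [j _ <-]; case: (cross j k)].
have [a [b [b' [dp dq]]]] := cf s t (conj (sP 0%N) (tP 0%N)).
have c20 : 0 < c / 2 by rewrite divr_gt0.
have [d1 d10 d1P] := dp _ c20; have [d2 d20 d2P] := dq _ c20.
pose d := Num.min d1 d2.
have d0 : 0 < d by rewrite lt_min d10.
have [k kP] : exists k : nat, L < d * 2 ^+ k.
  exists (Num.trunc (L / d)).+1.
  rewrite mulrC -ltr_pdivrMr//.
  apply: lt_trans (truncnS_gt _) _.
  by rewrite -natrX ltr_nat ltn_expl.
have kd x : 0 <= x -> x <= L -> x / 2 ^+ k < d.
  by move=> x0 xL; rewrite ltr_pdivrMr ?exprn_gt0//; exact: le_lt_trans kP.
have [_ _ cfk badk] := gQ k.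
have := @circulation_small p q (Qn k).1.1 (Qn k).1.2 (Qn k).2.1 (Qn k).2.2 s t a b b' (c / 2) d.
have -> : ((Qn k).1.1, (Qn k).1.2, ((Qn k).2.1, (Qn k).2.2)) = Qn k.
  by case: (Qn k) => -[? ?] [? ?].
move=> /(_ cfk (conj (sP k) (tP k))) small.
have : `|circulation p q (Qn k)| <= 2 * (c / 2) * semiperimeter (Qn k) ^+ 2.
  apply: small.
  - by move=> s' t'; rewrite !lt_min => /andP[? _] /andP[? _]; exact: d1P.
  - by move=> s' t'; rewrite !lt_min => /andP[_ ?] /andP[_ ?]; exact: d2P.
  - exact: ltW.
  - by rewrite size1; apply: kd; rewrite /L /semiperimeter /=; lra.
  - by rewrite size2; apply: kd; rewrite /L /semiperimeter /=; lra.
have -> : 2 * (c / 2) = c by field.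
by rewrite leNgt badk.
Qed.

End Goursat.

(** * The complex plane in real coordinates *)
Section ComplexPlane.
Variable R : realType.
Implicit Types (z w l : cplx R) (x y e d : R).

Lemma recplxE x y : recplx (mkcplx x y) = x. Proof. by []. Qed.
Lemma imcplxE x y : imcplx (mkcplx x y) = y. Proof. by []. Qed.
Lemma recplxC x : recplx (tocplx x) = x. Proof. by []. Qed.
Lemma imcplxC x : imcplx (tocplx x) = 0. Proof. by []. Qed.
Lemma recplx0 : recplx (0 : cplx R) = 0. Proof. by []. Qed.
Lemma imcplx0 : imcplx (0 : cplx R) = 0. Proof. by []. Qed.
Lemma recplx1 : recplx (1 : cplx R) = 1. Proof. by []. Qed.
Lemma imcplx1 : imcplx (1 : cplx R) = 0. Proof. by []. Qed.
Lemma recplxi : recplx ('i : cplx R) = 0. Proof. by []. Qed.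
Lemma imcplxi : imcplx ('i : cplx R) = 1. Proof. by []. Qed.
Lemma recplxD z w : recplx (z + w) = recplx z + recplx w.
Proof. by case: z w => a b [c d]. Qed.
Lemma imcplxD z w : imcplx (z + w) = imcplx z + imcplx w.
Proof. by case: z w => a b [c d]. Qed.
Lemma recplxN z : recplx (- z) = - recplx z.
Proof. by case: z. Qed.
Lemma imcplxN z : imcplx (- z) = - imcplx z.
Proof. by case: z. Qed.
Lemma recplxM z w : recplx (z * w) = recplx z * recplx w - imcplx z * imcplx w.
Proof. by case: z w => a b [c d]. Qed.
Lemma imcplxM z w : imcplx (z * w) = recplx z * imcplx w + imcplx z * recplx w.
Proof. by case: z w => a b [c d]. Qed.

Definition recimE := (recplxD, imcplxD, recplxN, imcplxN, recplxM, imcplxM,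
  recplxC, imcplxC, recplx0, imcplx0, recplx1, imcplx1, recplxi, imcplxi,
  recplxE, imcplxE).

Lemma cplx_eq z w : recplx z = recplx w -> imcplx z = imcplx w -> z = w.
Proof. by case: z w => a b [c d] /= -> ->. Qed.

Lemma mkcplx_id z : mkcplx (recplx z) (imcplx z) = z. Proof. by case: z. Qed.

Lemma tocplxM x y : tocplx (x * y) = tocplx x * tocplx y.
Proof. by apply: cplx_eq; rewrite !recimE; ring. Qed.

Lemma norm_cplx z : `|z| = tocplx (Num.sqrt (recplx z ^+ 2 + imcplx z ^+ 2)).
Proof. exact: normc_def. Qed.

Lemma ltcR_tocplx x y : (tocplx x < tocplx y) = (x < y). Proof. exact: ltcR. Qed.
Lemma lecR_tocplx x y : (tocplx x <= tocplx y) = (x <= y). Proof. exact: lecR. Qed.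

Lemma gt0_cplx z : 0 < z -> z = tocplx (recplx z) /\ 0 < recplx z.
Proof.
rewrite /recplx /tocplx; case: z => a b; rewrite ltcE /= => /andP[/eqP -> a0].
by split.
Qed.

Lemma norm_re z : tocplx `|recplx z| <= `|z|.
Proof. by rewrite norm_cplx lecR_tocplx -sqrtr_sqr ler_wsqrtr// lerDl sqr_ge0. Qed.

Lemma norm_im z : tocplx `|imcplx z| <= `|z|.
Proof. by rewrite norm_cplx lecR_tocplx -sqrtr_sqr ler_wsqrtr// lerDr sqr_ge0. Qed.

Lemma norm_le_reim z : `|z| <= tocplx (`|recplx z| + `|imcplx z|).
Proof.
rewrite norm_cplx lecR_tocplx -[leRHS]ger0_norm ?addr_ge0//.
rewrite -sqrtr_sqr ler_wsqrtr// -(real_normK (num_real (recplx z))).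
rewrite -(real_normK (num_real (imcplx z))).
have := normr_ge0 (recplx z); have := normr_ge0 (imcplx z); nra.
Qed.

(** The square neighbourhoods of a point, on which real and imaginary part can be
estimated separately. *)
Lemma nbhs_cplxP z (A : set (cplx R)) :
  nbhs z A <-> exists2 d, 0 < d & forall w,
    `|recplx w - recplx z| < d -> `|imcplx w - imcplx z| < d -> A w.
Proof.
split=> [/nbhs_ballP[e /= e0 eA]|[d d0 dA]].
  have [eE e0'] := gt0_cplx e0.
  exists (recplx e / 2); first by rewrite divr_gt0.
  move=> w h1 h2; apply: eA; rewrite /ball /= distrC.
  apply: le_lt_trans (norm_le_reim _) _; rewrite eE ltcR_tocplx !recimE; lra.
apply/nbhs_ballP; exists (tocplx d); first by rewrite /= ltcR_tocplx.
move=> w; rewrite /ball /= distrC => wd; apply: dA.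
  by rewrite -ltcR_tocplx; apply: le_lt_trans wd; have := norm_re (w - z); rewrite !recimE.
by rewrite -ltcR_tocplx; apply: le_lt_trans wd; have := norm_im (w - z); rewrite !recimE.
Qed.

Lemma cvg_cplxP (U : Type) (F : set_system U) (FF : Filter F) (f : U -> cplx R) z :
  f x @[x --> F] --> z <->
  (recplx (f x) @[x --> F] --> recplx z) /\ (imcplx (f x) @[x --> F] --> imcplx z).
Proof.
split=> [fz|[fr fi] A /nbhs_cplxP[d d0 dA]].
  split; apply/cvgrPdist_lt => e e0.
    apply: (fz [set w | `|recplx z - recplx w| < e]).
    by apply/nbhs_cplxP; exists e => // w; rewrite distrC.
  apply: (fz [set w | `|imcplx z - imcplx w| < e]).
  by apply/nbhs_cplxP; exists e => // w _; rewrite distrC.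
near=> x; apply: dA; rewrite distrC; near: x.
- by move/cvgrPdist_lt : fr; apply.
- by move/cvgrPdist_lt : fi; apply.
Unshelve. all: by end_near. Qed.

Lemma recplx_continuous : continuous (@recplx R).
Proof. by move=> z; have /cvg_cplxP[] : w @[w --> z] --> z by exact: cvg_id. Qed.

Lemma tocplx_continuous : continuous (@tocplx R).
Proof. by move=> z; apply/cvg_cplxP; split; [exact: cvg_id|exact: cvg_cst]. Qed.

Lemma circleP l : circle l <-> recplx l ^+ 2 + imcplx l ^+ 2 = 1.
Proof.
rewrite /circle /= norm_cplx; split=> [|->]; last by rewrite sqrtr1.
move=> /(congr1 (@recplx R)); rewrite !recimE => /(congr1 (fun x => x ^+ 2)).
by rewrite sqr_sqrtr ?expr1n// addr_ge0// sqr_ge0.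
Qed.

Lemma odiscP l : odisc l <-> recplx l ^+ 2 + imcplx l ^+ 2 < 1.
Proof.
rewrite /odisc /= norm_cplx -[1]/(tocplx 1) ltcR_tocplx.
by rewrite -{1}(sqrtr1 R) ltr_sqrt.
Qed.

Lemma cdiscP l : cdisc l <-> recplx l ^+ 2 + imcplx l ^+ 2 <= 1.
Proof.
rewrite /cdisc /= norm_cplx -[1]/(tocplx 1) lecR_tocplx.
by rewrite -{1}(sqrtr1 R) ler_sqrt.
Qed.

Lemma circleN l : circle l -> circle (- l).
Proof. by move=> /circleP h; apply/circleP; rewrite !recimE !sqrrN. Qed.

Lemma circle1 : circle (1 : cplx R). Proof. by rewrite /circle /= normr1. Qed.

Lemma odisc_cdisc l : odisc l -> cdisc l. Proof. exact: ltW. Qed.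
Lemma odisc0 : odisc (0 : cplx R). Proof. by rewrite /odisc /= normr0. Qed.

Lemma circle_expi t : circle (@expi R t).
Proof. by apply/circleP; rewrite !recimE cos2Dsin2. Qed.

Lemma expi_surj l : circle l -> exists2 t, 0 <= t <= 2 * pi & expi t = l.
Proof.
move=> /circleP h.
have x1 : -1 <= recplx l <= 1.
  rewrite -ler_norml -[leRHS](normr1 R) -ler_sqr ?nnegrE// !real_normK ?num_real//.
  by rewrite expr1n -h lerDl sqr_ge0.
have yE : sin (acos (recplx l)) = `|imcplx l|.
  by rewrite sin_acos// -h [_ ^+ 2 + _]addrC addrK sqrtr_sqr.
have t0 := acos_ge0 x1; have tp := acos_lepi x1.
have p0 := pi_ge0 R.
have [i0|i0] := leP 0 (imcplx l).
  exists (acos (recplx l)); first by rewrite t0 /=; lra.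
  by apply: cplx_eq; rewrite !recimE ?acosK ?in_itv// yE ger0_norm.
exists (2 * pi - acos (recplx l)); first by apply/andP; split; lra.
apply: cplx_eq; rewrite !recimE.
  by rewrite mulr_natl addrC cosD2pi cosN acosK ?in_itv.
by rewrite mulr_natl addrC sinD2pi sinN yE ltr0_norm// opprK.
Qed.

End ComplexPlane.

Fact tocplx_is_additive (R : realType) : additive (@tocplx R).
Proof. exact: real_complex_is_additive. Qed.

Fact tocplx_is_multiplicative (R : realType) : multiplicative (@tocplx R).
Proof. exact: real_complex_is_multiplicative. Qed.

HB.instance Definition _ (R : realType) := GRing.isAdditive.Build R (cplx R)
  (@tocplx R) (@tocplx_is_additive R).
HB.instance Definition _ (R : realType) := GRing.isMultiplicative.Build R (cplx R)
  (@tocplx R) (@tocplx_is_multiplicative R).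

(** * Differentiability in two real variables *)
Section TwoVariables.
Variable R : realType.
Implicit Types (s t a b e d : R) (p q : R -> R -> R).

(** The chain rule in two variables. In the proof M bounds all six first-order
coefficients with room to spare, so that the three remainders together stay below e.
*)
Lemma diff_at_comp (u X Y : R -> R -> R) s t a b x1 x2 y1 y2 :
  diff_at u (X s t) (Y s t) a b -> diff_at X s t x1 x2 -> diff_at Y s t y1 y2 ->
  diff_at (fun s t => u (X s t) (Y s t)) s t (a * x1 + b * y1) (a * x2 + b * y2).
Proof.
move=> du dX dY e e0.
pose M := 2 + `|x1| + `|x2| + `|y1| + `|y2| + `|a| + `|b|.
have M0 : 0 < M.
  by rewrite /M; have := (normr_ge0 x1, normr_ge0 x2, normr_ge0 y1, normr_ge0 y2,
    normr_ge0 a, normr_ge0 b); move=> [[[[[? ?] ?] ?] ?] ?]; lra.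
have e4 : 0 < e / (4 * M) by rewrite divr_gt0// mulr_gt0.
have [d du0 duP] := du _ e4.
pose e' := Num.min 1 (e / (4 * M)).
have e'0 : 0 < e' by rewrite lt_min ltr01.
have [d1 d10 d1P] := dX _ e'0; have [d2 d20 d2P] := dY _ e'0.
have [d3 d30 d3P] := diff_at_continuous dX du0.
have [d4 d40 d4P] := diff_at_continuous dY du0.
exists (Num.min (Num.min d1 d2) (Num.min d3 d4)); first by rewrite !lt_min d10 d20 d30.
move=> s' t'; rewrite !lt_min => /andP[/andP[s1 s2] /andP[s3 s4]].
move=> /andP[/andP[t1 t2] /andP[t3 t4]].
have := duP _ _ (d3P _ _ s3 t3) (d4P _ _ s4 t4).
have := d1P _ _ s1 t1; have := d2P _ _ s2 t2.
set DX := X s' t' - X s t; set DY := Y s' t' - Y s t.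
set ds := s' - s; set dt := t' - t.
set rX := DX - _; set rY := DY - _; set ru := _ - _ - (a * DX + b * DY) => hY hX hu.
set N := `|ds| + `|dt| in hX hY *.
have N0 : 0 <= N by rewrite addr_ge0.
have bX : `|DX| <= (`|x1| + `|x2| + 1) * N.
  have -> : DX = rX + (x1 * ds + x2 * dt) by rewrite /rX; ring.
  apply: le_trans (ler_normD _ _) _.
  have h : `|x1 * ds + x2 * dt| <= `|x1| * `|ds| + `|x2| * `|dt|.
    by rewrite -!normrM ler_normD.
  have h' : `|rX| <= N by apply: le_trans hX _; rewrite ler_piMl// ge_min lexx.
  have := (normr_ge0 x1, normr_ge0 x2, normr_ge0 ds, normr_ge0 dt).
  by move=> [[[? ?] ?] ?]; rewrite /N in h' *; nra.
have bY : `|DY| <= (`|y1| + `|y2| + 1) * N.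
  have -> : DY = rY + (y1 * ds + y2 * dt) by rewrite /rY; ring.
  apply: le_trans (ler_normD _ _) _.
  have h : `|y1 * ds + y2 * dt| <= `|y1| * `|ds| + `|y2| * `|dt|.
    by rewrite -!normrM ler_normD.
  have h' : `|rY| <= N by apply: le_trans hY _; rewrite ler_piMl// ge_min lexx.
  have := (normr_ge0 y1, normr_ge0 y2, normr_ge0 ds, normr_ge0 dt).
  by move=> [[[? ?] ?] ?]; rewrite /N in h' *; nra.
have -> : u (X s' t') (Y s' t') - u (X s t) (Y s t) -
   ((a * x1 + b * y1) * ds + (a * x2 + b * y2) * dt) = ru + (a * rX + b * rY).
  by rewrite /ru /rX /rY; ring.
apply: le_trans (ler_normD _ _) _.
have h1 : `|ru| <= e / 2 * N.
  apply: le_trans hu _.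
  have : `|DX| + `|DY| <= 2 * M * N.
    apply: le_trans (lerD bX bY) _.
    rewrite -mulrDl ler_wpM2r// /M.
    have := (normr_ge0 x1, normr_ge0 x2, normr_ge0 y1, normr_ge0 y2, normr_ge0 a, normr_ge0 b).
    by move=> [[[[[? ?] ?] ?] ?] ?]; lra.
  move=> h; apply: le_trans (ler_wpM2l (ltW e4) h) _.
  by have -> : e / (4 * M) * (2 * M * N) = e / 2 * N by field; rewrite gt_eqF.
have h2 : `|a * rX + b * rY| <= e / 4 * N.
  apply: le_trans (ler_normD _ _) _; rewrite !normrM.
  have e'le : e' <= e / (4 * M) by rewrite ge_min lexx orbT.
  have hX' : `|rX| <= e / (4 * M) * N by apply: le_trans hX _; rewrite ler_wpM2r.
  have hY' : `|rY| <= e / (4 * M) * N by apply: le_trans hY _; rewrite ler_wpM2r.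
  apply: le_trans (lerD (ler_wpM2l (normr_ge0 a) hX') (ler_wpM2l (normr_ge0 b) hY')) _.
  rewrite -mulrDl.
  have -> : e / 4 * N = M * (e / (4 * M) * N) by field; rewrite gt_eqF.
  rewrite ler_wpM2r//; first by rewrite mulr_ge0// ltW.
  rewrite /M.
  have := (normr_ge0 x1, normr_ge0 x2, normr_ge0 y1, normr_ge0 y2, normr_ge0 a, normr_ge0 b).
  by move=> [[[[[? ?] ?] ?] ?] ?]; lra.
apply: le_trans (lerD h1 h2) _; nra.
Qed.

Lemma diff_at_mul s t : diff_at (fun x y => x * y) s t t s.
Proof.
move=> e e0; exists e => // s' t' h1 h2.
have -> : s' * t' - s * t - (t * (s' - s) + s * (t' - t)) = (s' - s) * (t' - t) by ring.
rewrite normrM; have := (normr_ge0 (s' - s), normr_ge0 (t' - t)).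
by move=> [? ?]; nra.
Qed.

Lemma diff_at_eq p s t a b a' b' : diff_at p s t a b -> a = a' -> b = b' ->
  diff_at p s t a' b'.
Proof. by move=> h <- <-. Qed.

Lemma diff_atM p q s t a b a' b' : diff_at p s t a b -> diff_at q s t a' b' ->
  diff_at (fun s t => p s t * q s t) s t (q s t * a + p s t * a') (q s t * b + p s t * b').
Proof. by move=> dp dq; apply: (diff_at_comp (@diff_at_mul _ _) dp dq). Qed.

Lemma is_derive_approx (f : R -> R) s a : is_derive s 1 f a ->
  forall e, 0 < e -> exists2 d, 0 < d & forall s', `|s' - s| < d ->
    `|f s' - f s - a * (s' - s)| <= e * `|s' - s|.
Proof.
move=> /is_deriveP /cvgrPdist_le H e e0.
have /nbhs_ballP[d /= d0 dP] := H e e0; exists d => // s' s'd.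
have [->|s's] := eqVneq s' s; first by rewrite !subrr mulr0 subr0 normr0 mulr0.
have h0 : s' - s != 0 by rewrite subr_eq0.
have := dP (s' - s); rewrite /ball /= sub0r normrN => /(_ s'd h0).
rewrite [_ *: 1]mulr1 subrK => h.
have -> : f s' - f s - a * (s' - s) =
    - ((a - (s' - s)^-1 * (f s' - f s)) * (s' - s)) by field.
by rewrite normrN normrM ler_wpM2r.
Qed.

Lemma diff_at_fst (f : R -> R) s t a : is_derive s 1 f a ->
  diff_at (fun s _ => f s) s t a 0.
Proof.
move=> /is_derive_approx H e e0; have [d d0 dP] := H e e0; exists d => // s' t' sd _.
by rewrite mul0r addr0; apply: le_trans (dP _ sd) _; rewrite (ler_wpM2l (ltW e0))// lerDl.
Qed.

Lemma diff_at_snd (f : R -> R) s t a : is_derive t 1 f a ->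
  diff_at (fun _ t => f t) s t 0 a.
Proof.
move=> /is_derive_approx H e e0; have [d d0 dP] := H e e0; exists d => // s' t' _ sd.
by rewrite mul0r add0r; apply: le_trans (dP _ sd) _; rewrite (ler_wpM2l (ltW e0))// lerDr.
Qed.

Lemma diff_at_curve (u : R -> R -> R) (x y : R -> R) s a b x' y' :
  diff_at u (x s) (y s) a b -> is_derive s 1 x x' -> is_derive s 1 y y' ->
  is_derive s 1 (fun r => u (x r) (y r)) (a * x' + b * y').
Proof.
move=> du dx dy; apply/is_deriveP.
have := diff_at_comp du (@diff_at_fst x s 0 x' dx) (@diff_at_fst y s 0 y' dy).
move=> H; apply/cvgrPdist_le => e e0; have [d d0 dP] := H e e0.
near=> h.
have h0 : h != 0 by near: h; exact: nbhs_dnbhs_neq.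
have hd : `|h + s - s| < d.
  by rewrite addrK; near: h; exact: dnbhs0_lt.
have := dP (h + s) 0 hd; rewrite !subrr normr0 => /(_ d0).
rewrite mulr0 !addr0 addrK [_ *: 1]mulr1 => hh.
have -> : a * x' + b * y' - h^-1 * (u (x (h + s)) (y (h + s)) - u (x s) (y s)) =
  - (h^-1 * (u (x (h + s)) (y (h + s)) - u (x s) (y s) - (a * x' + b * y') * h)) by field.
by rewrite normrN normrM normfV ler_pdivrMl ?normr_gt0// [leRHS]mulrC.
Unshelve. all: by end_near. Qed.

End TwoVariables.

Section ComplexDerivative.
Variable R : realType.
Implicit Types (z w c l : cplx R) (h : cplx R -> cplx R).

(** A complex derivative is a first-order approximation over a square neighbourhood.
*)
Lemma is_derive_cplx_approx h z c : is_derive z 1 h c ->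
  forall e : R, 0 < e -> exists2 d : R, 0 < d & forall w,
    `|recplx w - recplx z| < d -> `|imcplx w - imcplx z| < d ->
    `|h w - h z - c * (w - z)| <= tocplx e * `|w - z|.
Proof.
move=> /is_deriveP /cvgrPdist_le H e e0.
have e0' : 0 < tocplx e by rewrite ltcR_tocplx.
have /nbhs_cplxP[d /= d0 dP] := H _ e0'; exists d => // w wr wi.
have [->|wz] := eqVneq w z; first by rewrite !subrr mulr0 subr0 normr0 mulr0.
have h0 : w - z != 0 by rewrite subr_eq0.
have := dP (w - z); rewrite !recimE !subr0 => /(_ wr wi h0).
rewrite [_ *: 1]mulr1 subrK => hh.
have -> : h w - h z - c * (w - z) =
    - ((c - (w - z)^-1 * (h w - h z)) * (w - z)).
  by rewrite mulrBl mulrAC mulVf// mul1r opprB.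
by rewrite normrN normrM ler_wpM2r.
Qed.

(** The Cauchy-Riemann equations, contained in the shape of the partial derivatives.
*)
Lemma cauchy_riemann_re h z c : is_derive z 1 h c ->
  diff_at (fun x y => recplx (h (mkcplx x y))) (recplx z) (imcplx z)
    (recplx c) (- imcplx c).
Proof.
move=> /is_derive_cplx_approx H e e0; have [d d0 dP] := H e e0.
exists d => // x y xd yd; have := dP (mkcplx x y) xd yd.
move=> /(le_trans (norm_re _)) /le_trans.
have /(ler_wpM2l (ltW (_ : 0 < tocplx e))) := norm_le_reim (mkcplx x y - z).
rewrite ltcR_tocplx => /(_ e0) hh /(_ _ hh).
rewrite -tocplxM lecR_tocplx mkcplx_id !recimE.
by congr (_ <= _); congr (`|_|); ring.
Qed.

Lemma cauchy_riemann_im h z c : is_derive z 1 h c ->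
  diff_at (fun x y => imcplx (h (mkcplx x y))) (recplx z) (imcplx z)
    (imcplx c) (recplx c).
Proof.
move=> /is_derive_cplx_approx H e e0; have [d d0 dP] := H e e0.
exists d => // x y xd yd; have := dP (mkcplx x y) xd yd.
move=> /(le_trans (norm_im _)) /le_trans.
have /(ler_wpM2l (ltW (_ : 0 < tocplx e))) := norm_le_reim (mkcplx x y - z).
rewrite ltcR_tocplx => /(_ e0) hh /(_ _ hh).
rewrite -tocplxM lecR_tocplx mkcplx_id !recimE.
by congr (_ <= _); congr (`|_|); ring.
Qed.

End ComplexDerivative.

(** * The mean value property on the unit disc *)
Section MeanValue.
Variable R : realType.
Implicit Types (z w c l : cplx R) (h : cplx R -> cplx R) (r t e : R).

Definition polar r t : cplx R := mkcplx (r * cos t) (r * sin t).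

Lemma polar1 t : polar 1 t = expi t.
Proof. by rewrite /polar !mul1r. Qed.

Lemma polar_modulus r t :
  recplx (polar r t) ^+ 2 + imcplx (polar r t) ^+ 2 = r ^+ 2.
Proof. by rewrite !recimE !exprMn -mulrDr cos2Dsin2 mulr1. Qed.

Lemma odisc_polar r t : 0 <= r -> r < 1 -> odisc (polar r t).
Proof. by move=> r0 r1; apply/odiscP; rewrite polar_modulus expr_lt1. Qed.

(** The regularity of the extension of a plus loop: continuous up to the boundary,
complex differentiable inside. *)
Definition disc_holomorphic h :=
  {within @cdisc R, continuous h} /\ forall l, odisc l -> derivable h l 1.

(** The Cauchy-Riemann equations in polar coordinates: with h = u + i v, the
r-derivative of u is r^-1 times the t-derivative of v, which is the closedness of -
r^-1 v dr - u dt. *)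
Lemma polar_closed_form h r1 r2 : disc_holomorphic h -> 0 < r1 -> r2 < 1 ->
  closed_form (fun r t => - r^-1 * imcplx (h (polar r t)))
    (fun r t => recplx (h (polar r t))) ((r1, r2), (0, 2 * pi)).
Proof.
move=> [_ hd] r10 r21 r t [/= /andP[r1r rr2] _].
have r0 := lt_le_trans r10 r1r; have rlt1 := le_lt_trans rr2 r21.
have /hd/derivableP hc : odisc (polar r t) by apply: odisc_polar => //; exact: ltW.
set c := derive _ _ _ in hc.
have dX : diff_at (fun r t => r * cos t) r t (cos t) (- r * sin t).
  apply: diff_at_eq; first apply: (@diff_atM R (fun r _ => r) (fun _ t => cos t)).
  - exact: (@diff_at_fst R id).
  - exact: (@diff_at_snd R cos).
  - by rewrite mulr0 addr0 mulr1.
  - by rewrite mulr0 add0r mulrN mulNr.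
have dY : diff_at (fun r t => r * sin t) r t (sin t) (r * cos t).
  apply: diff_at_eq; first apply: (@diff_atM R (fun r _ => r) (fun _ t => sin t)).
  - exact: (@diff_at_fst R id).
  - exact: (@diff_at_snd R sin).
  - by rewrite mulr0 addr0 mulr1.
  - by rewrite mulr0 add0r.
have dU := @diff_at_comp R _ (fun r t => r * cos t) (fun r t => r * sin t) r t
  _ _ _ _ _ _ (cauchy_riemann_re hc) dX dY.
have dV := @diff_at_comp R _ (fun r t => r * cos t) (fun r t => r * sin t) r t
  _ _ _ _ _ _ (cauchy_riemann_im hc) dX dY.
have dI : is_derive r (1 : R) (fun r : R => - r^-1 : R) (r ^- 2).
  have dJ : is_derive r (1 : R) (fun y : R => y^-1) (- r ^- 2 *: (1 : R)).
    by apply: (@is_deriveV R id); rewrite ?gt_eqF.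
  by have := is_deriveN dJ; rewrite -[_ *: _]/(_ * _) mulr1 opprK.
have dP := diff_atM (@diff_at_fst R _ r t _ dI) dV.
exists (imcplx (h (polar r t)) * r ^- 2 +
  - r^-1 * (imcplx c * cos t + recplx c * sin t)).
exists (- (recplx c * cos t - imcplx c * sin t)).
exists (recplx c * (- r * sin t) + - imcplx c * (r * cos t)); split.
  apply: diff_at_eq dP _ _ => //.
  by field; rewrite gt_eqF.
apply: diff_at_eq dU _ _ => //; ring.
Qed.

(** Goursat's theorem on the rectangle of polar coordinates; the two sides t = 0 and
t = 2 pi cancel by periodicity. *)
Lemma circle_mean_const h r1 r2 : disc_holomorphic h -> 0 < r1 -> r1 < r2 -> r2 < 1 ->
  integral_itv 0 (2 * pi) (fun t => recplx (h (polar r1 t))) =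
  integral_itv 0 (2 * pi) (fun t => recplx (h (polar r2 t))).
Proof.
move=> hh r10 r12 r21.
have pi0 : 0 < 2 * pi :> R by rewrite mulr_gt0// pi_gt0.
have cf := polar_closed_form hh r10 r21.
have := goursat r12 pi0 cf; rewrite /circulation /=.
have -> : integral_itv r1 r2 (fun s => - s^-1 * imcplx (h (polar s 0)) -
    - s^-1 * imcplx (h (polar s (2 * pi)))) = 0.
  have -> : (fun s => - s^-1 * imcplx (h (polar s 0)) -
    - s^-1 * imcplx (h (polar s (2 * pi)))) = fun=> 0.
    apply/funext => s; have -> : polar s (2 * pi) = polar s 0; last by rewrite subrr.
    by rewrite /polar mulr_natl cos2pi sin2pi cos0 sin0.
  by rewrite /integral_itv Rintegral_cst// mul0r.
rewrite sub0r => /eqP; rewrite oppr_eq0 => /eqP.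
rewrite integral_itvB; last 2 first.
- by apply: (slice_q cf) => /=; rewrite lexx ltW.
- by apply: (slice_q cf) => /=; rewrite lexx ltW.
by move/eqP; rewrite subr_eq0 => /eqP.
Qed.

Lemma polar_continuous_at r t : (fun p : R * R => polar p.1 p.2) x @[x --> (r, t)] --> polar r t.
Proof.
apply/cvg_cplxP; split.
  apply: cvgM; first exact: cvg_fst.
  by apply: (@cvg_comp _ _ _ snd cos _ (nbhs t)); [exact: cvg_snd|exact: continuous_cos].
apply: cvgM; first exact: cvg_fst.
by apply: (@cvg_comp _ _ _ snd sin _ (nbhs t)); [exact: cvg_snd|exact: continuous_sin].
Qed.

(** Uniform continuity in the angle, from the compactness of the circle: it allows
the radius to tend to 0 and to 1 in the mean. *)
Lemma circle_mean_near h r0 e : {within @cdisc R, continuous h} -> 0 <= r0 <= 1 -> 0 < e ->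
  exists2 d, 0 < d & forall r, `|r - r0| < d -> 0 <= r <= 1 ->
    forall t, 0 <= t <= 2 * pi -> `|recplx (h (polar r t)) - recplx (h (polar r0 t))| < e.
Proof.
move=> hc r01 e0.
have := (@compact_near_coveringP R `[0, 2 * pi]).1 (@segment_compact _ _ _).
pose P r t := 0 <= r <= 1 -> `|recplx (h (polar r t)) - recplx (h (polar r0 t))| < e.
move=> /(_ R (nbhs r0) P _) cov.
have /nbhs_ballP[d /= d0 dP] : \forall r \near r0, `[0, 2 * pi] `<=` P r.
  apply: cov => t _.
  have cd r' t' : 0 <= r' <= 1 -> cdisc (polar r' t').
    by move=> /andP[h1 h2]; apply/cdiscP; rewrite polar_modulus expr_le1.
  have hct : h w @[w --> within (@cdisc R) (nbhs (polar r0 t))] --> h (polar r0 t).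
    by apply: ((subspace_continuousP _ _).1 hc); exact: cd.
  have e20 : 0 < e / 2 by rewrite divr_gt0.
  have [/cvgrPdist_lt /(_ _ e20) hre _] := (cvg_cplxP _ _ _).1 hct.
  have hnear : \forall x \near (r0, t), cdisc (polar x.1 x.2) ->
      `|recplx (h (polar r0 t)) - recplx (h (polar x.1 x.2))| < e / 2.
    exact: (polar_continuous_at (r := r0) (t := t) hre).
  have [[A B] [/= Ar Bt] AB] := hnear.
  exists (B, A) => // -[t' r] [/= Bt' Ar'] r1.
  have h1 := AB (r, t') (conj Ar' Bt') (cd r t' r1).
  have h2 := AB (r0, t') (conj (nbhs_singleton Ar) Bt') (cd r0 t' r01).
  move: h1 h2 => /=; rewrite !ltr_distl => /andP[? ?] /andP[? ?].
  by apply/andP; split; lra.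
exists d => // r rd r1 t tI; apply: dP => //; first by rewrite /ball /= distrC.
Qed.

Lemma polar_slice_continuous h r : {within @cdisc R, continuous h} -> 0 <= r <= 1 ->
  continuous (fun t => h (polar r t)).
Proof.
move=> hc /andP[r0 r1] t.
have cd t' : cdisc (polar r t').
  by apply/cdiscP; rewrite polar_modulus expr_le1.
have hct : h w @[w --> within (@cdisc R) (nbhs (polar r t))] --> h (polar r t).
  by apply: ((subspace_continuousP _ _).1 hc); exact: cd.
apply: cvg_trans hct => A hA.
have pc : polar r t' @[t' --> t] --> polar r t.
  apply/cvg_cplxP; split; apply: cvgM; first exact: cvg_cst.
  - exact: continuous_cos.
  - exact: cvg_cst.
  - exact: continuous_sin.
have := pc _ hA; rewrite !nbhs_simpl /=; apply: filterS => t' /= H; exact: (H (cd t')).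
Qed.

Lemma polar_slice_re_continuous h r : {within @cdisc R, continuous h} -> 0 <= r <= 1 ->
  continuous (fun t => recplx (h (polar r t))).
Proof.
move=> hc r01 t.
apply: (@cvg_comp _ _ _ (fun t => h (polar r t)) (@recplx R) _ (nbhs (h (polar r t)))).
  exact: polar_slice_continuous.
exact: recplx_continuous.
Qed.

Lemma expi_re_continuous h : {within @cdisc R, continuous h} ->
  continuous (fun t => recplx (h (expi t))).
Proof.
move=> hc; have r1 : 0 <= (1 : R) <= 1 by rewrite ler01 lexx.
by under eq_fun do rewrite -polar1; exact: polar_slice_re_continuous.
Qed.

(** The mean over the circle of radius r does not depend on r in ]0, 1[; its limits
at 0 and 1 are the value at the centre and the mean over the unit circle. *)
Lemma mean_value_re h : disc_holomorphic h ->
  integral_itv 0 (2 * pi) (fun t => recplx (h (expi t))) = recplx (h 0) * (2 * pi).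
Proof.
move=> hh; have [hc _] := hh.
have pi0 : 0 < 2 * pi :> R by rewrite mulr_gt0// pi_gt0.
pose phi r := integral_itv 0 (2 * pi) (fun t => recplx (h (polar r t))).
have cst r : 0 < r < 1 -> phi r = phi (1 / 2).
  move=> /andP[r0 r1]; have [h2|h2|->//] := ltgtP r (1 / 2).
    by apply: circle_mean_const => //; lra.
  by apply/esym; apply: circle_mean_const => //; lra.
have cont r : 0 <= r <= 1 -> {within `[0, 2 * pi], continuous (fun t => recplx (h (polar r t)))}.
  by move=> r01; apply: continuous_subspaceT; exact: polar_slice_re_continuous.
(* Only r0 = 0 and r0 = 1 matter; r is taken close to r0 in the open interval. *)
have lim r0 : 0 <= r0 <= 1 -> phi r0 = phi (1 / 2).
  move=> r01; apply/eqP; rewrite -subr_eq0 -normr_le0; apply/ler_addgt0Pr => e e0.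
  rewrite add0r.
  have e'0 : 0 < e / (2 * pi) by rewrite divr_gt0.
  have [d d0 dP] := circle_mean_near hc r01 e'0.
  have [r r1 rd] : exists2 r, 0 < r < 1 & `|r - r0| < d.
    pose d' := Num.min (d / 2) (1 / 4).
    have d'0 : 0 < d' by rewrite lt_min; apply/andP; split; lra.
    have d'd : d' < d by rewrite /d' gt_min; apply/orP; left; lra.
    have d'1 : d' <= 1 / 4 by rewrite /d' ge_min lexx orbT.
    have [h2|h2] := leP r0 (1 / 2).
      exists (r0 + d'); first by apply/andP; split; lra.
      by rewrite addrAC subrr add0r gtr0_norm.
    exists (r0 - d'); first by apply/andP; split; lra.
    by rewrite addrAC subrr add0r normrN gtr0_norm.
  have r1' : 0 <= r <= 1 by apply/andP; split; lra.
  rewrite -(cst _ r1) distrC /phi -integral_itvB; [|exact: cont..].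
  have := @integral_itv_near R 0 (2 * pi) 0 (e / (2 * pi))
    (fun t => recplx (h (polar r t)) - recplx (h (polar r0 t))) (ltW pi0).
  rewrite mul0r !subr0 divfK ?gt_eqF//; apply.
    by apply: withinB; exact: cont.
  by move=> t tI; rewrite subr0; apply: ltW; exact: dP.
have := lim 1; rewrite lexx ler01 => /(_ isT).
have := lim 0; rewrite lexx ler01 => /(_ isT) <-.
rewrite /phi; under [in LHS]eq_fun do rewrite polar1.
move=> ->.
have -> : (fun t => recplx (h (polar 0 t))) = fun=> recplx (h 0).
  by apply/funext => t; rewrite /polar !mul0r.
apply/eqP; rewrite -subr_eq0 -normr_le0.
have := @integral_itv_near R 0 (2 * pi) (recplx (h 0)) 0 (fun=> recplx (h 0)) (ltW pi0).
rewrite mul0r subr0; apply; last by move=> *; rewrite subrr normr0.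
by apply: continuous_subspaceT; exact: cst_continuous.
Qed.

Lemma disc_holomorphic_lin h (a b : cplx R) : disc_holomorphic h ->
  disc_holomorphic (fun l => a * h l + b).
Proof.
move=> [hc hd]; split.
  move=> x; apply: cvgD; last exact: cvg_cst.
  by apply: cvgM; [exact: cvg_cst|exact: hc].
move=> l /hd /derivableP hl.
have H : is_derive l 1 (fun l => a *: h l + b) (a *: 'D_1 h l + 0).
  by apply: is_deriveD.
by have [] := H.
Qed.

Lemma disc_holomorphicM g h : disc_holomorphic g -> disc_holomorphic h ->
  disc_holomorphic (fun l => g l * h l).
Proof.
move=> [gc gd] [hc hd]; split; first by move=> x; apply: cvgM; [exact: gc|exact: hc].
by move=> l lo; apply: (derivableM (gd _ lo) (hd _ lo)).
Qed.

Lemma disc_holomorphicD g h : disc_holomorphic g -> disc_holomorphic h ->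
  disc_holomorphic (fun l => g l + h l).
Proof.
move=> [gc gd] [hc hd]; split; first by move=> x; apply: cvgD; [exact: gc|exact: hc].
by move=> l lo; apply: (derivableD (gd _ lo) (hd _ lo)).
Qed.

Lemma disc_bound h e : disc_holomorphic h -> 
  (forall l, circle l -> `|recplx (h l)| <= e) -> `|recplx (h 0)| <= e.
Proof.
move=> hh he; have [hc _] := hh.
have pi0 : 0 < 2 * pi :> R by rewrite mulr_gt0// pi_gt0.
have := @integral_itv_near R 0 (2 * pi) 0 e (fun t => recplx (h (expi t))) (ltW pi0).
rewrite mul0r !subr0 (mean_value_re hh) normrM [`|2 * pi|]gtr0_norm// ler_pM2r//; apply.
  by apply: continuous_subspaceT; exact: expi_re_continuous.
by move=> t _; rewrite subr0; apply: he; exact: circle_expi.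
Qed.

Lemma disc_bound_im h e : disc_holomorphic h -> 
  (forall l, circle l -> `|imcplx (h l)| <= e) -> `|imcplx (h 0)| <= e.
Proof.
move=> hh he; have := disc_bound (disc_holomorphic_lin (- 'i) 0 hh) (e := e).
have E l : recplx (- 'i * h l + 0) = imcplx (h l) by rewrite !recimE; ring.
rewrite E; apply => l lc; rewrite E; exact: he.
Qed.

Lemma integral0_continuous (f : R -> R) (a b x : R) : a < b -> continuous f ->
  (forall x, 0 <= f x) -> integral_itv a b f = 0 -> a <= x <= b -> f x = 0.
Proof.
move=> ab fc f0 I0 /andP[ax xb]; apply/eqP; rewrite eq_le f0 andbT leNgt; apply/negP => fx.
have fx2 : 0 < f x / 2 by rewrite divr_gt0.
have /cvgrPdist_lt /(_ _ fx2) /nbhs_ballP[d /= d0 dP] := fc x.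
pose c := Num.max a (x - d / 2); pose c' := Num.min b (x + d / 2).
have cw A : {within A, continuous f} by exact: continuous_subspaceT.
have cx : c <= x by rewrite /c ge_max ax /=; lra.
have xc' : x <= c' by rewrite /c' le_min xb /=; lra.
have cc' : c < c'.
  by rewrite /c /c' lt_min !gt_max ab /=; apply/andP; split; [|apply/andP; split]; lra.
have ac : a <= c by rewrite /c le_max lexx.
have c'b : c' <= b by rewrite /c' ge_min lexx.
move: I0; rewrite (integral_itv_split ac (le_trans (ltW cc') c'b))//.
rewrite (integral_itv_split (ltW cc') c'b)//.
have p1 : 0 <= integral_itv a c f by apply: Rintegral_ge0 => *; exact: f0.
have p3 : 0 <= integral_itv c' b f by apply: Rintegral_ge0 => *; exact: f0.
have p2 : 0 < integral_itv c c' f.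
  have : `|integral_itv c c' f - f x * (c' - c)| <= (f x / 2) * (c' - c).
    apply: integral_itv_near => //; first exact: ltW.
    move=> y /andP[cy yc']; rewrite distrC; apply/ltW/dP.
    rewrite /ball /= ltr_distl.
    have : x - d / 2 <= y by apply: le_trans cy; rewrite /c le_max lexx orbT.
    have : y <= x + d / 2 by apply: le_trans yc' _; rewrite /c' ge_min lexx orbT.
    by move=> ? ?; apply/andP; split; lra.
  rewrite ler_distl => /andP[+ _]; apply: lt_le_trans.
  have -> : f x * (c' - c) - f x / 2 * (c' - c) = f x / 2 * (c' - c) by field.
  by rewrite mulr_gt0// subr_gt0.
move=> E; lra.
Qed.

(** The imaginary part vanishes at 0 by the mean value property. Applied to the
square of h - h(0), whose boundary values are squares of real numbers, the mean
value property shows that their integral is 0, hence that they vanish. *)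
Theorem disc_real_circle h : disc_holomorphic h ->
  (forall l, circle l -> imcplx (h l) = 0) -> forall l, circle l -> h l = h 0.
Proof.
move=> hh hreal.
have pi0 : 0 < 2 * pi :> R by rewrite mulr_gt0// pi_gt0.
have im0 : imcplx (h 0) = 0.
  apply/eqP; rewrite -normr_le0; apply: disc_bound_im => // l /hreal ->.
  by rewrite normr0.
have gh := disc_holomorphic_lin 1 (- h 0) hh.
have := mean_value_re (disc_holomorphicM gh gh); rewrite mul1r subrr mulr0 recplx0 mul0r.
move=> I0 l lc; have [t tI <-] := expi_surj lc.
have E s : recplx ((1 * h (expi s) - h 0) * (1 * h (expi s) - h 0)) =
    (recplx (h (expi s)) - recplx (h 0)) ^+ 2.
  by rewrite !recimE im0 hreal; [ring|exact: circle_expi].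
have := @integral0_continuous (fun s => (recplx (h (expi s)) - recplx (h 0)) ^+ 2)
  0 (2 * pi) t pi0.
have -> : integral_itv 0 (2 * pi) (fun s => (recplx (h (expi s)) - recplx (h 0)) ^+ 2) = 0.
  by rewrite -[RHS]I0; congr (integral_itv _ _ _); apply: funext => s /=; rewrite -E.
have cont : continuous (fun s => (recplx (h (expi s)) - recplx (h 0)) ^+ 2).
  move=> s; have H' := expi_re_continuous hh.1 (x := s).
  have H2 := cvgB H' (cvg_cst (recplx (h 0))).
  exact: (cvgM (H2 _ _) (H2 _ _)).
move=> /(_ cont (fun s => sqr_ge0 _) erefl tI) /eqP.
rewrite sqrf_eq0 subr_eq0 => /eqP hE.
by apply: cplx_eq => //; rewrite im0 hreal//; exact: circle_expi.
Qed.

End MeanValue.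

(** * The Lorentz form and its isometries *)
Lemma connected_locally_constant (T : topologicalType) (U : Type) (A : set T)
    (f : T -> U) : connected A ->
  (forall x, A x -> \forall y \near x, A y -> f y = f x) ->
  forall x y, A x -> A y -> f x = f y.
Proof.
move=> cA fA x y Ax Ay; apply: contrapT => fxy.
move/connectedP : cA => /(_ (fun b => [set z | A z /\ (if b then f z <> f x else f z = f x)])).
apply; split.
- by case; [exists y; split => // /esym|exists x].
- apply/seteqP; split => [z Az|z [[]|[]]//].
  by have [fz|fz] := pselect (f z = f x); [left|right].
- split; apply/seteqP; split => // z [].
    move=> clz [Az fz].
    have [w [[Aw fw] hw]] := clz [set y | A y -> f y = f z] (fA z Az).
    by apply: fz; rewrite -(hw Aw).
  move=> [Az fz] clz.
  have [w [[Aw fw] hw]] := clz [set y | A y -> f y = f z] (fA z Az).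
  by apply: fw; rewrite (hw Aw).
Qed.

Section LorentzAlgebra.
Variables (T : comNzRingType) (m : nat).
Implicit Types A B : 'M[T]_m.+1.
Local Notation J := (lorentz_form T m).

Lemma lorentz_formE i j :
  J i j = (if i == j then (if i == ord0 then -1 else 1) else 0).
Proof.
rewrite /lorentz_form /signmx !mxE; case: eqP => [->|] //=.
rewrite mulr1n; case: (altP (j =P ord0)) => [->|]; first by rewrite eqxx expr1.
by rewrite -val_eqE /= => /negbTE ->.
Qed.

Lemma tr_lorentz : J^T = J. Proof. exact: tr_diag_mx. Qed.

Lemma lorentz_sqr : J *m J = 1%:M.
Proof.
rewrite /lorentz_form /signmx mulmx_diag -diag_const_mx; congr diag_mx.
by apply/rowP => j; rewrite !mxE -expr2 -exprM mulnC exprM sqrrN expr1n expr1n.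
Qed.

(** The adjoint for the Lorentz form: the inverse of A when A is an isometry, but
polynomial in A, so that it is continuous and differentiable without side
conditions. *)
Definition lorentz_adj A : 'M[T]_m.+1 := J *m A^T *m J.

Lemma lorentz_adjE A i j : lorentz_adj A i j =
  (if i == ord0 then -1 else 1) * A j i * (if j == ord0 then -1 else 1).
Proof.
rewrite /lorentz_adj mxE (bigD1 j)//= big1 ?addr0; last first.
  by move=> k /negbTE kj; rewrite lorentz_formE kj mulr0.
rewrite lorentz_formE eqxx mxE (bigD1 i)//= big1 ?addr0; last first.
  by move=> k /negbTE ki; rewrite lorentz_formE eq_sym ki mul0r.
by rewrite lorentz_formE eqxx mxE.
Qed.

Lemma lorentz_adjM A B : lorentz_adj (A *m B) = lorentz_adj B *m lorentz_adj A.
Proof.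
by rewrite /lorentz_adj trmx_mul -!mulmxA (mulmxA (lorentz_form _ _)
  (lorentz_form _ _)) lorentz_sqr mul1mx.
Qed.

Lemma lorentz_adjK A : lorentz_adj (lorentz_adj A) = A.
Proof.
rewrite /lorentz_adj !trmx_mul trmxK tr_lorentz.
by rewrite !mulmxA lorentz_sqr mul1mx -mulmxA lorentz_sqr mulmx1.
Qed.

Lemma lorentz_adj1 : lorentz_adj 1%:M = 1%:M.
Proof. by rewrite /lorentz_adj trmx1 mulmx1 lorentz_sqr. Qed.

Lemma lorentz_isoP A : lorentz_isometry A <-> lorentz_adj A *m A = 1%:M.
Proof.
rewrite /lorentz_isometry /lorentz_adj /=; split=> [h|/(congr1 (mulmx J))].
  by rewrite -!mulmxA (mulmxA A^T) h lorentz_sqr.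
by rewrite !mulmxA lorentz_sqr mul1mx mulmx1.
Qed.

Lemma lorentz_adjV A : lorentz_isometry A -> A *m lorentz_adj A = 1%:M.
Proof. by move=> /lorentz_isoP /mulmx1C. Qed.

Lemma lorentz_iso1 : lorentz_isometry (1%:M : 'M[T]_m.+1).
Proof. by apply/lorentz_isoP; rewrite lorentz_adj1 mulmx1. Qed.

Lemma lorentz_isoM A B : lorentz_isometry A -> lorentz_isometry B ->
  lorentz_isometry (A *m B).
Proof.
move=> /lorentz_isoP hA /lorentz_isoP hB; apply/lorentz_isoP.
by rewrite lorentz_adjM -mulmxA (mulmxA _ A) hA mul1mx.
Qed.

Lemma lorentz_iso_adj A : lorentz_isometry A -> lorentz_isometry (lorentz_adj A).
Proof. by move=> hA; apply/lorentz_isoP; rewrite lorentz_adjK lorentz_adjV. Qed.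

Lemma det_lorentz_adj A : \det (lorentz_adj A) = \det A.
Proof.
rewrite /lorentz_adj !det_mulmx det_tr mulrAC -det_mulmx lorentz_sqr det1.
by rewrite mul1r.
Qed.

Lemma lorentz_iso_det A : lorentz_isometry A -> \det A ^+ 2 = 1.
Proof.
by move=> /lorentz_isoP /(congr1 determinant); rewrite det_mulmx det_lorentz_adj det1.
Qed.

End LorentzAlgebra.

Lemma lorentz_iso_unit (T : comUnitRingType) m (A : 'M[T]_m.+1) :
  lorentz_isometry A -> A \in unitmx.
Proof. by move=> hA; case: (mulmx1_unit (lorentz_adjV hA)). Qed.

Section LorentzReal.
Variables (R : realType) (m : nat).
Implicit Types (A B : 'M[R]_m.+1) (x y u v w : 'cV[R]_m.+1).
Local Notation J := (lorentz_form R m).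
Local Notation e i := (delta_mx i ord0 : 'cV[R]_m.+1).

Definition bil x y : R := (x^T *m J *m y) ord0 ord0.

Lemma bilE x y : x^T *m J *m y = (bil x y)%:M.
Proof. exact: mx11_scalar. Qed.

Lemma bil_sum x y : bil x y = \sum_i (if i == ord0 then -1 else 1) * (x i ord0 * y i ord0).
Proof.
rewrite /bil mxE; apply: eq_bigr => i _; rewrite mxE (bigD1 i)//= big1 ?addr0; last first.
  by move=> j /negbTE ji; rewrite lorentz_formE ji mulr0.
by rewrite mxE lorentz_formE eqxx mulrAC mulrC.
Qed.

Lemma bil_delta x i : bil x (e i) = (if i == ord0 then -1 else 1) * x i ord0.
Proof.
rewrite bil_sum (bigD1 i)//= big1 ?addr0; first by rewrite mxE !eqxx mulr1.
by move=> j /negbTE ji; rewrite mxE ji /= !mulr0.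
Qed.

Lemma bilC x y : bil x y = bil y x.
Proof. by rewrite !bil_sum; apply: eq_bigr => i _; rewrite [x _ _ * _]mulrC. Qed.

Lemma bilDl x y z : bil (x + y) z = bil x z + bil y z.
Proof. by rewrite /bil linearD /= !mulmxDl mxE. Qed.
Lemma bilZl (a : R) x y : bil (a *: x) y = a * bil x y.
Proof. by rewrite /bil linearZ /= -!scalemxAl mxE. Qed.
Lemma bilDr x y z : bil x (y + z) = bil x y + bil x z.
Proof. by rewrite ![bil x _]bilC bilDl. Qed.
Lemma bilZr (a : R) x y : bil x (a *: y) = a * bil x y.
Proof. by rewrite ![bil x _]bilC bilZl. Qed.

Lemma bil_iso A x y : lorentz_isometry A -> bil (A *m x) (A *m y) = bil x y.
Proof.
move=> hA; rewrite /bil trmx_mul -!mulmxA (mulmxA J) (mulmxA A^T) (mulmxA A^T).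
by rewrite hA mulmxA.
Qed.

Definition reflection u : 'M[R]_m.+1 := 1%:M - (2 / bil u u) *: (u *m u^T *m J).

Lemma reflectionE u x : reflection u *m x = x - (2 * bil u x / bil u u) *: u.
Proof.
rewrite /reflection mulmxBl mul1mx -scalemxAl -!mulmxA (mulmxA _ J) bilE.
by rewrite mul_mx_scalar scalerA mulrAC.
Qed.

Lemma reflection_iso u : bil u u != 0 -> lorentz_isometry (reflection u).
Proof.
move=> u0; rewrite /lorentz_isometry /= /reflection.
set c := 2 / _.
have -> : (1%:M - c *: (u *m u^T *m J))^T = 1%:M - c *: (J *m (u *m u^T)).
  have -> : J *m (u *m u^T) = (u *m u^T *m J)^T by rewrite !trmx_mul trmxK tr_lorentz.
  by apply/matrixP => i j; rewrite !mxE eq_sym.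
rewrite mulmxBl mulmxBr mul1mx mulmx1.
have E : (c *: (J *m (u *m u^T))) *m J *m (c *: (u *m u^T *m J)) =
  (c * c * bil u u) *: (J *m u *m u^T *m J).
  rewrite -!scalemxAl -!scalemxAr scalerA.
  have -> : J *m (u *m u^T) *m J *m (u *m u^T *m J) =
     J *m u *m (u^T *m J *m u) *m u^T *m J by rewrite !mulmxA.
  by rewrite bilE mul_mx_scalar -!scalemxAl scalerA.
rewrite mulmxBl E -scalemxAr -!scalemxAl !mulmxA.
have -> : c * c * bil u u = c + c by rewrite /c; field.
by apply/matrixP => i j; rewrite !mxE; ring.
Qed.

Lemma reflectionK u x : bil u u != 0 -> reflection u *m (reflection u *m x) = x.
Proof.
move=> u0; rewrite !reflectionE; set a := 2 * bil u x / _.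
have -> : bil u (x - a *: u) = - bil u x by rewrite bilDr -scaleNr bilZr /a; field.
by rewrite mulrN mulNr -/a scaleNr opprK subrK.
Qed.

(** The image of the time-like basis vector has square -1. *)
Lemma iso_entry00 A : lorentz_isometry A ->
  A ord0 ord0 ^+ 2 = 1 + \sum_(i < m) A (lift ord0 i) ord0 ^+ 2.
Proof.
move=> hA; have := bil_iso (e ord0) (e ord0) hA.
have lE (i : 'I_m) : (lift ord0 i == ord0) = false.
  by rewrite eq_sym; apply/negbTE; exact: neq_lift.
rewrite bil_delta eqxx mxE !eqxx mulr1 -colE bil_sum big_ord_recl eqxx !mxE.
under eq_bigr => i _ do rewrite lE mul1r !mxE -expr2.
by move=> h; rewrite -[1]opprK -[in RHS]h expr2; ring.
Qed.

End LorentzReal.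

(** * Connected components of the Lorentz group *)
Section LorentzPaths.
Variables (R : realType) (m : nat).
Implicit Types (A B : 'M[R]_m.+1) (x y u v w : 'cV[R]_m.+1) (C : set 'M[R]_m.+1).
Local Notation J := (lorentz_form R m).
Local Notation e i := (delta_mx i ord0 : 'cV[R]_m.+1).

Lemma iso_entry00_ge1 A : lorentz_isometry A -> 1 <= A ord0 ord0 ^+ 2.
Proof.
by move=> /iso_entry00 ->; rewrite lerDl; apply: sumr_ge0 => i _; exact: sqr_ge0.
Qed.

(** An isometry has determinant 1 or -1, so a continuous determinant cannot jump. *)
Lemma connected_iso_det C : connected C -> C `<=` @lorentz_isometry R m ->
  forall A B, C A -> C B -> \det A = \det B.
Proof.
move=> cC Ciso A B; apply: (connected_locally_constant (f := fun A => \det A)) => // {A B}.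
move=> A CA.
have /cvgrPdist_lt /(_ 1 ltr01) : \det B @[B --> A] --> \det A.
  exact: (cvg_det (@cvg_id _ (nbhs A))).
apply: filterS => B + CB.
have := lorentz_iso_det (Ciso _ CA); have := lorentz_iso_det (Ciso _ CB).
move=> /eqP; rewrite sqrf_eq1 => /orP[] /eqP -> /eqP; rewrite sqrf_eq1 => /orP[] /eqP -> //;
  rewrite ltr_norml => /andP[? ?]; exfalso; lra.
Qed.

(** The first entry of an isometry has absolute value at least 1, so it cannot
change sign along a connected set. *)
Lemma connected_iso_sign C : connected C -> C `<=` @lorentz_isometry R m ->
  forall A B, C A -> C B -> (0 < A ord0 ord0) = (0 < B ord0 ord0).
Proof.
move=> cC Ciso A B.
apply: (connected_locally_constant (f := fun A => 0 < A ord0 ord0)) => // {A B}.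
move=> A CA.
have /cvgrPdist_lt /(_ 1 ltr01) := @entry_continuous R m.+1 m.+1 ord0 ord0 A.
apply: filterS => B + CB.
have := iso_entry00_ge1 (Ciso _ CA); have := iso_entry00_ge1 (Ciso _ CB).
rewrite ltr_norml => hB hA /andP[h1 h2].
case: (ltP 0 (A ord0 ord0)) => hA0; case: (ltP 0 (B ord0 ord0)) => hB0 //; exfalso; nra.
Qed.

Definition fixes (j : nat) A := forall i : 'I_m.+1, (i < j)%N -> A *m e i = e i.

(** The isometries fixing the first j basis vectors; raising j step by step joins
any isometry to the identity. *)
Definition Fix j : set 'M[R]_m.+1 := [set A | lorentz_isometry A /\ fixes j A].

Lemma fixesM j A B : fixes j A -> fixes j B -> fixes j (A *m B).
Proof. by move=> fA fB i ij; rewrite -mulmxA fB// fA. Qed.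

Lemma reflection_fixes j u : (forall i : 'I_m.+1, (i < j)%N -> u i ord0 = 0) ->
  fixes j (reflection u).
Proof.
by move=> u0 i /u0 ui; rewrite reflectionE bil_delta ui !mulr0 mul0r scale0r subr0.
Qed.

(** Two space-like vectors at an acute angle are joined by a segment of space-like
vectors, and the reflections along it form a path. *)
Lemma reflection_path_connected v w B : 0 < bil v v -> 0 < bil w w -> 0 <= bil v w ->
  (forall t : R, 0 <= t <= 1 -> 0 < bil ((1 - t) *: v + t *: w) ((1 - t) *: v + t *: w)) /\
  connected [set reflection ((1 - t) *: v + t *: w) *m B | t in `[(0:R), 1]].
Proof.
move=> vv ww vw.
have pos (t : R) : 0 <= t <= 1 ->
    0 < bil ((1 - t) *: v + t *: w) ((1 - t) *: v + t *: w).
  move=> /andP[t0 t1]; rewrite !(bilDl, bilDr, bilZl, bilZr) [bil w v]bilC.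
  have h : 0 <= (1 - t) * (t * bil v w) by rewrite !mulr_ge0// subr_ge0.
  have [th|th] := leP t (1 / 2).
    have : 0 < (1 - t) * ((1 - t) * bil v v) by rewrite !mulr_gt0//; lra.
    have : 0 <= t * (t * bil w w) by rewrite !mulr_ge0// ltW.
    lra.
  have : 0 < t * (t * bil w w) by rewrite !mulr_gt0//; lra.
  have : 0 <= (1 - t) * ((1 - t) * bil v v) by rewrite !mulr_ge0 ?subr_ge0// ltW.
  lra.
split => //; apply: connected_continuous_connected; first exact: segment_connected.
apply: continuous_in_subspaceT => t; rewrite inE /= in_itv /= => /pos/lt0r_neq0 pt.
apply: cvg_mulmx; last exact: cvg_cst.
pose u (s : R) := (1 - s) *: v + s *: w.
have ct : u s @[s --> t] --> u t.
  apply/cvg_mxP => i k; rewrite !mxE; under eq_fun do rewrite !mxE.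
  apply: cvgD; apply: cvgM; first (apply: cvgB); by [exact: cvg_cst|exact: cvg_id].
have cq : bil (u s) (u s) @[s --> t] --> bil (u t) (u t).
  have /cvg_mxP/(_ ord0 ord0) : (u s)^T *m J *m u s @[s --> t] --> (u t)^T *m J *m u t.
    by apply: cvg_mulmx; [apply: cvg_mulmx; [exact: cvg_trmx|exact: cvg_cst]|exact: ct].
  by [].
have cuu : u s *m (u s)^T *m J @[s --> t] --> u t *m (u t)^T *m J.
  by apply: cvg_mulmx; [apply: cvg_mulmx; [exact: ct|exact: cvg_trmx]|exact: cvg_cst].
apply: cvgB; first exact: cvg_cst.
apply: cvg_scalemx; last exact: cuu.
by apply: cvgM; [exact: cvg_cst|exact: cvgV].
Qed.

(** The difference A e_k - e_k is orthogonal to the vectors e_i with i < j. For k =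
0 its square is 2 (A_00 - 1), and for k > 0 it has no time component. *)
Lemma displaced_spacelike j (A : 'M[R]_m.+1) : Fix j A -> 0 < A ord0 ord0 ->
  forall k : 'I_m.+1, k = j :> nat -> A *m e k <> e k ->
  0 < bil (A *m e k - e k) (A *m e k - e k).
Proof.
move=> [hA fA] A0 k kj ne; set v := _ - _.
have lE (i : 'I_m) : (lift ord0 i == ord0) = false.
  by rewrite eq_sym; apply/negbTE; exact: neq_lift.
case: (altP (k =P ord0)) => [k0|k0].
  have xx : bil (A *m e ord0) (A *m e ord0) = -1.
    by rewrite bil_iso// bil_delta eqxx mxE !eqxx mulr1.
  have xe : bil (A *m e ord0) (e ord0) = - A ord0 ord0.
    by rewrite bil_delta eqxx mulN1r -colE mxE.
  have ee : bil (e ord0) (e ord0) = -1 by rewrite bil_delta eqxx mxE !eqxx mulr1.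
  have E : bil v v = 2 * (A ord0 ord0 - 1).
    rewrite /v k0 -scaleN1r !(bilDl, bilDr, bilZl, bilZr) [bil (e _) (A *m _)]bilC xx xe ee.
    ring.
  have A1 : 1 <= A ord0 ord0 by have := iso_entry00_ge1 hA; nra.
  rewrite E mulr_gt0// subr_gt0 lt_neqAle A1 andbT; apply/eqP => A11.
  apply: ne; rewrite k0 -colE; apply/colP => i; rewrite !mxE eqxx andbT.
  have := iso_entry00 hA; rewrite -A11 expr1n => /eqP.
  rewrite -subr_eq0 opprD addrA subrr add0r oppr_eq0.
  rewrite psumr_eq0; last by move=> ? _; exact: sqr_ge0.
  move=> /allP h; case: (unliftP ord0 i) => [i'|] ->.
    by rewrite lE; have := h i' (mem_index_enum _); rewrite /= sqrf_eq0 => /eqP.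
  by rewrite eqxx.
have v0 : v ord0 ord0 = 0.
  have f0 : A *m e ord0 = e ord0.
    by apply: fA; move: k0; rewrite -val_eqE -kj lt0n.
  have := bil_iso (e k) (e ord0) hA; rewrite f0 !bil_delta eqxx.
  by rewrite /v !mxE [ord0 == k]eq_sym (negbTE k0) /= mulr0 subr0 mulN1r => /eqP; rewrite oppr_eq0 => /eqP.
rewrite bil_sum big_ord_recl v0 !mul0r mulr0 add0r.
under eq_bigr => i _ do rewrite lE mul1r -expr2.
have s0 : 0 <= \sum_(i < m) v (lift ord0 i) ord0 ^+ 2.
  by apply: sumr_ge0 => i _; exact: sqr_ge0.
rewrite lt_neqAle s0 andbT.
apply/eqP => /esym /eqP; rewrite psumr_eq0; last by move=> ? _; exact: sqr_ge0.
move=> /allP h; apply: ne; apply/eqP; rewrite -subr_eq0; apply/eqP/colP => i.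
rewrite -/v [RHS]mxE; case: (unliftP ord0 i) => [i'|] -> //.
by have := h i' (mem_index_enum _); rewrite /= sqrf_eq0 => /eqP.
Qed.

(** With v = A e_j - e_j, the reflection in v sends A e_j back to e_j. A second
reflection in w, a multiple of e_(j+1), restores the orientation and still fixes
e_j. Moving w to v inside space-like vectors turns the product of the two
reflections into the identity, so the new isometry is joined to A inside Fix j. The
spare direction e_(j+1) exists because j < m. *)
Lemma fix_one_more j A : (j < m)%N -> Fix j A -> 0 < A ord0 ord0 ->
  exists A' (C : set 'M[R]_m.+1),
    [/\ Fix j.+1 A', connected C, C `<=` Fix j, C A & C A'].
Proof.
move=> jm [hA fA] A0.
have jm1 : (j < m.+1)%N by rewrite ltnS ltnW.
pose k := Ordinal jm1; pose k' : 'I_m.+1 := Ordinal (jm : (j.+1 < m.+1)%N).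
have [fk|nfk] := eqVneq (A *m e k) (e k).
  exists A, [set A]; split => //; [split => //|exact: connected1|by move=> _ ->; split].
  move=> i; rewrite ltnS leq_eqVlt => /predU1P[ij|/fA//].
  by have -> : i = k by apply: val_inj.
have vv := displaced_spacelike (conj hA fA) A0 (erefl : k = j :> nat) (elimN eqP nfk).
set v := _ - _ in vv.
have k'0 : (k' == ord0) = false by [].
(* The sign makes the angle between v and w acute. *)
pose s : R := if 0 <= v k' ord0 then 1 else -1.
pose w := s *: e k'.
have ss : s * s = 1 by rewrite /s; case: ifP; rewrite ?mulr1// mulrNN mulr1.
have ww : bil w w = 1 by rewrite /w bilZl bilZr bil_delta k'0 mxE !eqxx !mulr1.
have vw : 0 <= bil v w.
  rewrite /w bilZr bil_delta k'0 mul1r /s; case: ifP => [|/negbT]; first by rewrite mul1r.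
  by rewrite -ltNge mulN1r oppr_ge0 => /ltW.
have ww0 : 0 < bil w w by rewrite ww.
have [pos conn] := reflection_path_connected (reflection v *m A) vv ww0 vw.
have vlow (i : 'I_m.+1) : (i < j)%N -> v i ord0 = 0.
  move=> ij; have ik : (i == k) = false by rewrite -val_eqE /= ltn_eqF.
  have := bil_iso (e k) (e i) hA; rewrite (fA i ij) !bil_delta /v !mxE ik /= mulr0 subr0.
  by case: ifP => _; rewrite ?mulN1r ?mul1r// => /eqP; rewrite oppr_eq0 => /eqP.
have wlow (i : 'I_m.+1) : (i < j.+1)%N -> w i ord0 = 0.
  move=> ij; have ik : (i == k') = false by rewrite -val_eqE /= ltn_eqF.
  by rewrite /w !mxE ik mulr0.
have isov := reflection_iso (lt0r_neq0 vv).
have vvE : bil v v = 2 * bil v (A *m e k).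
  have xx : bil (A *m e k) (A *m e k) = bil (e k) (e k) by rewrite bil_iso.
  rewrite {1 2 3}/v -scaleN1r !(bilDl, bilDr, bilZl, bilZr) [bil (e _) (A *m _)]bilC xx.
  ring.
have refl_v : reflection v *m (A *m e k) = e k.
  by rewrite reflectionE -vvE divff ?gt_eqF// scale1r /v subKr.
exists (reflection w *m (reflection v *m A)), [set reflection ((1 - t) *: v + t *: w) *m (reflection v *m A) | t in `[(0:R), 1]].
split => //.
- split; first by apply: lorentz_isoM; [apply: reflection_iso; rewrite gt_eqF|exact: lorentz_isoM].
  move=> i; rewrite ltnS leq_eqVlt => /predU1P[ij|ij].
    have -> : i = k by apply: val_inj.
    by rewrite -!mulmxA refl_v; apply: (reflection_fixes wlow).
  rewrite -!mulmxA fA// (reflection_fixes vlow)//.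
  by apply: (reflection_fixes wlow); rewrite ltnS ltnW.
- move=> _ [t /= tI <-]; have pt := pos t tI; split.
    by apply: lorentz_isoM; [apply: reflection_iso; rewrite gt_eqF|exact: lorentz_isoM].
  apply: fixesM; last by apply: fixesM => //; exact: reflection_fixes.
  apply: reflection_fixes => i ij.
  rewrite mxE [X in X + _]mxE [X in _ + X]mxE (vlow i ij) wlow ?mulr0 ?addr0//.
  by rewrite ltnS ltnW.
- exists 0; first by rewrite /= in_itv /= lexx ler01.
  rewrite subr0 scale1r scale0r addr0; apply/row_matrixP => i.
  have K x : reflection v *m (reflection v *m x) = x by rewrite reflectionK// gt_eqF.
  suff -> : reflection v *m (reflection v *m A) = A by [].
  apply/matrixP => a b; have := congr1 (fun x : 'cV_m.+1 => x a ord0) (K (A *m e b)).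
  by rewrite !mulmxA -!colE !mxE.
- exists 1; first by rewrite /= in_itv /= lexx ler01.
  by rewrite subrr scale0r add0r scale1r.
Qed.

(** Orthogonality to the fixed vectors leaves only the last diagonal entry free, and
that one is the determinant. *)
Lemma fix_all A : Fix m A -> \det A = 1 -> A = 1%:M.
Proof.
move=> [hA fA] dA.
have dgn (i j : 'I_m.+1) : i != j -> A i j = 0.
  move=> ij; have [jm|jm] := ltnP j m.
    by have := fA j jm => /colP /(_ i); rewrite -colE !mxE (negbTE ij).
  have im : (i < m)%N.
    rewrite ltn_neqAle -ltnS ltn_ord andbT; apply: contra ij => /eqP im.
    by rewrite -val_eqE /= im eqn_leq jm -ltnS ltn_ord.
  have := bil_iso (e j) (e i) hA; rewrite (fA i im) !bil_delta -colE !mxE (negbTE ij) /= mulr0.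
  by case: ifP => _; rewrite ?mulN1r ?mul1r// => /eqP; rewrite oppr_eq0 => /eqP.
have one (i : 'I_m.+1) : (i < m)%N -> A i i = 1.
  by move=> im; have := fA i im => /colP /(_ i); rewrite -colE !mxE !eqxx.
have trg : is_trig_mx A.
  by apply/is_trig_mxP => i j ij; apply: dgn; rewrite -val_eqE /= ltn_eqF.
move: dA; rewrite det_trig// big_ord_recr /= big1 ?mul1r; last first.
  by move=> i _; apply: one; rewrite /= ltn_ord.
move=> last; apply/matrixP => i j; rewrite mxE.
case: (altP (i =P j)) => [->|/dgn//]; have [jm|jm] := ltnP j m; first exact: one.
by have -> : j = ord_max by apply: val_inj; apply/eqP; rewrite /= eqn_leq jm -ltnS ltn_ord.
Qed.

(** Induction on the number m - j of vectors that are not yet fixed. The set Fix j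
is used both for j = 0, where it gives SO^+(1,m), and for j = 4, where it gives the
subgroup SO(n) of K. *)
Lemma Fix_component j A : (j <= m)%N -> Fix j A -> 0 < A ord0 ord0 -> \det A = 1 ->
  connected_component (Fix j) 1%:M A.
Proof.
have [k] := ubnP (m - j)%N; elim: k j A => // k IH j A; rewrite ltnS => mjk jm FA A0 dA.
have [jm'|mj] := ltnP j m; last first.
  have jE : j = m by apply/eqP; rewrite eqn_leq jm.
  rewrite jE in FA *; have -> := fix_all FA dA; apply: connected_component_refl.
  by split; [exact: lorentz_iso1|move=> i _; rewrite mul1mx].
have [A' [C [FA' cC CF CA CA']]] := fix_one_more jm' FA A0.
have Ciso : C `<=` @lorentz_isometry R m by move=> B /CF[].
have := IH j.+1 A'; rewrite subnS; have -> : (m - j).-1 = (m - j.+1)%N by rewrite subnS.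
have lt : (m - j.+1 < k)%N by rewrite -subnSK// in mjk; exact: leq_trans mjk.
move=> /(_ lt jm' FA'); rewrite -(connected_iso_sign cC Ciso CA CA').
rewrite -(connected_iso_det cC Ciso CA CA') => /(_ A0 dA) [D [D1 DF cD DA']].
apply: (@connected_component_trans _ _ A').
  exists D => //; split => // B /DF[hB fB]; split => // i ij; apply: fB.
  exact: leq_trans ij _.
exists C => //; split => //.
Qed.

End LorentzPaths.

Section SOplusCharacterization.
Variables (R : realType) (m : nat).
Implicit Types (A B : 'M[R]_m.+2).

Lemma lorentz_adj00 A : lorentz_adj A ord0 ord0 = A ord0 ord0.
Proof. by rewrite lorentz_adjE eqxx mulrN1 mulN1r opprK. Qed.

Lemma iso_row00 A : lorentz_isometry A ->
  A ord0 ord0 ^+ 2 = 1 + \sum_(i < m.+1) A ord0 (lift ord0 i) ^+ 2.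
Proof.
move=> /lorentz_iso_adj /iso_entry00; rewrite lorentz_adj00 => ->; congr (_ + _).
apply: eq_bigr => i _; rewrite lorentz_adjE eqxx eq_sym (negbTE (neq_lift _ _)).
by rewrite mul1r mulrN1 sqrrN.
Qed.

Lemma cone_form (x : 'cV[R]_m.+2) : x^T *m lorentz_form R m.+1 *m x = 0 <->
  x ord0 ord0 ^+ 2 = \sum_(i < m.+1) x (lift ord0 i) ord0 ^+ 2.
Proof.
rewrite bilE bil_sum big_ord_recl eqxx mulN1r.
under eq_bigr => i _.
  rewrite eq_sym (negbTE (neq_lift _ _)) mul1r -expr2; over.
rewrite -expr2; split.
  move=> /matrixP /(_ ord0 ord0); rewrite !mxE mulr1n => /eqP.
  by rewrite addrC subr_eq0 => /eqP ->.
by move=> ->; rewrite addNr; apply/matrixP => i j; rewrite !mxE mul0rn.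
Qed.

(** An isometry is tested on the null vectors e_0 + e_1 and e_0 - e_1; their images
have positive time component only if A_00 does. The converse is the Cauchy-Schwarz
inequality. *)
Lemma OplusP A : @Oplus R m.+1 A <-> lorentz_isometry A /\ 0 < A ord0 ord0.
Proof.
split=> [[hA cA]|[hA A0]]; split => //.
  pose x (s : R) : 'cV[R]_m.+2 := delta_mx ord0 ord0 + s *: delta_mx (lift ord0 ord0) ord0.
  have fx s : s ^+ 2 = 1 -> forward_light_cone (x s).
    move=> s1; split; last first.
      by rewrite !mxE !eqxx (negbTE (neq_lift _ _)) mulr0 addr0.
    apply/cone_form; rewrite !mxE !eqxx (negbTE (neq_lift _ _)) mulr0 addr0 expr1n.
    rewrite (bigD1 ord0)//= big1 ?addr0; last first.
      move=> j j0; rewrite !mxE (inj_eq (@lift_inj _ _)) (negbTE j0).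
      by rewrite eq_sym (negbTE (neq_lift _ _)) mulr0 addr0 expr0n.
    by rewrite !mxE !eqxx eq_sym (negbTE (neq_lift _ _)) mulr1 add0r s1.
  have [_ h1] := cA _ (fx 1 (expr1n _ _)).
  have s1 : (-1 : R) ^+ 2 = 1 by rewrite sqrrN expr1n.
  have [_ h2] := cA _ (fx (-1) s1).
  move: h1 h2; rewrite !mulmxDr -!scalemxAr -!colE !mxE; lra.
move=> x [/cone_form xc x0]; split.
  apply/eqP; move: xc => /cone_form; rewrite !bilE bil_iso// => /eqP.
  done.
rewrite mxE big_ord_recl; set s := \sum_(i < _) _.
(* The Cauchy-Schwarz inequality in the form: the sum of the squares of a x_i + b
   A_0i is nonnegative, where a = A_00 and b = x_0. *)
have : 0 <= \sum_(i < m.+1) (A ord0 ord0 * x (lift ord0 i) ord0 + x ord0 ord0 * A ord0 (lift ord0 i)) ^+ 2.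
  by apply: sumr_ge0 => i _; exact: sqr_ge0.
have -> : \sum_(i < m.+1) (A ord0 ord0 * x (lift ord0 i) ord0 + x ord0 ord0 * A ord0 (lift ord0 i)) ^+ 2 =
   A ord0 ord0 ^+ 2 * \sum_(i < m.+1) x (lift ord0 i) ord0 ^+ 2 +
   2 * A ord0 ord0 * x ord0 ord0 * s + x ord0 ord0 ^+ 2 * \sum_(i < m.+1) A ord0 (lift ord0 i) ^+ 2.
  by rewrite !mulr_sumr -!big_split /=; apply: eq_bigr => i _; ring.
rewrite -xc; have := iso_row00 hA; set q := \sum_(i < _) _ => hq.
have -> : q = A ord0 ord0 ^+ 2 - 1 by rewrite hq; ring.
move=> h; set a := A ord0 ord0 in A0 h *; set b := x ord0 ord0 in x0 h *.
have ab : 0 < a * b by rewrite mulr_gt0.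
have : 0 < 2 * (a * b) * (a * b + s).
  have -> : 2 * (a * b) * (a * b + s) = (a ^+ 2 * b ^+ 2 + 2 * a * b * s + b ^+ 2 * (a ^+ 2 - 1)) + b ^+ 2.
    ring.
  by rewrite ltr_wpDl// exprn_gt0.
by rewrite pmulr_rgt0// mulr_gt0.
Qed.

(** The two conditions are constant on connected sets of isometries, and conversely
Fix 0 consists of all isometries. *)
Lemma SOplusP A : @SOplus R m.+1 A <->
  [/\ lorentz_isometry A, 0 < A ord0 ord0 & \det A = 1].
Proof.
have O1 : @Oplus R m.+1 1%:M.
  by apply/OplusP; split; [exact: lorentz_iso1|rewrite mxE eqxx].
split=> [[C [C1 CO cC] CA]|[hA A0 dA]].
  have Ciso : C `<=` @lorentz_isometry R m.+1 by move=> B /CO[].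
  have [hA A0] := (OplusP A).1 (CO _ CA); split => //.
  by rewrite (connected_iso_det cC Ciso CA C1) det1.
have [] := @Fix_component R m.+1 0 A (leq0n _) _ A0 dA.
  by split => // i.
move=> C [C1 CF cC] CA; exists C => //; split => // B CB.
have Ciso : C `<=` @lorentz_isometry R m.+1 by move=> D /CF[].
apply/OplusP; split; first exact: Ciso.
by rewrite (connected_iso_sign cC Ciso CB C1) mxE eqxx.
Qed.

End SOplusCharacterization.

(** * Uniform convergence of loops and identity components of loop groups *)
Section LoopTopology.
Variables (R : realType) (n : nat) (K : numFieldType).
Local Notation L := (loops R K n).
Implicit Types (a b g : L) (e M : K).

(** Uniform convergence on the circle, entry by entry. *)
Lemma nbhs_loopsP g (A : set L) : nbhs g A <->
  exists2 e : K, 0 < e & forall g' : L,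
    (forall l, circle l -> forall i j, `|g l i j - g' l i j| < e) -> A g'.
Proof.
split=> [/uniform_nbhs[E [entE EA]]|[e e0 eA]].
  move: entE; rewrite -entourage_ballE => -[e /= e0 eE].
  exists e => // g' g'e; apply: EA => l lc; apply: eE => /=.
  by split => // i j; exact: g'e.
apply/uniform_nbhs; exists [set xy | ball xy.1 e xy.2]; split.
  by rewrite -entourage_ballE; exists e.
by move=> g' g'e; apply: eA => l lc i j; have [_] := g'e l lc; exact.
Qed.

Lemma cvg_loopsP (U : Type) (F : set_system U) {FF : Filter F} (f : U -> L) g :
  f x @[x --> F] --> g <-> forall e, 0 < e -> \forall x \near F,
    forall l, circle l -> forall i j, `|g l i j - f x l i j| < e.
Proof.
split=> [fg e e0|H A /nbhs_loopsP[e e0 eA]].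
  apply: (fg [set g' : L | forall l, circle l -> forall i j, `|g l i j - g' l i j| < e]).
  by apply/nbhs_loopsP; exists e.
by move: (H e e0); apply: filterS => x xe; exact: eA.
Qed.

(** The multiplication of loops is continuous for uniform convergence only at
bounded loops, and loops are not bounded in general. *)
Definition bounded_loop (a : L) :=
  exists2 M : K, 0 < M & forall l, circle l -> forall i j, `|a l i j| <= M.

Lemma loops_cvgM (U : Type) (F : set_system U) {FF : Filter F} (f g : U -> L) a b :
  bounded_loop a -> bounded_loop b -> f x @[x --> F] --> a -> g x @[x --> F] --> b ->
  (fun l => f x l *m g x l : 'M[K]_n.+4) @[x --> F] --> ((fun l => a l *m b l) : L).
Proof.
move=> [Ma Ma0 aM] [Mb Mb0 bM] /cvg_loopsP fa /cvg_loopsP gb; apply/cvg_loopsP => e e0.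
pose S := 1 + Ma + Mb; have S0 : 0 < S by rewrite !addr_gt0.
pose d := e / (n.+4%:R * S).
have d0 : 0 < d by rewrite divr_gt0// mulr_gt0// ltr0n.
(* This d' is below both d and 1: the bound 1 keeps f within 1 of a. *)
pose d' := d / (1 + d).
have d10 : 0 < 1 + d by rewrite addr_gt0.
have d'0 : 0 < d' by rewrite divr_gt0.
have d'1 : d' <= 1 by rewrite ler_pdivrMr// mul1r lerDr.
have d'd : d' < d by rewrite ltr_pdivrMr// ltr_pMr// ltrDl.
near=> x.
have hf : forall l, circle l -> forall i j, `|a l i j - f x l i j| < d' by near: x; exact: fa.
have hg : forall l, circle l -> forall i j, `|b l i j - g x l i j| < d' by near: x; exact: gb.
move=> l lc i j.
rewrite !mxE -sumrB; apply: le_lt_trans (ler_norm_sum _ _ _) _.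
have H k : `|a l i k * b l k j - f x l i k * g x l k j| <= d' * S.
  have -> : a l i k * b l k j - f x l i k * g x l k j =
    (a l i k - f x l i k) * b l k j + (a l i k - (a l i k - f x l i k)) * (b l k j - g x l k j).
    by ring.
  apply: le_trans (ler_normD _ _) _; rewrite !normrM.
  have h1 : `|a l i k - f x l i k| * `|b l k j| <= d' * Mb.
    by apply: ler_pM => //; [exact/ltW/hf|exact: bM].
  have h2 : `|a l i k - (a l i k - f x l i k)| * `|b l k j - g x l k j| <= (Ma + 1) * d'.
    apply: ler_pM => //; last exact/ltW/hg.
    apply: le_trans (ler_normB _ _) _; apply: lerD; first exact: aM.
    by apply: le_trans d'1; exact/ltW/hf.
  have -> : d' * S = d' * Mb + (Ma + 1) * d' by rewrite /S; ring.
  exact: lerD.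
have : \sum_k `|a l i k * b l k j - f x l i k * g x l k j| <= \sum_(k < n.+4) d' * S.
  by apply: ler_sum => k _; exact: H.
move=> /le_lt_trans; apply.
rewrite sumr_const card_ord -mulr_natl.
have -> : e = n.+4%:R * (d * S).
  rewrite /d; have : (n.+4%:R : K) != 0 by rewrite pnatr_eq0.
  by move: (n.+4%:R : K) (lt0r_neq0 S0) => N S1 N1; field; rewrite S1 N1.
by rewrite ltr_pM2l ?ltr0n// ltr_pM2r.
Unshelve. all: by end_near. Qed.

Lemma norm_adj (A : 'M[K]_n.+4) i j : `|lorentz_adj A i j| = `|A j i|.
Proof.
by rewrite lorentz_adjE !normrM; do 2 case: ifP => _; rewrite ?normrN normr1 mul1r mulr1.
Qed.

Lemma norm_adjB (A B : 'M[K]_n.+4) i j :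
  `|lorentz_adj A i j - lorentz_adj B i j| = `|A j i - B j i|.
Proof.
have -> : lorentz_adj A i j - lorentz_adj B i j = lorentz_adj (A - B) i j.
  by rewrite !lorentz_adjE !mxE; ring.
by rewrite norm_adj !mxE.
Qed.

Lemma loops_cvg_adj (U : Type) (F : set_system U) {FF : Filter F} (f : U -> L) a :
  f x @[x --> F] --> a ->
  (fun l => lorentz_adj (f x l)) @[x --> F] --> ((fun l => lorentz_adj (a l)) : L).
Proof.
move=> /cvg_loopsP fa; apply/cvg_loopsP => e e0.
by move: (fa e e0); apply: filterS => x h l lc i j; rewrite norm_adjB; exact: h.
Qed.

Lemma loops_cvg_cst (U : Type) (F : set_system U) {FF : Filter F} (f : U -> 'M[K]_n.+4) A :
  f x @[x --> F] --> A -> (fun=> f x) @[x --> F] --> ((fun=> A) : L).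
Proof.
move=> /cvg_mxP fA; apply/cvg_loopsP => e e0.
have : \forall x \near F, forall i j, `|A i j - f x i j| < e.
  apply: filter_forall => i; apply: filter_forall => j.
  by move/cvgrPdist_lt : (fA i j); exact.
by apply: filterS => x h l _.
Qed.

(** Loops are functions on the whole plane; equality on the circle makes them
topologically indistinguishable. *)
Definition circle_eq a b := forall l, circle l -> a l = b l.

Lemma circle_eq_nbhs a b : circle_eq a b -> forall A, nbhs a A -> A b.
Proof.
move=> ab A /nbhs_loopsP[e e0]; apply => l lc i j; by rewrite ab// subrr normr0.
Qed.

Lemma circle_eq_connected a b : circle_eq a b -> connected [set a; b].
Proof.
move=> ab B [x Bx] [C oC BC] _; rewrite BC; apply/seteqP; split => [y []//|y aby]; split => //.
have ba : circle_eq b a by move=> l lc; rewrite ab.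
have [/= xab Cx] : ([set a; b] `&` C) x by rewrite -BC.
have Ca : C a.
  case: xab => xE; rewrite xE in Cx => //.
  by apply: (circle_eq_nbhs ba); exact: open_nbhs_nbhs.
by case: aby => -> //; apply: (circle_eq_nbhs ab); exact: open_nbhs_nbhs.
Qed.

Lemma connected_component_circle_eq (A : set L) c a b : circle_eq a b -> A b ->
  connected_component A c a -> connected_component A c b.
Proof.
move=> ab Ab Aca; apply: (connected_component_trans Aca).
exists [set a; b]; last by right.
split; [by left| |exact: circle_eq_connected].
by move=> x [->|->] //; exact: connected_component_sub Aca.
Qed.

End LoopTopology.

Section LoopGroups.
Variables (R : realType) (n : nat) (K : numFieldType).
Local Notation L := (loops R K n).
Implicit Types (a b g : L) (G : set L).

(** What the identity component needs: a subset closed under products and inverses,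
of bounded loops of isometries, and depending only on the restriction to the circle.
*)
Definition loop_group G : Prop :=
  [/\ G (fun=> 1%:M), forall a b, G a -> G b -> G (fun l => a l *m b l),
      forall a, G a -> G (fun l => lorentz_adj (a l)),
      forall a, G a -> bounded_loop a /\ forall l, circle l -> lorentz_isometry (a l) &
      forall a b, circle_eq a b -> G a -> G b].

Definition id_component G := connected_component G (fun=> 1%:M).

Section theory.
Variable G : set L.
Hypothesis gG : loop_group G.

Lemma id_component1 : id_component G (fun=> 1%:M).
Proof. by apply: connected_component_refl; case: gG. Qed.

Lemma id_component_sub a : id_component G a -> G a.
Proof. exact: connected_component_sub. Qed.

Lemma id_component_eq a b : circle_eq a b -> id_component G a -> id_component G b.
Proof.
move=> ab Ga; apply: (connected_component_circle_eq ab _ Ga).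
by have [_ _ _ _ H] := gG; exact: (H _ _ ab (id_component_sub Ga)).
Qed.

Lemma mul_left_connected a (C : set L) : G a -> C `<=` G -> connected C ->
  connected ((fun c : L => (fun l => a l *m c l) : L) @` C).
Proof.
have [_ _ _ bG _] := gG.
move=> Ga CG cC; apply: connected_continuous_connected => //.
apply: continuous_in_subspaceT => c; rewrite inE => Cc.
exact: (loops_cvgM (bG _ Ga).1 (bG _ (CG _ Cc)).1 (cvg_cst a) (@cvg_id _ (nbhs c))).
Qed.

Lemma id_componentM a b : id_component G a -> id_component G b ->
  id_component G (fun l => a l *m b l).
Proof.
have [G1 GM _ _ _] := gG.
move=> Ga [C [C1 CG cC] Cb]; apply: (connected_component_trans Ga).
have Ga' := id_component_sub Ga.
exists ((fun c : L => (fun l => a l *m c l) : L) @` C); last by exists b.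
split; [|by move=> _ [c Cc <-]; apply: GM => //; exact: CG|exact: mul_left_connected].
by exists (fun=> 1%:M) => //; apply/funext => l; rewrite mulmx1.
Qed.

Lemma id_componentV a : id_component G a -> id_component G (fun l => lorentz_adj (a l)).
Proof.
have [G1 GM GV GI Ge] := gG.
move=> Ga; have Ga' := id_component_sub Ga; have Gv := GV _ Ga'.
have [C [C1 CG cC] Ca] := Ga.
have comp : connected_component G (fun l => lorentz_adj (a l))
    (fun l => lorentz_adj (a l) *m a l).
  exists ((fun c : L => (fun l => lorentz_adj (a l) *m c l) : L) @` C); last by exists a.
  split; [|by move=> _ [c Cc <-]; apply: GM => //; exact: CG|exact: mul_left_connected].
  by exists (fun=> 1%:M) => //; apply/funext => l; rewrite mulmx1.
apply: connected_component_sym; apply: (connected_component_circle_eq _ _ comp) => //.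
by move=> l lc; apply/lorentz_isoP; exact: (GI _ Ga').2.
Qed.

(** The usual way to show that a loop is in the identity component: put it in a
continuous family over a connected parameter space. *)
Lemma id_component_path (T : topologicalType) (X : set T) (phi : T -> L) x0 :
  connected X -> {within X, continuous phi} -> (forall x, X x -> G (phi x)) ->
  X x0 -> id_component G (phi x0) -> forall x, X x -> id_component G (phi x).
Proof.
move=> cX cphi Gphi X0 G0 x Xx; apply: (connected_component_trans G0).
exists (phi @` X); last by exists x.
split; [by exists x0|by move=> _ [y Xy <-]; exact: Gphi|].
exact: connected_continuous_connected.
Qed.

End theory.
End LoopGroups.

(** * The involution sigma and the matrix Ptilde *)
Section SignMatrices.
Variables (T : fieldType) (n : nat).
Implicit Types A B : 'M[T]_n.+4.

Lemma signmx_conjE m (p q : pred nat) (A : 'M[T]_m) i j :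
  (signmx T m p *m A *m signmx T m q) i j = (-1) ^+ p i * A i j * (-1) ^+ q j.
Proof. by rewrite /signmx mul_diag_mx mul_mx_diag !mxE. Qed.

Lemma signmx_sqr m (p : pred nat) : signmx T m p *m signmx T m p = 1%:M.
Proof.
rewrite /signmx mulmx_diag -diag_const_mx; congr diag_mx.
by apply/rowP => j; rewrite !mxE -expr2 sqrr_sign.
Qed.

Lemma signmx_unit m (p : pred nat) : signmx T m p \in unitmx.
Proof. by have /mulmx1_unit[] := signmx_sqr m p. Qed.

Lemma signmx_inv m (p : pred nat) : invmx (signmx T m p) = signmx T m p.
Proof.
by rewrite -[RHS]mul1mx -(mulVmx (signmx_unit m p)) -mulmxA signmx_sqr mulmx1.
Qed.

Lemma sigmaE A : sigma A = signmx T n.+4 (fun i => i < 4)%N *m A *m signmx T n.+4 (fun i => i < 4)%N.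
Proof. by rewrite /sigma signmx_inv. Qed.

Lemma sigmaM A B : sigma (A *m B) = sigma A *m sigma B.
Proof.
rewrite !sigmaE -!mulmxA; do 2 congr (_ *m _).
by rewrite !mulmxA signmx_sqr mul1mx.
Qed.

Lemma sigma1 : sigma (1%:M : 'M[T]_n.+4) = 1%:M.
Proof. by rewrite sigmaE mulmx1 signmx_sqr. Qed.

Lemma sigmaD A B : sigma (A + B) = sigma A + sigma B.
Proof. by rewrite !sigmaE mulmxDr mulmxDl. Qed.

Lemma sigmaZ (a : T) A : sigma (a *: A) = a *: sigma A.
Proof. by rewrite !sigmaE -scalemxAr -scalemxAl. Qed.

Lemma sigmaN A : sigma (- A) = - sigma A.
Proof. by rewrite -scaleN1r sigmaZ scaleN1r. Qed.

Lemma sigma_entry A i j : sigma A i j = (-1) ^+ (i < 4)%N * A i j * (-1) ^+ (j < 4)%N.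
Proof. by rewrite sigmaE signmx_conjE. Qed.

Lemma sigma_adj A : sigma (lorentz_adj A) = lorentz_adj (sigma A).
Proof.
apply/matrixP => i j; rewrite sigma_entry /lorentz_adj /lorentz_form !signmx_conjE.
by rewrite ![_^T i j]mxE sigma_entry; ring.
Qed.

(** Ptilde^b, to treat both alternatives of the theorem together. *)
Definition Pt (b : bool) : 'M[T]_n.+4 := Ptilde T n ^+ b.

Lemma PtE b : Pt b = signmx T n.+4 (fun i => b && (i == 4)%N).
Proof.
case: b; rewrite /Pt ?expr1//= expr0 /signmx -[1]/(1%:M) -diag_const_mx; congr diag_mx.
by apply/rowP => j; rewrite !mxE.
Qed.

Lemma Pt_sqr b : Pt b *m Pt b = 1%:M.
Proof. by rewrite PtE signmx_sqr. Qed.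

Lemma PtK b A : Pt b *m (Pt b *m A) = A.
Proof. by rewrite mulmxA Pt_sqr mul1mx. Qed.

Lemma mulPtK b A : A *m Pt b *m Pt b = A.
Proof. by rewrite -mulmxA Pt_sqr mulmx1. Qed.

Lemma sigma_Pt b : sigma (Pt b) = Pt b.
Proof.
apply/matrixP => i j; rewrite sigma_entry PtE /signmx !mxE.
case: (altP (i =P j)) => [->|ij]; last by rewrite mulr0n mulr0 mul0r.
by rewrite mulrAC -expr2 sqrr_sign mul1r.
Qed.

Lemma Pt_adj b : lorentz_adj (Pt b) = Pt b.
Proof.
apply/matrixP => i j; rewrite PtE /lorentz_adj /lorentz_form !signmx_conjE /signmx !mxE.
case: (altP (i =P j)) => [->|ij].
  by rewrite eqxx mulrAC -expr2 sqrr_sign mul1r.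
by rewrite [j == i]eq_sym (negbTE ij) mulr0n mulr0 mul0r.
Qed.

Lemma Pt_iso b : lorentz_isometry (Pt b).
Proof. by apply/lorentz_isoP; rewrite Pt_adj Pt_sqr. Qed.

Lemma det_Pt b : (1 <= n)%N -> \det (Pt b) = (-1) ^+ b.
Proof.
move=> n1; rewrite PtE /signmx det_diag.
have n4 : (4 < n.+4)%N by rewrite !ltnS.
rewrite (bigD1 (Ordinal n4))//= big1 ?mulr1 ?mxE /= ?andbT// => i i4.
have := i4; rewrite -val_eqE /= => /negbTE i4'.
by rewrite mxE i4' andbF.
Qed.

Lemma Pt00 b : Pt b ord0 ord0 = 1.
Proof. by rewrite PtE /signmx !mxE eqxx andbF. Qed.

Lemma det_PtJ b A : \det (Pt b *m A *m Pt b) = \det A.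
Proof.
by rewrite !det_mulmx mulrAC -det_mulmx Pt_sqr det1 mul1r.
Qed.

Lemma iso_PtJ b A : lorentz_isometry A -> lorentz_isometry (Pt b *m A *m Pt b).
Proof. by move=> hA; do 2?apply: lorentz_isoM => //; exact: Pt_iso. Qed.

Lemma sigma_PtJ b A : sigma (Pt b *m A *m Pt b) = Pt b *m sigma A *m Pt b.
Proof. by rewrite !sigmaM sigma_Pt. Qed.

End SignMatrices.

Section PointGroups.
Variables (R : realType) (n : nat).

Lemma SOC1 : @SOC R n.+3 1%:M.
Proof. by split; [exact: lorentz_iso1|rewrite det1]. Qed.
Lemma SOCM A B : @SOC R n.+3 A -> @SOC R n.+3 B -> @SOC R n.+3 (A *m B).
Proof. by move=> [a1 a2] [b1 b2]; split; [exact: lorentz_isoM|rewrite det_mulmx a2 b2 mul1r]. Qed.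
Lemma SOCV A : @SOC R n.+3 A -> @SOC R n.+3 (lorentz_adj A).
Proof. by move=> [a1 a2]; split; [exact: lorentz_iso_adj|rewrite det_lorentz_adj]. Qed.
Lemma SOCJ b A : @SOC R n.+3 A -> @SOC R n.+3 (Pt _ n b *m A *m Pt _ n b).
Proof. by move=> [a1 a2]; split; [exact: iso_PtJ|rewrite det_PtJ]. Qed.

End PointGroups.

Section SOplusGroup.
Variables (R : realType) (m : nat).

Lemma SOplus1 : @SOplus R m.+1 1%:M.
Proof. by apply/SOplusP; split; [exact: lorentz_iso1|rewrite mxE eqxx|rewrite det1]. Qed.
Lemma OplusM (A B : 'M[R]_m.+2) : Oplus A -> Oplus B -> Oplus (A *m B).
Proof.
move=> [a1 a2] [b1 b2]; split; first exact: lorentz_isoM.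
by move=> x fx; rewrite -mulmxA; apply: a2; exact: b2.
Qed.
Lemma OplusV (A : 'M[R]_m.+2) : Oplus A -> Oplus (lorentz_adj A).
Proof.
move=> /OplusP[h1 h2]; apply/OplusP; split; first exact: lorentz_iso_adj.
by rewrite lorentz_adj00.
Qed.
Lemma SOplus_Oplus (A : 'M[R]_m.+2) : @SOplus R m.+1 A -> Oplus A.
Proof. by move=> /SOplusP[h1 h2 h3]; apply/OplusP. Qed.
Lemma SOplus_split (A : 'M[R]_m.+2) : @SOplus R m.+1 A <-> Oplus A /\ \det A = 1.
Proof.
split=> [h|[/OplusP[h1 h2] h3]]; last by apply/SOplusP.
by split; [exact: SOplus_Oplus|case/SOplusP : h].
Qed.
Lemma SOplusM (A B : 'M[R]_m.+2) :
  @SOplus R m.+1 A -> @SOplus R m.+1 B -> @SOplus R m.+1 (A *m B).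
Proof.
move=> /SOplus_split[a1 a2] /SOplus_split[b1 b2]; apply/SOplus_split.
by split; [exact: OplusM|rewrite det_mulmx a2 b2 mul1r].
Qed.
Lemma SOplusV (A : 'M[R]_m.+2) : @SOplus R m.+1 A -> @SOplus R m.+1 (lorentz_adj A).
Proof.
move=> /SOplus_split[a1 a2]; apply/SOplus_split.
by split; [exact: OplusV|rewrite det_lorentz_adj].
Qed.

End SOplusGroup.

Section PtildeAction.
Variables (R : realType) (n : nat).

Lemma Pt_Oplus b : @Oplus R n.+3 (Pt R n b).
Proof. by apply/OplusP; split; [exact: Pt_iso|rewrite Pt00]. Qed.
Lemma SOplusJ b A : @SOplus R n.+3 A -> @SOplus R n.+3 (Pt _ n b *m A *m Pt _ n b).
Proof.
move=> /SOplus_split[a1 a2]; apply/SOplus_split; split; last by rewrite det_PtJ.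
by do 2?apply: OplusM => //; exact: Pt_Oplus.
Qed.

End PtildeAction.

Section Boundedness.
Variables (R : realType) (n : nat) (K : numFieldType).

Lemma circle_compact : compact (@circle R).
Proof.
have -> : @circle R = (@expi R) @` `[0, 2 * pi].
  apply/seteqP; split => [l /expi_surj[t tI <-]|_ [t _ <-]]; last exact: circle_expi.
  by exists t => //=; rewrite in_itv.
apply: continuous_compact; last exact: segment_compact.
apply: continuous_subspaceT => t; apply/cvg_cplxP; split.
  exact: continuous_cos.
exact: continuous_sin.
Qed.

(** Compactness of the circle, in the covering form that produces a common bound. *)
Lemma within_circle_bounded (a : loops R K n) :
  {within @circle R, continuous (a : cplx R -> 'M[K]_n.+4)} -> bounded_loop a.
Proof.
move=> ac.
have := (near_covering_withinP _).2 ((compact_near_coveringP _).1 circle_compact).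
move=> /(_ K (pinfty_nbhs K) (fun M l => forall i j, `|a l i j| <= M) _) cov.
have : \forall M \near pinfty_nbhs K, circle (R:=R) `<=` fun l => forall i j, `|a l i j| <= M.
  apply: cov => l lc.
  have H i j : \forall l' \near l & M \near pinfty_nbhs K, circle l' -> `|a l' i j| <= M.
    have /cvg_mxP/(_ i j) : a l' @[l' --> within (@circle R) (nbhs l)] --> a l.
      by apply: ((subspace_continuousP _ _).1 ac).
    move=> /cvgrPdist_lt /(_ 1 ltr01) h1.
    exists ([set l' | circle l' -> `|a l i j - a l' i j| < 1], [set M | `|a l i j| + 1 <= M]).
      split => //=; apply: nbhs_pinfty_ge; apply: ger0_real.
      by rewrite addr_ge0.
    move=> [l' M] /= [h2 h3] l'c; apply: le_trans h3.
    have -> : a l' i j = a l i j - (a l i j - a l' i j) by rewrite subKr.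
    apply: le_trans (ler_normB _ _) _; rewrite lerD//; exact/ltW/h2.
  have : \forall l' \near l & M \near pinfty_nbhs K, forall i j, circle l' -> `|a l' i j| <= M.
    exact: (filter_forall _ (fun i => filter_forall _ (H i))).
  by move=> [PQ pq sub]; exists PQ => // x /sub h xc i j; exact: h.
move=> h; have h' : \forall M \near pinfty_nbhs K, (0 : K) < M.
  by apply: nbhs_pinfty_gt; exact: real0.
by have [M [M1 M2]] := filter_ex (filterI h h'); exists M.
Qed.

End Boundedness.

Section ComponentConjugation.
Variables (R : realType) (n : nat) (K : numFieldType) (G : set (loops R K n)) (b : bool).
Local Notation conj_Pt := (fun (c : loops R K n) => (fun l => Pt K n b *m c l *m Pt K n b) : loops R K n).

(** Conjugation by the diagonal sign matrix Ptilde^b preserves absolute values of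
entries, so it is continuous. *)
Lemma id_componentJ a : (forall a, G a -> G (conj_Pt a)) -> id_component G a ->
  id_component G (fun l => Pt K n b *m a l *m Pt K n b).
Proof.
move=> GP [C [C1 CG cC] Ca]; exists (conj_Pt @` C); last by exists a.
split.
- by exists (fun=> 1%:M) => //; apply/funext => l; rewrite mulmx1 Pt_sqr.
- by move=> _ [c Cc <-]; apply: GP; exact: CG.
apply: connected_continuous_connected => //.
apply: continuous_in_subspaceT => c _.
suff h : conj_Pt x @[x --> nbhs c] --> conj_Pt c by exact: h.
apply/cvg_loopsP => e e0.
have /cvg_loopsP/(_ e e0) : (x : loops R K n) @[x --> nbhs c] --> c by exact: cvg_id.
apply: filterS => x h l lc i j; rewrite PtE !signmx_conjE -mulrBl -mulrBr !normrM.
by rewrite !normrX !normrN1 !expr1n mul1r mulr1; exact: h.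
Qed.

End ComponentConjugation.

(** * The twisted loop groups *)
Lemma within_post (T U V : topologicalType) (A : set T) (f : T -> U) (g : U -> V) :
  {within A, continuous f} -> continuous g ->
  {within A, continuous (fun x => g (f x))}.
Proof.
move=> fA gc; apply/subspace_continuousP => x Ax.
have fx := (subspace_continuousP _ _).1 fA x Ax.
exact: (@cvg_comp _ _ _ f g _ (nbhs (f x)) _ fx (gc (f x))).
Qed.

Section WithinContinuity.
Variables (T : topologicalType) (K : numFieldType) (n : nat) (A : set T).
Implicit Types (f g : T -> 'M[K]_n.+4).

Lemma within_mulmx f g : {within A, continuous f} -> {within A, continuous g} ->
  {within A, continuous (fun x => f x *m g x)}.
Proof. by move=> fA gA x; apply: cvg_mulmx; [exact: fA|exact: gA]. Qed.

Lemma within_cst (M : 'M[K]_n.+4) : {within A, continuous (fun=> M)}.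
Proof. by move=> x; exact: cvg_cst. Qed.

Lemma within_adj f : {within A, continuous f} ->
  {within A, continuous (fun x => lorentz_adj (f x))}.
Proof.
move=> fA x; apply: cvg_mulmx; last exact: cvg_cst.
by apply: cvg_mulmx; [exact: cvg_cst|apply: cvg_trmx; exact: fA].
Qed.

Lemma within_circle_eq_continuous f g : (forall x, A x -> f x = g x) ->
  {within A, continuous f} -> {within A, continuous g}.
Proof.
move=> fg fA; apply/subspace_continuousP => x Ax.
have h : f y @[y --> within A (nbhs x)] --> f x.
  exact: ((subspace_continuousP _ _).1 fA x Ax).
suff : g y @[y --> within A (nbhs x)] --> g x by [].
rewrite -(fg x Ax); apply: cvg_trans h; apply: near_eq_cvg; near=> y; apply: fg.
by near: y; exact: withinT.
Unshelve. all: by end_near. Qed.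

End WithinContinuity.

Section MatrixDerivable.
Variables (K : numFieldType) (n : nat).
Implicit Types (f g : K -> 'M[K]_n.+4) (x : K).

Lemma derivable_mulmx f g x : derivable f x 1 -> derivable g x 1 ->
  derivable (fun y => f y *m g y) x 1.
Proof.
by move=> /derivableP df /derivableP dg; have [] := is_derive_mulmx df dg.
Qed.

Lemma is_derive_adj f x df : is_derive x 1 f df ->
  is_derive x 1 (fun y => lorentz_adj (f y)) (lorentz_adj df).
Proof.
move=> /is_derive_trmx h.
have h1 := is_derive_mulmx (is_derive_cst (lorentz_form K n.+3) x 1) h.
have h2 := is_derive_mulmx h1 (is_derive_cst (lorentz_form K n.+3) x 1).
by apply: is_derive_eq h2 _; rewrite mul0mx add0r mulmx0 addr0.
Qed.

Lemma derivable_adj f x : derivable f x 1 -> derivable (fun y => lorentz_adj (f y)) x 1.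
Proof. by move=> /derivableP /is_derive_adj[]. Qed.

End MatrixDerivable.

Section CplxMatrix.
Variables (R : realType) (m : nat).
Implicit Types A B : 'M[R]_m.

Lemma cmxM A B : cmx (A *m B) = cmx A *m cmx B. Proof. exact: map_mxM. Qed.
Lemma cmxD A B : cmx (A + B) = cmx A + cmx B. Proof. exact: map_mxD. Qed.
Lemma cmxN A : cmx (- A) = - cmx A. Proof. exact: map_mxN. Qed.
Lemma cmxZ a A : cmx (a *: A) = tocplx a *: cmx A. Proof. exact: map_mxZ. Qed.
Lemma cmx1 : cmx (1%:M : 'M[R]_m) = 1%:M. Proof. exact: map_mx1. Qed.
Lemma cmx0 : cmx (0 : 'M[R]_m) = 0. Proof. exact: map_mx0. Qed.
Lemma cmx_det A : \det (cmx A) = tocplx (\det A). Proof. exact: det_map_mx. Qed.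
Lemma cmx_inj : injective (@cmx R m).
Proof. by move=> A B /matrixP h; apply/matrixP => i j; have := h i j; rewrite !mxE => -[]. Qed.
Lemma cmx_signmx p : cmx (signmx R m p) = signmx (cplx R) m p.
Proof.
apply/matrixP => i j; rewrite !mxE rmorphMn /=; congr (_ *+ _).
by rewrite rmorph_sign.
Qed.
End CplxMatrix.

Lemma cmx_form (R : realType) m : cmx (lorentz_form R m) = lorentz_form (cplx R) m.
Proof. exact: cmx_signmx. Qed.

Lemma cmx_adj (R : realType) m (A : 'M[R]_m.+1) : cmx (lorentz_adj A) = lorentz_adj (cmx A).
Proof. by rewrite /lorentz_adj !cmxM cmx_form /cmx map_trmx. Qed.

Lemma cmx_sigma (R : realType) n (A : 'M[R]_n.+4) : cmx (sigma A) = sigma (cmx A).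
Proof. by rewrite !sigmaE !cmxM !cmx_signmx. Qed.

Lemma cmx_Pt (R : realType) n b : cmx (Pt R n b) = Pt (cplx R) n b.
Proof. by rewrite !PtE cmx_signmx. Qed.

Lemma cmx_iso (R : realType) m (A : 'M[R]_m.+1) :
  lorentz_isometry A <-> lorentz_isometry (cmx A).
Proof.
rewrite !lorentz_isoP -cmx_adj -cmxM -(cmx1 R m.+1); split=> [->//|].
exact: cmx_inj.
Qed.

Lemma cmx_SOC (R : realType) n (A : 'M[R]_n.+4) : @SOplus R n.+3 A -> @SOC R n.+3 (cmx A).
Proof.
by move=> /SOplusP[h1 _ h3]; split; [exact/cmx_iso|rewrite cmx_det h3].
Qed.

Lemma cmx_continuous (R : realType) n : continuous (@cmx R n).
Proof.
move=> A; suff h : cmx B @[B --> A] --> cmx A by exact: h.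
apply: (@cvg_mxP _ _ _ _ (nbhs A) (nbhs_filter A) (@cmx R n) (cmx A)).2 => i j.
rewrite mxE; under eq_fun do rewrite mxE.
have h : B i j @[B --> A] --> A i j by exact: entry_continuous.
by apply: (cvg_comp _ _ h); exact: tocplx_continuous.
Qed.

(** The groups Lambda G and Lambda G^C differ only in the set P of admissible
values. *)
Lemma pointwise_loop_group (R : realType) n (K : numFieldType) (P : set 'M[K]_n.+4) :
  P 1%:M -> (forall A B, P A -> P B -> P (A *m B)) ->
  (forall A, P A -> P (lorentz_adj A)) -> P `<=` @lorentz_isometry K n.+3 ->
  loop_group [set g : loops R K n |
    [/\ {within @circle R, continuous (g : cplx R -> 'M[K]_n.+4)},
      forall l, circle l -> P (g l) & forall l, circle l -> sigma (g l) = g (- l)]].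
Proof.
move=> P1 PM PV Piso; split.
- by split=> [|l _|l _]; [exact: within_cst|exact: P1|exact: sigma1].
- move=> a b [a1 a2 a3] [b1 b2 b3]; split=> [|l lc|l lc].
  + exact: (@within_mulmx _ _ _ _ (a : cplx R -> _) (b : cplx R -> _) a1 b1).
  + by apply: PM; [exact: a2|exact: b2].
  + by rewrite sigmaM a3// b3.
- move=> a [a1 a2 a3]; split=> [|l lc|l lc].
  + exact: (@within_adj _ _ _ _ (a : cplx R -> _) a1).
  + by apply: PV; exact: a2.
  + by rewrite sigma_adj a3.
- move=> a [a1 a2 a3]; split; first exact: within_circle_bounded.
  by move=> l /a2 /Piso.
- move=> a b ab [a1 a2 a3]; split=> [|l lc|l lc].
  + exact: (@within_circle_eq_continuous _ _ _ _ (a : cplx R -> _) (b : cplx R -> _) ab a1).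
  + by rewrite -ab//; exact: a2.
  + by rewrite -ab// -ab//; [exact: a3|exact: circleN].
Qed.

Section LoopGroupInstances.
Variables (R : realType) (n : nat).

Lemma LambdaGC_group : loop_group (@LambdaGC R n).
Proof.
apply: (@pointwise_loop_group R n (cplx R) (@SOC R n.+3)).
- exact: SOC1.
- exact: SOCM.
- exact: SOCV.
- by move=> A [].
Qed.

Lemma LambdaG_group : loop_group (@LambdaG R n).
Proof.
apply: (@pointwise_loop_group R n R (@SOplus R n.+3)).
- exact: SOplus1.
- exact: SOplusM.
- exact: SOplusV.
- by move=> A /SOplusP[].
Qed.

Lemma LambdaplusGC_group : loop_group (@LambdaplusGC R n).
Proof.
have [g1 gM gV gI ge] := LambdaGC_group.
split.
- split => //; exists (fun=> 1%:M); split => //; first exact: within_cst.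
  by move=> l _; exact: SOC1.
- move=> a b [a0 [h [h1 h2 h3 h4]]] [b0 [k [k1 k2 k3 k4]]]; split; first exact: gM.
  exists (fun l => h l *m k l); split.
  + exact: (within_mulmx h1 k1).
  + by move=> l lo; apply: derivable_mulmx; [exact: h2|exact: k2].
  + by move=> l lo; apply: SOCM; [exact: h3|exact: k3].
  + by move=> l lc; rewrite h4// k4.
- move=> a [a0 [h [h1 h2 h3 h4]]]; split; first exact: gV.
  exists (fun l => lorentz_adj (h l)); split.
  + exact: (within_adj h1).
  + by move=> l lo; apply: derivable_adj; exact: h2.
  + by move=> l lo; apply: SOCV; exact: h3.
  + by move=> l lc; rewrite h4.
- by move=> a [/gI].
- move=> a b ab [a0 [h [h1 h2 h3 h4]]]; split; first exact: ge ab a0.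
  by exists h; split => // l lc; rewrite h4// ab.
Qed.

Lemma LambdaGC_PtJ b (a : loops R (cplx R) n) : @LambdaGC R n a ->
  @LambdaGC R n (fun l => Pt _ n b *m a l *m Pt _ n b).
Proof.
move=> [a1 a2 a3]; split=> [|l lc|l lc].
- have c P := @within_cst (cplx R) (cplx R) n (@circle R) P.
  exact: (within_mulmx (within_mulmx (c (Pt _ n b)) a1) (c (Pt _ n b))).
- by apply: SOCJ; exact: a2.
- by rewrite sigma_PtJ a3.
Qed.

Lemma LambdaplusGC_PtJ b (a : loops R (cplx R) n) : @LambdaplusGC R n a ->
  @LambdaplusGC R n (fun l => Pt _ n b *m a l *m Pt _ n b).
Proof.
move=> [a0 [h [h1 h2 h3 h4]]]; split; first exact: LambdaGC_PtJ.
exists (fun l => Pt _ n b *m h l *m Pt _ n b); split.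
- have c P := @within_cst (cplx R) (cplx R) n (@cdisc R) P.
  exact: (within_mulmx (within_mulmx (c (Pt _ n b)) h1) (c (Pt _ n b))).
- move=> l lo.
  have c P := @derivable_cst (cplx R) (cplx R) _ (P : 'M[cplx R]_n.+4) l 1.
  exact: (derivable_mulmx (derivable_mulmx (c (Pt _ n b)) (h2 l lo)) (c (Pt _ n b))).
- by move=> l lo; apply: SOCJ; exact: h3.
- by move=> l lc; rewrite h4.
Qed.

Lemma LambdaG_cmx (a : loops R R n) : @LambdaG R n a ->
  @LambdaGC R n (fun l => cmx (a l)).
Proof.
move=> [a1 a2 a3]; split=> [|l lc|l lc].
- exact: (within_post a1 (@cmx_continuous R n.+4)).
- by apply: cmx_SOC; exact: a2.
- by rewrite -cmx_sigma a3.
Qed.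

Lemma LambdaplusGC_cst (A : 'M[cplx R]_n.+4) : @SOC R n.+3 A -> sigma A = A ->
  @LambdaplusGC R n (fun=> A).
Proof.
move=> hA sA; split.
  by split=> [|l _|l _] //; exact: within_cst.
exists (fun=> A); split => //; first exact: within_cst.
Qed.

Lemma LambdaG_cst (A : 'M[R]_n.+4) : @SOplus R n.+3 A -> sigma A = A ->
  @LambdaG R n (fun=> A).
Proof. by move=> hA sA; split=> [|l _|l _] //; exact: within_cst. Qed.

Lemma LambdaplusGC0_GC0 (a : loops R (cplx R) n) : @LambdaplusGC0 R n a -> @LambdaGC0 R n a.
Proof.
move=> [C [C1 CG cC] Ca]; exists C => //; split => // x /CG[].
by [].
Qed.

End LoopGroupInstances.

(** * Evaluation of plus loops at zero *)
Lemma within_comp (T U V : topologicalType) (A : set T) (B : set U)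
    (phi : T -> U) (h : U -> V) :
  {within A, continuous phi} -> {within B, continuous h} ->
  (forall x, A x -> B (phi x)) -> {within A, continuous (fun x => h (phi x))}.
Proof.
move=> pc hc AB; apply/subspace_continuousP => x Ax.
have px := (subspace_continuousP _ _).1 pc x Ax.
have hx := (subspace_continuousP _ _).1 hc _ (AB x Ax).
move=> W /hx; rewrite nbhs_simpl /= => /px; rewrite !nbhs_simpl /= /within /=.
apply: filterS => y H Ay; exact: (H Ay (AB y Ay)).
Qed.

Lemma is_derive_chain (K : numFieldType) (V : normedModType K) (g : K -> K)
    (F : K -> V) (z c : K) (D : V) :
  is_derive z 1 g c -> is_derive (g z) 1 F D ->
  is_derive z 1 (fun w => F (g w)) (c *: D).
Proof.
move=> [dg gc] [dF FD].
have dg' := (derivable1_diffP _ _).1 dg; have dF' := (derivable1_diffP _ _).1 dF.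
have dFg : differentiable (F \o g) z by exact: differentiable_comp.
apply: DeriveDef; first exact/derivable1_diffP.
have gE : 'd g z 1 = c by rewrite -deriveE.
rewrite deriveE// diff_comp//= gE -[X in 'd F _ X]mulr1.
by rewrite -[c * 1]/(c *: (1 : K)) linearZ /= -deriveE// FD.
Qed.

Section BlockSign.
Variables (T : numFieldType) (n : nat).
Implicit Types A B : 'M[T]_n.+4.

Definition ulblock A : 'M[T]_4 := @ulsubmx T 4 n 4 n A.
Definition drblock A : 'M[T]_n := @drsubmx T 4 n 4 n A.
(** On matrices fixed by sigma, which are block diagonal, this is a character with
values 1 and -1; it detects the two orientations of the R^4 factor. *)
Definition eps A : T := \det (ulblock A).

Lemma sigma_offdiag A (i j : 'I_n.+4) : sigma A = A -> (i < 4)%N != (j < 4)%N -> A i j = 0.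
Proof.
move=> sA ij; have : A i j = - A i j.
  rewrite -{1}sA sigma_entry; case: (i < 4)%N ij; case: (j < 4)%N => //= _.
    by rewrite expr1 expr0 mulr1 mulN1r.
  by rewrite expr1 expr0 mul1r mulrN1.
by move=> /eqP; rewrite -addr_eq0 -mulr2n mulrn_eq0 /= => /eqP.
Qed.

Lemma sigma_block A : sigma A = A ->
  A = block_mx (ulblock A) 0 0 (drblock A) :> 'M[T]_(4 + n).
Proof.
move=> sA; rewrite -[LHS](@submxK T 4 n 4 n); congr block_mx.
  apply/matrixP => i j; rewrite !mxE; apply: sigma_offdiag => //=.
  by rewrite ltn_ord.
apply/matrixP => i j; rewrite !mxE; apply: sigma_offdiag => //=.
by rewrite ltn_ord.
Qed.

Lemma block_sigma (a : 'M[T]_4) (b : 'M[T]_n) :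
  sigma (block_mx a 0 0 b : 'M[T]_n.+4) = block_mx a 0 0 b.
Proof.
apply/matrixP => i j; rewrite sigma_entry.
have [ij|ij] := eqVneq (i < 4)%N (j < 4)%N.
  by rewrite ij mulrAC -expr2 sqrr_sign mul1r.
suff -> : (block_mx a 0 0 b : 'M[T]_(4 + n)) i j = 0 by rewrite mulr0 mul0r.
move: ij; case: (@split_ordP 4 n i) => i' ->; case: (@split_ordP 4 n j) => j' -> /=;
  rewrite ?ltn_ord//= => _.
- by rewrite block_mxEur mxE.
- by rewrite block_mxEdl mxE.
Qed.

Lemma lorentz_block : lorentz_form T n.+3 =
  block_mx (lorentz_form T 3) 0 0 1%:M :> 'M[T]_(4 + n).
Proof.
rewrite -[LHS](@submxK T 4 n 4 n); congr block_mx; apply/matrixP => i j; rewrite !mxE.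
- by [].
- by rewrite [_ == _](_ : _ = false) ?mulr0n//; exact: eq_lrshift.
- by have -> : (rshift 4 i == lshift n j) = false by exact: eq_rlshift.
- by have -> : (rshift 4 i == rshift 4 j) = (i == j) by exact: eq_rshift.
Qed.

Lemma block_iso (a : 'M[T]_4) (b : 'M[T]_n) :
  lorentz_isometry (block_mx a 0 0 b : 'M[T]_n.+4) <->
  lorentz_isometry a /\ b^T *m b = 1%:M.
Proof.
have E : (block_mx a 0 0 b : 'M[T]_(4 + n))^T *m block_mx (lorentz_form T 3) 0 0 1%:M *m
    (block_mx a 0 0 b : 'M[T]_(4 + n)) =
   block_mx (a^T *m lorentz_form T 3 *m a) 0 0 (b^T *m b).
  by rewrite tr_block_mx !trmx0 !mulmx_block !(mul0mx, mulmx0, addr0, add0r, mulmx1).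
rewrite /lorentz_isometry /=; split.
  by rewrite lorentz_block => h; have := etrans (esym E) h => /eq_block_mx[-> _ _ ->].
by move=> [ha hb]; rewrite lorentz_block; apply: (etrans E); rewrite ha hb.
Qed.

Lemma ulblock_mul A B : sigma A = A -> ulblock (A *m B) = ulblock A *m ulblock B.
Proof.
move=> sA; rewrite {1}(sigma_block sA) -{1}(@submxK T 4 n 4 n B).
rewrite /ulblock (@mulmx_block T 4 n 4 n 4 n).
by rewrite block_mxKul mul0mx addr0.
Qed.

Lemma eps_mul A B : sigma A = A -> eps (A *m B) = eps A * eps B.
Proof. by move=> sA; rewrite /eps ulblock_mul// det_mulmx. Qed.

Lemma eps1 : eps 1%:M = 1.
Proof.
rewrite /eps /ulblock; have -> : (1%:M : 'M[T]_n.+4) = (1%:M : 'M[T]_(4 + n)) by [].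
by rewrite scalar_mx_block block_mxKul det1.
Qed.

Lemma eps_sqr A : sigma A = A -> lorentz_isometry A -> eps A ^+ 2 = 1.
Proof.
move=> sA; rewrite {1}(sigma_block sA) => /block_iso[/lorentz_iso_det + _].
by [].
Qed.

Lemma eps_adj A : sigma A = A -> lorentz_isometry A -> eps (lorentz_adj A) = eps A.
Proof.
move=> sA hA; have := eps_mul (lorentz_adj A) sA; rewrite lorentz_adjV// eps1 => h.
have e2 := eps_sqr sA hA; have e0 : eps A != 0.
  by apply/eqP => e0; move: e2; rewrite e0 expr0n /= => /eqP; rewrite eq_sym oner_eq0.
by apply: (mulfI e0); rewrite -h -expr2 e2.
Qed.

Lemma eps_PtJ b A : sigma A = A -> eps (Pt T n b *m A *m Pt T n b) = eps A.
Proof.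
move=> sA; rewrite -mulmxA !eps_mul ?sigma_Pt// mulrCA -expr2 eps_sqr ?mulr1//.
  exact: sigma_Pt.
exact: Pt_iso.
Qed.

Lemma eps_continuous (M : 'M[T]_n.+4) : {for M, continuous (@eps)}.
Proof.
suff h : ulblock N @[N --> M] --> ulblock M by exact: cvg_det h.
apply: (@cvg_mxP _ _ _ _ (nbhs M) (nbhs_filter M) ulblock (ulblock M)).2 => i j.
rewrite !mxE; under eq_fun do rewrite !mxE.
exact: entry_continuous.
Qed.

End BlockSign.

Section EvaluationAtZero.
Variables (R : realType) (n : nat).
Local Notation L := (loops R (cplx R) n).
Implicit Types (a b : L) (h k : cplx R -> 'M[cplx R]_n.+4).

Definition disc_extension a h :=
  [/\ {within @cdisc R, continuous h}, forall l, odisc l -> derivable h l 1,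
      forall l, cdisc l -> @SOC R n.+3 (h l) & forall l, circle l -> h l = a l].

Lemma extension_entry h i j : {within @cdisc R, continuous h} ->
  (forall l, odisc l -> derivable h l 1) -> disc_holomorphic (fun l => h l i j).
Proof.
move=> hc hd; split.
  exact: (within_post hc (@entry_continuous (cplx R) n.+4 n.+4 i j)).
by move=> l /hd /derivableP /is_derive_mxP /(_ i j)[].
Qed.

(** The mean value property bounds the value at 0 by the values on the circle,
separately for real and imaginary part. *)
Lemma extension_close a b h k (e : R) : disc_extension a h -> disc_extension b k ->
  0 <= e -> (forall l, circle l -> forall i j, `|a l i j - b l i j| <= tocplx e) ->
  forall i j, `|h 0 i j - k 0 i j| <= tocplx (e + e).
Proof.
move=> [h1 h2 h3 h4] [k1 k2 k3 k4] e0 ab i j.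
have hd := extension_entry i j h1 h2; have kd := extension_entry i j k1 k2.
have dd := disc_holomorphicD hd (disc_holomorphic_lin (-1) 0 kd).
have E l : h l i j + (-1 * k l i j + 0) = h l i j - k l i j by rewrite mulN1r addr0.
apply: le_trans (norm_le_reim _) _; rewrite lecR_tocplx lerD//.
  rewrite -E; apply: (disc_bound dd) => l lc; rewrite E h4// k4//.
  by rewrite -lecR_tocplx; apply: le_trans (norm_re _) _; exact: ab.
rewrite -E; apply: (disc_bound_im dd) => l lc; rewrite E h4// k4//.
by rewrite -lecR_tocplx; apply: le_trans (norm_im _) _; exact: ab.
Qed.

Lemma extension_unique a b h k : disc_extension a h -> disc_extension b k ->
  circle_eq a b -> h 0 = k 0.
Proof.
move=> ah bk ab; apply/matrixP => i j; apply/eqP; rewrite -subr_eq0 -normr_le0.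
have := extension_close ah bk (lexx 0); rewrite addr0; apply => l lc i' j'.
by rewrite ab// subrr normr0.
Qed.

(** By uniqueness of the extension, sigma(h(l)) = h(-l) on the whole disc; at l = 0
this is the claim. *)
Lemma extension_sigma a h : @LambdaGC R n a -> disc_extension a h -> sigma (h 0) = h 0.
Proof.
move=> [_ _ a3] [h1 h2 h3 h4].
pose Q := signmx (cplx R) n.+4 (fun i => i < 4)%N.
pose k l := Q *m h (- l) *m Q.
have kS l : k l = sigma (h (- l)) by rewrite sigmaE.
have kE : disc_extension a k.
  split.
  - have hN : {within @cdisc R, continuous (fun l => h (- l))}.
      apply: (within_comp _ h1) => [|l lc]; last by rewrite /cdisc /= normrN.
      by apply: continuous_subspaceT => y; exact: continuousN.
    have c := @within_cst (cplx R) (cplx R) n (@cdisc R) Q.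
    exact: (within_mulmx (within_mulmx c hN) c).
  - move=> l lo.
    have /h2/derivableP hl : odisc (- l) by rewrite /odisc /= normrN.
    have dN : is_derive l 1 (fun w : cplx R => - w) (- 1) by exact: is_deriveNid.
    have [hN _] := is_derive_chain dN hl.
    have c := @derivable_cst (cplx R) (cplx R) _ (Q : 'M[cplx R]_n.+4) l 1.
    exact: (derivable_mulmx (derivable_mulmx c hN) c).
  - move=> l lc; have [hi hd] : @SOC R n.+3 (h (- l)) by apply: h3; rewrite /cdisc /= normrN.
    rewrite kS; split.
      by apply/lorentz_isoP; rewrite -sigma_adj -sigmaM (lorentz_isoP _).1// sigma1.
    by rewrite sigmaE !det_mulmx hd mulr1 -det_mulmx signmx_sqr det1.
  - move=> l lc; rewrite kS h4; last exact: circleN.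
    by rewrite a3 ?opprK//; exact: circleN.
have aE : disc_extension a h by split.
by have := extension_unique kE aE (fun _ _ => erefl); rewrite kS oppr0.
Qed.

Lemma eps_continuous_at (M : 'M[cplx R]_n.+4) :
  exists2 d : R, 0 < d & forall N : 'M[cplx R]_n.+4, (forall i j, `|M i j - N i j| < tocplx d) ->
    `|eps M - eps N| < 1.
Proof.
have /cvgrPdist_lt := @eps_continuous (cplx R) n M.
move=> /(_ 1 ltr01) /nbhs_ballP[e /= e0 eP].
have [eE e0'] := gt0_cplx e0.
exists (recplx e) => // N MN; apply: eP; split => // i j.
by rewrite /ball /= eE.
Qed.

(** The value at 0 of the extension depends continuously on the loop and is block
diagonal, so its sign eps is locally constant on the group of plus loops and equals
1 at the constant loop I. *)
Lemma eps_LambdaplusGC0 a h : @LambdaplusGC0 R n a -> disc_extension a h -> eps (h 0) = 1.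
Proof.
move=> [C [C1 CG cC] Ca] ah.
(* A choice of extensions; their values at 0 do not depend on it. *)
have /choice[H HP] : forall b : L, exists h, @LambdaplusGC R n b -> disc_extension b h.
  move=> b; have [[_ [k bk]]|nb] := pselect (@LambdaplusGC R n b); first by exists k.
  by exists (fun=> 0).
have HC b : C b -> disc_extension b (H b) by move=> Cb; apply: HP; exact: CG.
have sgm b : C b -> eps (H b 0) ^+ 2 = 1.
  move=> Cb; have bE := HC b Cb; apply: eps_sqr.
    by apply: extension_sigma bE; case: (CG _ Cb).
  by case: bE => _ _ /(_ 0 (odisc_cdisc (odisc0 R)))[].
have aE : H a 0 = h 0 by exact: extension_unique (HC a Ca) ah (fun _ _ => erefl).
have one : H (fun=> 1%:M) 0 = 1%:M.
  apply: (@extension_unique _ _ _ (fun=> 1%:M) (HC _ C1) _ (fun _ _ => erefl)).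
  split => //; first exact: within_cst.
  by move=> l _; exact: SOC1.
rewrite -aE -[RHS](eps1 (cplx R) n) -one.
apply: (connected_locally_constant (f := fun b => eps (H b 0)) cC) => // {ah aE} b Cb.
have [d d0 dP] := eps_continuous_at (H b 0).
apply/nbhs_loopsP; exists (tocplx (d / 4)); first by rewrite ltcR_tocplx divr_gt0.
move=> b' bb' Cb'.
have : `|eps (H b 0) - eps (H b' 0)| < 1.
  apply: dP => i j; apply: le_lt_trans (_ : _ <= tocplx (d / 4 + d / 4)) _.
    apply: (extension_close (HC _ Cb) (HC _ Cb')); first by rewrite divr_ge0// ltW.
    by move=> l lc i' j'; apply/ltW/bb'.
  by rewrite ltcR_tocplx; lra.
have := sgm _ Cb; have := sgm _ Cb'.
have two : (`|1 + 1 : cplx R| < 1) = false.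
  apply/negbTE; rewrite -real_leNgt ?normr_real ?real1//.
  by rewrite ger0_norm ?addr_ge0// -{1}[1]addr0 lerD2l.
move=> /eqP; rewrite sqrf_eq1 => /orP[] /eqP -> /eqP; rewrite sqrf_eq1 => /orP[] /eqP -> //.
  by rewrite -opprD normrN two.
by rewrite opprK two.
Qed.

End EvaluationAtZero.

(** * Connectedness of complements of discrete sets *)
Section PlaneConnectedness.
Variable R : realType.
Local Notation C := (cplx R).
Implicit Types (z w p q : C) (A D S U : set C).

(** The homotopy joins every point of D to the same point. *)
Lemma contractible_connected D : contractible_set R D -> connected D.
Proof.
move=> [z0 [H [Dz0 Hc HD H0 H1]]].
have t0I : (0 : R) \in `[0, 1] by rewrite in_itv /= lexx ler01.
have t1I : (1 : R) \in `[0, 1] by rewrite in_itv /= lexx ler01.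
have -> : D = \bigcup_(z in D) ((H^~ z) @` `[0, 1]).
  apply/seteqP; split => [z Dz|_ [z Dz [t tI <-]]]; last exact: HD.
  by exists z => //; exists 0 => //; exact: H0.
apply: bigcup_connected.
  by exists z0 => z Dz; exists 1 => //; exact: H1.
move=> z Dz; apply: connected_continuous_connected; first exact: segment_connected.
have pc : {within `[0, 1], continuous (fun t : R => (t, z))}.
  apply: continuous_subspaceT => t.
  exact: (cvg_pair (@cvg_id _ (nbhs t)) (cvg_cst z)).
exact: (within_comp pc Hc (fun t tI => conj tI Dz)).
Qed.

Lemma star_connected A p : A p ->
  (forall q (t : R), A q -> 0 <= t <= 1 -> A (p + tocplx t * (q - p))) -> connected A.
Proof.
move=> Ap Ast.
have -> : A = \bigcup_(q in A) ((fun t : R => p + tocplx t * (q - p)) @` `[0, 1]).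
  apply/seteqP; split => [q Aq|_ [q Aq [t /= tI <-]]]; last first.
    by apply: Ast => //; rewrite in_itv in tI.
  exists q => //; exists 1; first by rewrite /= in_itv /= lexx ler01.
  by rewrite (_ : tocplx 1 = 1)// mul1r addrC subrK.
apply: bigcup_connected.
  exists p => q Aq; exists 0; first by rewrite /= in_itv /= lexx ler01.
  by rewrite (_ : tocplx 0 = 0)// mul0r addr0.
move=> q Aq; apply: connected_continuous_connected; first exact: segment_connected.
apply: continuous_subspaceT => t; apply: cvgD; first exact: cvg_cst.
by apply: cvgM; [exact: tocplx_continuous|exact: cvg_cst].
Qed.

Lemma locally_constant_connected (T : topologicalType) (A : set T) :
  (forall f : T -> bool, (forall x, A x -> \forall y \near x, A y -> f y = f x) ->
    forall x y, A x -> A y -> f x = f y) -> connected A.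
Proof.
move=> H B [x Bx] [C oC BC] [D cD BD].
have Ax : A x by move: Bx; rewrite BC => -[].
have lc y : A y -> \forall y' \near y, A y' -> `[< B y' >] = `[< B y >].
  move=> Ay; have [By|nBy] := pselect (B y).
    have Cy : C y by move: By; rewrite BC => -[].
    have : nbhs y C by exact: open_nbhs_nbhs.
    apply: filterS => y' Cy' Ay'; rewrite (asboolT By); apply/asboolP.
    by rewrite BC.
  have nDy : (~` D) y by move=> Dy; apply: nBy; rewrite BD.
  have : nbhs y (~` D) by apply: open_nbhs_nbhs; split => //; exact: closed_openC.
  apply: filterS => y' nDy' Ay'; rewrite (asboolF nBy); apply/asboolF.
  by rewrite BD => -[].
apply/seteqP; split => [y|y Ay]; first by rewrite BC => -[].
by have := H _ lc x y Ax Ay; rewrite (asboolT Bx) => /esym /asboolP.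
Qed.

(** An open square: it is convex, and without its centre it is covered by four
convex pieces. *)
Definition box z (d : R) : set C :=
  [set w | `|recplx w - recplx z| < d /\ `|imcplx w - imcplx z| < d].

Lemma nbhs_box z A : nbhs z A <-> exists2 d, 0 < d & box z d `<=` A.
Proof.
split=> [/nbhs_cplxP[d d0 dA]|[d d0 dA]].
  by exists d => // w [? ?]; exact: dA.
by apply/nbhs_cplxP; exists d => // w ? ?; exact: dA.
Qed.

Lemma box_ex z A : nbhs z A -> exists2 d, 0 < d & box z d `<=` A.
Proof. by move=> /nbhs_box. Qed.

Lemma box_near z d w : box z d w -> nbhs w (box z d).
Proof.
move=> [h1 h2]; apply/nbhs_cplxP.
exists (Num.min (d - `|recplx w - recplx z|) (d - `|imcplx w - imcplx z|)).
  by rewrite lt_min !subr_gt0 h1.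
move=> w'; rewrite !lt_min => /andP[a1 _] /andP[_ a2]; split.
  have -> : recplx w' - recplx z = (recplx w' - recplx w) + (recplx w - recplx z) by ring.
  by apply: le_lt_trans (ler_normD _ _) _; lra.
have -> : imcplx w' - imcplx z = (imcplx w' - imcplx w) + (imcplx w - imcplx z) by ring.
by apply: le_lt_trans (ler_normD _ _) _; lra.
Qed.

Lemma convex_gt0 (a b t : R) : 0 < a -> 0 < b -> 0 <= t <= 1 -> 0 < (1 - t) * a + t * b.
Proof.
move=> a0 b0 /andP[t0 t1]; have [->|t1'] := eqVneq t 1.
  by rewrite subrr mul0r add0r mul1r.
rewrite ltr_pwDl ?mulr_ge0// ?ltW// mulr_gt0// subr_gt0 lt_neqAle t1'//.
Qed.

Lemma convex_box z d w w' (t : R) : box z d w -> box z d w' -> 0 <= t <= 1 ->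
  box z d (w + tocplx t * (w' - w)).
Proof.
move=> [+ +] [+ +] tI; rewrite /box /= !recimE !ltr_norml.
move=> /andP[a1 a2] /andP[b1 b2] /andP[c1 c2] /andP[d1 d2].
have key (x y u : R) : - d < x - u -> x - u < d -> - d < y - u -> y - u < d ->
    - d < x + t * (y - x) - u /\ x + t * (y - x) - u < d.
  move=> h1 h2 h3 h4.
  have : 0 < (1 - t) * (d - (x - u)) + t * (d - (y - u)) by apply: convex_gt0; rewrite ?subr_gt0.
  have : 0 < (1 - t) * (x - u - - d) + t * (y - u - - d) by apply: convex_gt0; rewrite ?subr_gt0.
  lra.
have [k1 k2] := key _ _ _ a1 a2 c1 c2; have [k3 k4] := key _ _ _ b1 b2 d1 d2.
by rewrite !mul0r !subr0 !addr0 k1 k2 k3 k4.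
Qed.

(** The four open half squares to the right, above, to the left and below the centre
cover the punctured square, and consecutive ones meet in quarter squares. *)
Lemma punctured_box_connected z d : 0 < d -> connected (box z d `\` [set z]).
Proof.
move=> d0.
pose H (s : bool) (f : C -> R) : set C :=
  box z d `&` [set w | 0 < (-1) ^+ s * (f w - f z)].
have cH s f c : (forall w w' (t : R), f (w + tocplx t * (w' - w)) = f w + t * (f w' - f w)) ->
    H s f c -> connected (H s f).
  move=> fl Hc; apply: (@star_connected _ c) => // q t [Bq fq] tI; split.
    exact: convex_box Hc.1 Bq tI.
  move: Hc => [_ fc]; rewrite /= fl; have := convex_gt0 fc fq tI.
  by congr (0 < _); ring.
have rel w w' (t : R) : recplx (w + tocplx t * (w' - w)) = recplx w + t * (recplx w' - recplx w).
  by rewrite !recimE; ring.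
have iml w w' (t : R) : imcplx (w + tocplx t * (w' - w)) = imcplx w + t * (imcplx w' - imcplx w).
  by rewrite !recimE; ring.
pose c (s s' : bool) : C := z + mkcplx ((-1) ^+ s * (d / 2)) ((-1) ^+ s' * (d / 2)).
have cRe s s' : H s (@recplx R) (c s s').
  rewrite /H /c; split; [split|]; rewrite /= !recimE; case: s; case: s'; rewrite ?expr1 ?expr0;
    rewrite ?ltr_norml; try (apply/andP; split); lra.
have cIm s s' : H s' (@imcplx R) (c s s').
  rewrite /H /c; split; [split|]; rewrite /= !recimE; case: s; case: s'; rewrite ?expr1 ?expr0;
    rewrite ?ltr_norml; try (apply/andP; split); lra.
have -> : box z d `\` [set z] = (H false (@recplx R) `|` H false (@imcplx R)) `|`
   (H true (@recplx R) `|` H true (@imcplx R)).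
  apply/seteqP; split => [w [Bw wz]|w].
    have [h|h|hr] := ltgtP (recplx w) (recplx z).
    - by right; left; split => //=; rewrite expr1 mulN1r opprB subr_gt0.
    - by left; left; split => //=; rewrite expr0 mul1r subr_gt0.
    have [h|h|hi] := ltgtP (imcplx w) (imcplx z).
    - by right; right; split => //=; rewrite expr1 mulN1r opprB subr_gt0.
    - by left; right; split => //=; rewrite expr0 mul1r subr_gt0.
    by exfalso; apply: wz; exact: cplx_eq.
  have nz s (f : C -> R) : H s f w -> (box z d `\` [set z]) w.
    by move=> [Bw fw]; split => // wz; move: fw; rewrite wz /= subrr mulr0 ltxx.
  by move=> [[/nz|/nz]|[/nz|/nz]].
have cU s s' : connected (H s (@recplx R) `|` H s' (@imcplx R)).
  apply: connectedU; first by exists (c s s'); split; [exact: cRe|exact: cIm].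
    exact: cH (cRe s s').
  exact: cH (cIm s s').
apply: connectedU; [|exact: cU|exact: cU].
by exists (c false true); split; [left; exact: cRe|right; exact: cIm].
Qed.

Lemma dnbhs_boxP z A : (\forall w \near z, w <> z -> A w) <->
  exists2 d, 0 < d & box z d `\` [set z] `<=` A.
Proof.
split=> [/nbhs_box[d d0 dA]|[d d0 dA]].
  by exists d => // w [Bw wz]; exact: dA.
by apply/nbhs_box; exists d => // w Bw wz; exact: dA.
Qed.

(** Stated with points of D only, since S may accumulate at the boundary of D. *)
Definition no_limit_point D S := forall z, D z -> ~ limit_point S z.

Lemma no_limit_near D S z : no_limit_point D S -> D z ->
  \forall w \near z, w <> z -> ~ S w.
Proof.
move=> nl Dz; have := nl z Dz; rewrite /limit_point /= => /existsNP[U /not_implyP[zU]].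
move=> nU; apply: filterS zU => w Uw wz Sw; apply: nU; exists w; split => //.
exact/eqP.
Qed.

Lemma no_limit_open D S : open D -> no_limit_point D S -> open (D `\` S).
Proof.
move=> oD nl; rewrite openE => z [Dz nSz].
have h1 : nbhs z D by exact: open_nbhs_nbhs.
have h2 := no_limit_near nl Dz.
apply: filterS (filterI h1 h2) => w [Dw h]; split => //.
by have [->|] := pselect (w = z).
Qed.

Lemma punctured_ne z d : 0 < d -> (box z d `\` [set z]) (z + tocplx (d / 2)).
Proof.
move=> d0; split.
  split; rewrite !recimE ?addr0 ?subrr ?normr0//.
  by rewrite addrAC subrr add0r ger0_norm; lra.
move=> /= /(congr1 (@recplx R)); rewrite !recimE => h; lra.
Qed.

Lemma no_limit_dense D S z A : open D -> no_limit_point D S -> D z -> nbhs z A ->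
  exists2 w, A w & (D `\` S) w.
Proof.
move=> oD nl Dz zA; have zD : nbhs z D by exact: open_nbhs_nbhs.
have [d d0 dP] := box_ex (filterI (filterI zA zD) (no_limit_near nl Dz)).
have [Bw wz] := punctured_ne z d0.
have [[Aw Dw] nS] := dP _ Bw.
by exists (z + tocplx (d / 2)) => //; split => //; apply: nS.
Qed.

(** A locally constant function on the complement is constant on small punctured
squares, so it extends to a locally constant function on the connected set D. *)
Theorem connected_minus_discrete D S : open D -> connected D -> no_limit_point D S ->
  connected (D `\` S).
Proof.
move=> oD cD nl; apply: locally_constant_connected => f flc.
have pun z : D z -> exists b, \forall w \near z, w <> z -> f w = b.
  move=> Dz; have zD : nbhs z D by exact: open_nbhs_nbhs.
  have [d d0 dP] := box_ex (filterI zD (no_limit_near nl Dz)).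
  exists (f (z + tocplx (d / 2))); apply/dnbhs_boxP; exists d => // w Bw.
  have sub : box z d `\` [set z] `<=` D `\` S.
    by move=> w' [Bw' w'z]; have [Dw' nSw'] := dP _ Bw'; split => //; exact: nSw'.
  apply: (connected_locally_constant (f := f) (@punctured_box_connected z d d0)) => //.
    move=> x Bx; have := flc x (sub x Bx); apply: filterS => y h By; exact/h/sub.
  exact: punctured_ne.
have /choice[g gP] : forall z, exists b, D z -> \forall w \near z, w <> z -> f w = b.
  move=> z; have [/pun[b bP]|nD] := pselect (D z); first by exists b.
  by exists true.
have glc z : D z -> \forall w \near z, D w -> g w = g z.
  move=> Dz; have /dnbhs_boxP[d d0 dP] := gP z Dz.
  apply/nbhs_box; exists d => // w Bw Dw.
  have [->//|wz] := pselect (w = z).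
  have wpun : \forall w' \near w, w' <> z.
    have oz : open (~` [set z]) by apply: closed_openC; apply: accessible_closed_set1; apply: hausdorff_accessible; exact: norm_hausdorff.
    by apply: (open_nbhs_nbhs (conj oz _)).
  have [e e0 eP] := box_ex (filterI (filterI (gP w Dw) (box_near Bw)) wpun).
  have [Bw' w'w] := punctured_ne w e0.
  have [[h1 h2] h3] := eP _ Bw'.
  by rewrite -(h1 w'w) dP.
have gf z : (D `\` S) z -> f z = g z.
  move=> zDS; have [Dz _] := zDS.
  have oDS := no_limit_open oD nl.
  have [e e0 eP] := box_ex (filterI (filterI (gP z Dz) (flc z zDS)) (open_nbhs_nbhs (conj oDS zDS))).
  have [Bw' w'w] := punctured_ne z e0.
  have [[h1 h2] h3] := eP _ Bw'.
  by rewrite -(h1 w'w) (h2 h3).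
move=> x y hx hy; rewrite !gf//.
by apply: (connected_locally_constant (f := g) cD) => //; [case: hx|case: hy].
Qed.

End PlaneConnectedness.

(** * Partial derivatives along lines in the plane *)
Section RealDirections.
Variable R : realType.
Local Notation C := (cplx R).
Implicit Types (z w v : C) (D U : set C).

Lemma mvt_between (f df : R -> R) x x' :
  (forall s, `|s - x| <= `|x' - x| -> is_derive (s : R) (1 : R) f (df s)) ->
  exists2 s, `|s - x| <= `|x' - x| & f x' - f x = df s * (x' - x).
Proof.
move=> fd.
have cont s : `|s - x| <= `|x' - x| -> {for s, continuous f}.
  by move=> /fd[fs _]; apply/differentiable_continuous/derivable1_diffP.
have [xx'|x'x] := leP x x'.
  have bnd s : s \in `[x, x'] -> `|s - x| <= `|x' - x|.
    rewrite in_itv /= => /andP[h1 h2]; rewrite !ger0_norm ?subr_ge0//; lra.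
  have fd' s : s \in `]x, x'[ -> is_derive (s : R) (1 : R) f (df s).
    by move=> /subset_itv_oo_cc sI; apply: fd; exact: bnd.
  have fc : {within `[x, x'], continuous f}.
    by apply: continuous_in_subspaceT => s; rewrite inE => /bnd; exact: cont.
  have [s sI E] := MVT_segment xx' fd' fc.
  by exists s => //; exact: bnd.
have bnd s : s \in `[x', x] -> `|s - x| <= `|x' - x|.
  rewrite in_itv /= => /andP[h1 h2]; rewrite !ler0_norm ?subr_le0//; lra.
have fd' s : s \in `]x', x[ -> is_derive (s : R) (1 : R) f (df s).
  by move=> /subset_itv_oo_cc sI; apply: fd; exact: bnd.
have fc : {within `[x', x], continuous f}.
  by apply: continuous_in_subspaceT => s; rewrite inE => /bnd; exact: cont.
have [s sI E] := MVT_segment (ltW x'x) fd' fc.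
exists s; first exact: bnd.
by rewrite -[LHS]opprB E -mulrN opprB.
Qed.

(** Moving the base point along the line turns a derivative at 0 into a derivative
at t. *)
Lemma line_derive (V : normedModType R) (F : C -> V) z v (t : R) d :
  is_derive (0 : R) (1 : R) (fun s : R => F (z + tocplx t * v + tocplx s * v)) d ->
  is_derive (t : R) (1 : R) (fun s : R => F (z + tocplx s * v)) d.
Proof.
move=> /is_deriveP H; apply/is_deriveP.
have -> // : (fun h : R => h^-1 *: (F (z + tocplx (h *: (1 : R) + t) * v) - F (z + tocplx t * v))) =
  (fun h : R => h^-1 *: (F (z + tocplx t * v + tocplx (h *: (1 : R) + 0) * v) -
     F (z + tocplx t * v + tocplx 0 * v))).
apply/funext => h; rewrite rmorph0 mul0r !addr0; congr (_ *: (F _ - _)).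
by rewrite rmorphD mulrDl addrA addrAC.
Qed.

Lemma horizontal_derive (phi : C -> R) (d : C -> R) (y s : R) :
  is_derive (0 : R) (1 : R) (fun t : R => phi (mkcplx s y + tocplx t * 1)) (d (mkcplx s y)) ->
  is_derive (s : R) (1 : R) (fun s => phi (mkcplx s y)) (d (mkcplx s y)).
Proof.
have E t : mkcplx t y = mkcplx 0 y + tocplx t * 1 by apply: cplx_eq; rewrite !recimE; ring.
rewrite E => H; have := @line_derive R^o phi (mkcplx 0 y) 1 s _ H.
by under [X in _ -> is_derive _ _ X _]eq_fun do rewrite E.
Qed.

Lemma vertical_derive (phi : C -> R) (d : C -> R) (x s : R) :
  is_derive (0 : R) (1 : R) (fun t : R => phi (mkcplx x s + tocplx t * 'i)) (d (mkcplx x s)) ->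
  is_derive (s : R) (1 : R) (fun s => phi (mkcplx x s)) (d (mkcplx x s)).
Proof.
have E t : mkcplx x t = mkcplx x 0 + tocplx t * 'i by apply: cplx_eq; rewrite !recimE; ring.
rewrite E => H; have := @line_derive R^o phi (mkcplx x 0) 'i s _ H.
by under [X in _ -> is_derive _ _ X _]eq_fun do rewrite E.
Qed.

Definition has_partials U (phi d1 d2 : C -> R) := forall z, U z ->
  is_derive (0 : R) (1 : R) (fun t : R => phi (z + tocplx t * 1)) (d1 z) /\
  is_derive (0 : R) (1 : R) (fun t : R => phi (z + tocplx t * 'i)) (d2 z).

(** The mean value theorem along a vertical and then a horizontal segment. *)
Lemma box_increment U phi d1 d2 z (d : R) w : has_partials U phi d1 d2 ->
  box z d `<=` U -> box z d w ->
  exists p q, [/\ box z d p, box z d q &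
    phi w - phi z = d1 p * (recplx w - recplx z) + d2 q * (imcplx w - imcplx z)].
Proof.
move=> pd sub [w1 w2].
have [s s1 E1] := @mvt_between (fun s => phi (mkcplx s (imcplx w)))
   (fun s => d1 (mkcplx s (imcplx w))) (recplx z) (recplx w) (fun s sI =>
     horizontal_derive (pd _ (sub (mkcplx s (imcplx w)) (conj (le_lt_trans sI w1) w2))).1).
have d0 : 0 < d by exact: le_lt_trans w1.
have z1 : `|recplx z - recplx z| < d by rewrite subrr normr0.
have [r r1 E2] := @mvt_between (fun s => phi (mkcplx (recplx z) s))
   (fun s => d2 (mkcplx (recplx z) s)) (imcplx z) (imcplx w) (fun s sI =>
     vertical_derive (pd _ (sub (mkcplx (recplx z) s) (conj z1 (le_lt_trans sI w2)))).2).
exists (mkcplx s (imcplx w)), (mkcplx (recplx z) r); split.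
- by split => //; exact: le_lt_trans w1.
- by split => //; exact: le_lt_trans w2.
by rewrite -E1 -E2 !mkcplx_id addrA subrK.
Qed.

Lemma zero_partials_constant U phi : open U -> connected U ->
  has_partials U phi (fun=> 0) (fun=> 0) -> forall z w, U z -> U w -> phi z = phi w.
Proof.
move=> oU cU pd; apply: (connected_locally_constant cU) => z Uz.
have [d d0 dU] := box_ex (open_nbhs_nbhs (conj oU Uz)).
apply/nbhs_box; exists d => // w Bw _.
have [p [q [_ _]]] := box_increment pd dU Bw.
by rewrite !mul0r addr0 => /eqP; rewrite subr_eq0 => /eqP.
Qed.

(** Continuous partial derivatives give differentiability. *)
Lemma C1_diff_at U phi d1 d2 : open U -> has_partials U phi d1 d2 ->
  {within U, continuous d1} -> {within U, continuous d2} -> forall z, U z ->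
  diff_at (fun x y => phi (mkcplx x y)) (recplx z) (imcplx z) (d1 z) (d2 z).
Proof.
move=> oU pd c1 c2 z Uz e e0.
have zU := open_nbhs_nbhs (conj oU Uz).
have near (d' : C -> R) : {within U, continuous d'} -> \forall w \near z, `|d' z - d' w| <= e.
  move=> c; have := (subspace_continuousP _ _).1 c z Uz.
  move=> /cvgrPdist_le /(_ e e0) h0.
  have h : nbhs z [set w | U w -> `|d' z - d' w| <= e] by exact: h0.
  have [r r0 rP] := box_ex (filterI h zU).
  by apply/nbhs_box; exists r => // w /rP[h1 /h1].
have [d d0 dP] := box_ex (filterI (filterI zU (near _ c1)) (near _ c2)).
exists d => // x y xd yd; have Bw : box z d (mkcplx x y) by [].
have sub : box z d `<=` U by move=> w /dP[[]].
have [p [q [Bp Bq E]]] := box_increment pd sub Bw.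
rewrite mkcplx_id E.
have [[_ p1] _] := dP _ Bp; have [_ q2] := dP _ Bq.
have -> : d1 p * (recplx (mkcplx x y) - recplx z) + d2 q * (imcplx (mkcplx x y) - imcplx z)
  - (d1 z * (x - recplx z) + d2 z * (y - imcplx z)) =
  (d1 p - d1 z) * (x - recplx z) + (d2 q - d2 z) * (y - imcplx z).
  by rewrite !recimE; ring.
apply: le_trans (ler_normD _ _) _; rewrite !normrM mulrDr.
by apply: lerD; rewrite ler_wpM2r// distrC.
Qed.

(** The real derivative of phi o g in the direction v, for g holomorphic: the
direction is turned by the complex derivative c of g. *)
Lemma curve_chain phi (g : C -> C) z v c a b : is_derive z 1 g c ->
  diff_at (fun x y => phi (mkcplx x y)) (recplx (g z)) (imcplx (g z)) a b ->
  is_derive (0 : R) (1 : R) (fun t : R => phi (g (z + tocplx t * v)))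
    (a * recplx (c * v) + b * imcplx (c * v)).
Proof.
move=> gd pd.
have lin (s r : R) : is_derive (0 : R) (1 : R) (fun t : R => s + t * r : R) r.
  have h := is_deriveD (is_derive_cst (s : R) (0 : R) (1 : R))
    (is_deriveZ r (is_derive_id (0 : R) (1 : R))).
  have -> : (fun t : R => s + t * r : R) = cst s + r \*: id.
    by apply/funext => t; rewrite mulrC.
  by apply: is_derive_eq h _; rewrite add0r [_ *: _]mulr1.
pose x (t : R) := recplx (g (mkcplx (recplx z + t * recplx v) (imcplx z + t * imcplx v))).
pose y (t : R) := imcplx (g (mkcplx (recplx z + t * recplx v) (imcplx z + t * imcplx v))).
have zE : mkcplx (recplx z + 0 * recplx v) (imcplx z + 0 * imcplx v) = z.
  by rewrite !mul0r !addr0 mkcplx_id.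
have dx : is_derive (0 : R) (1 : R) x (recplx c * recplx v + - imcplx c * imcplx v).
  apply: (@diff_at_curve R (fun x y => recplx (g (mkcplx x y)))
    (fun t => recplx z + t * recplx v) (fun t => imcplx z + t * imcplx v)) => //.
  by rewrite !mul0r !addr0; exact: cauchy_riemann_re.
have dy : is_derive (0 : R) (1 : R) y (imcplx c * recplx v + recplx c * imcplx v).
  apply: (@diff_at_curve R (fun x y => imcplx (g (mkcplx x y)))
    (fun t => recplx z + t * recplx v) (fun t => imcplx z + t * imcplx v)) => //.
  by rewrite !mul0r !addr0; exact: cauchy_riemann_im.
have pd' : diff_at (fun x y => phi (mkcplx x y)) (x 0) (y 0) a b.
  by rewrite /x /y zE.
have := diff_at_curve pd' dx dy.
have -> : (fun r => phi (mkcplx (x r) (y r))) = (fun t : R => phi (g (z + tocplx t * v))).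
  apply/funext => t; rewrite /x /y mkcplx_id; congr (phi (g _)).
  by apply: cplx_eq; rewrite !recimE; ring.
move=> h; apply: is_derive_eq h _; rewrite !recimE; ring.
Qed.

Lemma zero_derivative_constant U (X : C -> C) : open U -> connected U ->
  (forall z, U z -> is_derive z 1 X 0) -> forall z w, U z -> U w -> X z = X w.
Proof.
move=> oU cU X0 z w Uz Uw.
have lin1 (x y : R) : diff_at (fun s r => recplx (mkcplx s r)) x y 1 0.
  exact: (@diff_at_fst R id x y 1).
have lin2 (x y : R) : diff_at (fun s r => imcplx (mkcplx s r)) x y 0 1.
  exact: (@diff_at_snd R id x y 1).
have key (phi : C -> R) a b : (forall x y : R, diff_at (fun s r => phi (mkcplx s r)) x y a b) ->
    phi (X z) = phi (X w).
  move=> pd; apply: (@zero_partials_constant U (fun z => phi (X z))) => // p Up.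
  split.
    have := curve_chain 1 (X0 p Up) (pd (recplx (X p)) (imcplx (X p))).
    by rewrite mul0r !recimE !mulr0 addr0.
  have := curve_chain 'i (X0 p Up) (pd (recplx (X p)) (imcplx (X p))).
  by rewrite mul0r !recimE !mulr0 addr0.
by apply: cplx_eq; apply: key.
Qed.

End RealDirections.

(** * The group K and uniqueness of solutions of gauge equations *)
Section AlgebraK.
Variables (R : realType) (n : nat).
Implicit Types (A g h k : 'M[R]_n.+4).

(** A matrix fixed by sigma is block diagonal; given that it lies in SO^+(1,n+3),
its first block has a positive first entry and its second block is orthogonal, so
that only the sign of the determinants remains. *)
Lemma KgrpP k : @Kgrp R n k <-> [/\ @SOplus R n.+3 k, sigma k = k & eps k = 1].
Proof.
split=> [[a /SOplusP[ha a00 da] [b [hb db] <-]]|[/SOplusP[hk k00 dk] sk ek]].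
  split; [|exact: block_sigma|by rewrite /eps /ulblock block_mxKul].
  apply/SOplusP; split; first exact/block_iso.
    have -> : (ord0 : 'I_n.+4) = @lshift 4 n ord0 by apply: val_inj.
    by rewrite (@block_mxEul R 4 n 4 n).
  by rewrite (@det_ublock R 4 n) da db mulr1.
have E := sigma_block sk.
move: hk; rewrite E => /block_iso[ha hb].
exists (ulblock k).
  apply/SOplusP; split => //; rewrite /ulblock !mxE.
  by rewrite (_ : lshift n ord0 = ord0)//; apply: val_inj.
exists (drblock k); last by rewrite -E.
split => //; move: dk; rewrite {1}E (@det_ublock R 4 n) -/(eps k) ek mul1r.
by [].
Qed.

Lemma Kgrp1 : @Kgrp R n 1%:M.
Proof. by apply/KgrpP; split; [exact: SOplus1|exact: sigma1|exact: eps1]. Qed.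

Lemma KgrpM g h : @Kgrp R n g -> @Kgrp R n h -> @Kgrp R n (g *m h).
Proof.
move=> /KgrpP[g1 g2 g3] /KgrpP[h1 h2 h3]; apply/KgrpP; split.
- exact: SOplusM.
- by rewrite sigmaM g2 h2.
- by rewrite eps_mul// g3 h3 mulr1.
Qed.

Lemma KgrpV g : @Kgrp R n g -> @Kgrp R n (lorentz_adj g).
Proof.
move=> /KgrpP[g1 g2 g3]; apply/KgrpP; split.
- exact: SOplusV.
- by rewrite sigma_adj g2.
- by rewrite eps_adj//; case/SOplusP : g1.
Qed.

Lemma KgrpJ b g : @Kgrp R n g -> @Kgrp R n (Pt R n b *m g *m Pt R n b).
Proof.
move=> /KgrpP[g1 g2 g3]; apply/KgrpP; split.
- exact: SOplusJ.
- by rewrite sigma_PtJ g2.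
- by rewrite eps_PtJ.
Qed.

Lemma cosetK_self g : cosetK g g.
Proof. by exists 1%:M; [exact: Kgrp1|rewrite mulmx1]. Qed.

Lemma cosetK_eqP g h : cosetK g = cosetK h <-> exists2 k, @Kgrp R n k & g = h *m k.
Proof.
split=> [gh|[k Kk ->]].
  by have [k Kk <-] : cosetK h g; [rewrite -gh; exact: cosetK_self|exists k].
apply/seteqP; split => [_ [k' Kk' <-]|_ [k' Kk' <-]].
  by exists (k *m k'); [exact: KgrpM|rewrite mulmxA].
exists (lorentz_adj k *m k'); first by apply: KgrpM => //; exact: KgrpV.
have /KgrpP[/SOplusP[hk _ _] _ _] := Kk.
by rewrite mulmxA -(mulmxA h) lorentz_adjV// mulmx1.
Qed.

(** Both cases of the action in one formula; the second one uses that Ptilde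
normalises K. *)
Lemma act_cosetK A g (b : bool) : \det A = (-1) ^+ b -> act A (cosetK g) = cosetK (A *m g *m Pt R n b).
Proof.
case: b => dA; rewrite /act dA.
  have -> : ((-1) ^+ true == 1 :> R) = false.
    by rewrite expr1; apply/negbTE/eqP => h; have : (-1 : R) < 1 by []; rewrite h ltxx.
  have PE : Ptilde R n = Pt R n true by rewrite /Pt expr1.
  rewrite PE; apply/seteqP; split => [_ [_ [k Kk <-] <-]|_ [k Kk <-]].
    exists (Pt R n true *m k *m Pt R n true); first exact: KgrpJ.
    by rewrite !mulmxA -(mulmxA (A *m g) (Pt R n true)) Pt_sqr mulmx1.
  exists (g *m (Pt R n true *m k *m Pt R n true)); first by exists (Pt R n true *m k *m Pt R n true) => //; exact: KgrpJ.
  by rewrite !mulmxA mulPtK.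
rewrite expr0 eqxx /Pt expr0 mulmx1; apply/seteqP; split => [_ [_ [k Kk <-] <-]|_ [k Kk <-]].
  by exists k => //; rewrite mulmxA.
by exists (g *m k); [exists k|rewrite mulmxA].
Qed.

End AlgebraK.

Section GaugeUniqueness.

(** Differentiating the relation adj(Y) Y = 1. *)
Lemma adj_derivative (K : numFieldType) n (V : normedModType K) (Y : V -> 'M[K]_n.+4) x v D :
  is_derive x v Y D -> (\forall t \near x, lorentz_isometry (Y t)) ->
  lorentz_adj D = - (lorentz_adj (Y x) *m D *m lorentz_adj (Y x)).
Proof.
move=> hY nY; have isoY := nbhs_singleton nY.
have h1 := is_derive_mulmx (is_derive_cst (lorentz_form K n.+3) x v) (is_derive_trmx hY).
have h2 := is_derive_mulmx h1 (is_derive_cst (lorentz_form K n.+3) x v).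
have h3 := is_derive_mulmx h2 hY.
have near1 : \forall t \near x, (lorentz_form K n.+3 *m (Y t)^T *m lorentz_form K n.+3 *m Y t) =
   cst (1%:M : 'M[K]_n.+4) t.
  by apply: filterS nY => t /lorentz_isoP.
have h4 := near_eq_is_derive near1 h3.
have := derive_val; move=> /(_ _ _ _ _ _ _ _ h4); rewrite derive_cst.
rewrite mul0mx add0r mulmx0 addr0 -!/(lorentz_adj _) => /esym /eqP.
rewrite addr_eq0 => /eqP /(congr1 (fun M => M *m lorentz_adj (Y x))).
by rewrite mulNmx => <-; rewrite -mulmxA lorentz_adjV// mulmx1.
Qed.

Lemma sigma_derivative (K : numFieldType) n (V : normedModType K) (T : V -> 'M[K]_n.+4) x v D :
  is_derive x v T D -> (\forall t \near x, sigma (T t) = T t) -> sigma D = D.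
Proof.
move=> hT nT; pose Q := signmx K n.+4 (fun i => i < 4)%N.
have h1 := is_derive_mulmx (is_derive_cst Q x v) hT.
have h2 := is_derive_mulmx h1 (is_derive_cst Q x v).
have near1 : \forall t \near x, Q *m T t *m Q = T t.
  by apply: filterS nT => t; rewrite sigmaE.
have [_ h4] := near_eq_is_derive near1 h2; have [_ h5] := hT.
by rewrite sigmaE -[RHS]h5 h4 mul0mx add0r mulmx0 addr0.
Qed.

Variables (R : realType) (n : nat).
Local Notation C := (cplx R).
Implicit Types (z w v : C) (U : set C).

Definition is_rder v (F : C -> 'M[R]_n.+4) z (dF : 'M[R]_n.+4) :=
  is_derive (0 : R) (1 : R) (fun t : R => F (z + tocplx t * v)) dF.

Lemma line_near U z v : open U -> U z -> \forall t \near (0 : R), U (z + tocplx t * v).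
Proof.
move=> oU Uz; have c : z + tocplx t * v @[t --> (0 : R)] --> z.
  have -> : nbhs z = nbhs (z + tocplx 0 * v) by rewrite rmorph0 mul0r addr0.
  apply: cvgD; first exact: cvg_cst.
  by apply: cvgM; [exact: tocplx_continuous|exact: cvg_cst].
exact: (c _ (open_nbhs_nbhs (conj oU Uz))).
Qed.

Lemma rder_val v F z dF : is_rder v F z dF -> F (z + tocplx 0 * v) = F z.
Proof. by rewrite rmorph0 mul0r addr0. Qed.

(** The derivative of X adj(Y) vanishes in both directions, since adj(Y) is the
inverse of Y. *)
Lemma gauge_unique U (X Y : C -> 'M[R]_n.+4) (Om : C -> C -> 'M[C]_n.+4) :
  open U -> connected U -> (forall z, U z -> lorentz_isometry (Y z)) ->
  (forall z v, U z -> v = 1 \/ v = 'i -> exists Xv Yv,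
    [/\ is_rder v X z Xv, is_rder v Y z Yv,
        cmx Xv = cmx (X z) *m Om v z & cmx Yv = cmx (Y z) *m Om v z]) ->
  forall z w, U z -> U w -> X z *m lorentz_adj (Y z) = X w *m lorentz_adj (Y w).
Proof.
move=> oU cU Yiso H z w Uz Uw; apply/matrixP => i j.
apply: (@zero_partials_constant R U (fun z => (X z *m lorentz_adj (Y z)) i j)) => // p Up.
have key v : v = 1 \/ v = 'i ->
    is_derive (0 : R) (1 : R) (fun t : R => (X (p + tocplx t * v) *m lorentz_adj (Y (p + tocplx t * v))) i j) 0.
  move=> hv; have [Xv [Yv [hX hY EX EY]]] := H p v Up hv.
  have nY : \forall t \near (0 : R), lorentz_isometry (Y (p + tocplx t * v)).
    by have := line_near v oU Up; apply: filterS => t; exact: Yiso.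
  have adjD := adj_derivative hY nY.
  have h1 := is_derive_mulmx (is_derive_cst (lorentz_form R n.+3) (0 : R) (1 : R)) (is_derive_trmx hY).
  have h2 := is_derive_mulmx h1 (is_derive_cst (lorentz_form R n.+3) (0 : R) (1 : R)).
  have h3 := is_derive_mulmx hX h2.
  have /is_derive_mxP/(_ i j) h4 := h3.
  apply: is_derive_eq h4 _.
  rewrite mul0mx add0r mulmx0 addr0 -!/(lorentz_adj _) adjD !(rder_val hX) !(rder_val hY).
  rewrite -[RHS](_ : (0 : 'M[R]_n.+4) i j = 0); last by rewrite mxE.
  congr (fun_of_matrix _ i j); apply: cmx_inj.
  rewrite cmx0 cmxD (cmxM Xv) (cmxM (X p)) cmxN (cmxM (_ *m Yv)) (cmxM _ Yv) EX EY !cmx_adj.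
  have Yc : lorentz_isometry (cmx (Y p)) by apply/cmx_iso; exact: Yiso.
  have -> : lorentz_adj (cmx (Y p)) *m (cmx (Y p) *m Om v p) = Om v p.
    by rewrite mulmxA (lorentz_isoP _).1// mul1mx.
  by rewrite mulmxN -mulmxA subrr.
by split; apply: key; [left|right].
Qed.

(** The holomorphic counterpart of gauge_unique. *)
Lemma gauge_unique_holo U (X Y : C -> 'M[C]_n.+4) (om : C -> 'M[C]_n.+4) :
  open U -> connected U -> (forall z, U z -> lorentz_isometry (Y z)) ->
  (forall z, U z -> is_derive z 1 X (X z *m om z)) ->
  (forall z, U z -> is_derive z 1 Y (Y z *m om z)) ->
  forall z w, U z -> U w -> X z *m lorentz_adj (Y z) = X w *m lorentz_adj (Y w).
Proof.
move=> oU cU Yiso HX HY z w Uz Uw; apply/matrixP => i j.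
apply: (@zero_derivative_constant R U (fun z => (X z *m lorentz_adj (Y z)) i j)) => // p Up.
have nY : \forall t \near p, lorentz_isometry (Y t).
  by apply: filterS (open_nbhs_nbhs (conj oU Up)) => t; exact: Yiso.
have adjD := adj_derivative (HY p Up) nY.
have h3 := is_derive_mulmx (HX p Up) (is_derive_adj (HY p Up)).
have /is_derive_mxP/(_ i j) h4 := h3.
apply: is_derive_eq h4 _.
rewrite adjD -[RHS](_ : (0 : 'M[C]_n.+4) i j = 0); last by rewrite mxE.
congr (fun_of_matrix _ i j).
have -> : lorentz_adj (Y p) *m (Y p *m om p) = om p.
  by rewrite mulmxA (lorentz_isoP _).1 ?mul1mx//; exact: Yiso.
by rewrite mulmxN -mulmxA subrr.
Qed.

Lemma smooth_partials U (F : C -> 'M[R]_n.+4) : smooth U F ->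
  [/\ {within U, continuous F},
      forall z v, U z -> v = 1 \/ v = 'i -> is_rder v F z (rder v F z),
      {within U, continuous (rder 1 F)} & {within U, continuous (rder 'i F)}].
Proof.
move=> /(_ 1%N)[F0 [F1 [F2 _] [F3 _]]]; split => // z v Uz hv.
have d : rderivable v F z by case: (F1 z Uz) hv => d1 d2 [->|->].
by apply: DeriveDef => //; rewrite /rder derive1E.
Qed.

Lemma smooth_chain U (F : C -> 'M[R]_n.+4) (g : C -> C) z v c : open U -> smooth U F ->
  U (g z) -> is_derive z 1 g c ->
  is_rder v (fun z => F (g z)) z
    (recplx (c * v) *: rder 1 F (g z) + imcplx (c * v) *: rder 'i F (g z)).
Proof.
move=> oU sF Ugz gd; have [F0 F1 F2 F3] := smooth_partials sF.
apply/is_derive_mxP => i j; rewrite !mxE ![recplx _ * _]mulrC ![imcplx _ * _]mulrC.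
apply: (@curve_chain R (fun z => F z i j) g z v c) => //.
have ec (k l : 'I_n.+4) : continuous (fun A : 'M[R]_n.+4 => A k l) := @entry_continuous R n.+4 n.+4 k l.
apply: (@C1_diff_at R U (fun z => F z i j) (fun z => rder 1 F z i j) (fun z => rder 'i F z i j)) => //.
- move=> p Up; split.
    by have /is_derive_mxP/(_ i j) := F1 p 1 Up (or_introl erefl).
  by have /is_derive_mxP/(_ i j) := F1 p 'i Up (or_intror erefl).
- exact: (within_post F2 (ec i j)).
- exact: (within_post F3 (ec i j)).
Qed.

End GaugeUniqueness.

(** * Extended frames and the transition between them *)
Section Splitting.
Variables (T : numFieldType) (n : nat).
Implicit Types X Y : 'M[T]_n.+4.

Lemma pk_split X : X = kpart X + ppart X.
Proof.
rewrite /kpart /ppart; move: (sigma X) => Y.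
by apply/matrixP => i j; rewrite !mxE; field.
Qed.

Lemma ppartD X Y : ppart (X + Y) = ppart X + ppart Y.
Proof. by rewrite /ppart -scalerDr sigmaD opprD addrACA. Qed.

Lemma ppartZ a X : ppart (a *: X) = a *: ppart X.
Proof. by rewrite /ppart sigmaZ -scalerBr !scalerA mulrC. Qed.

(** Multiplication by a matrix fixed by sigma respects the splitting into k- and
p-parts, and M X - Y M has no p-part. *)
Lemma ppart_intertwine M X Y : sigma M = M ->
  sigma (M *m X - Y *m M) = M *m X - Y *m M -> M *m ppart X = ppart Y *m M.
Proof.
move=> sM; rewrite sigmaD sigmaN !sigmaM sM => h.
rewrite /ppart -scalemxAr -scalemxAl; congr (_ *: _).
rewrite mulmxBr mulmxBl; move: h.
move: (M *m X) (M *m sigma X) (Y *m M) (sigma Y *m M) => a b c d /eqP.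
by rewrite subr_eq => /eqP ->; rewrite opprD opprB addrA [a + _]addrC subrK.
Qed.

End Splitting.

Section Frames.
Variables (R : realType) (n : nat).
Local Notation C := (cplx R).
Implicit Types (z w v u c l : C) (D : set C) (F : C -> C -> 'M[R]_n.+4).

Definition cconj u : C := mkcplx (recplx u) (- imcplx u).

Lemma half_cplx : (2^-1 : C) = tocplx 2^-1.
Proof. by rewrite fmorphV rmorph_nat. Qed.

Lemma cconjM u v : cconj (u * v) = cconj u * cconj v.
Proof. by apply: cplx_eq; rewrite /cconj !recimE; ring. Qed.

Lemma cplx_direction (A B : 'M[R]_n.+4) u :
  cmx (recplx u *: A + imcplx u *: B) =
  u *: (2^-1 *: (cmx A - 'i *: cmx B)) + cconj u *: (2^-1 *: (cmx A + 'i *: cmx B)).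
Proof.
have e1 : tocplx (recplx u) = u * 2^-1 + cconj u * 2^-1.
  by rewrite half_cplx; apply: cplx_eq; rewrite /cconj !recimE; field.
have e2 : tocplx (imcplx u) = - (u * 2^-1 * 'i) + cconj u * 2^-1 * 'i.
  by rewrite half_cplx; apply: cplx_eq; rewrite /cconj !recimE; field.
rewrite cmxD !cmxZ e1 e2; move: (cconj u) (2^-1 : C) ('i : C) (cmx A) (cmx B) => w h i X Y.
by rewrite !scalerDr !scalerDl !scalerN !scalerA scaleNr; apply/matrixP => a b; rewrite !mxE; ring.
Qed.

Lemma cmx_direction (F : C -> 'M[R]_n.+4) z u :
  cmx (recplx u *: rder 1 F z + imcplx u *: rder 'i F z) =
  u *: ddz F z + cconj u *: ddzbar F z.
Proof. exact: cplx_direction. Qed.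

(** The value of the form alpha_lambda on the real tangent vector u. *)
Definition alpha_direction (F1 : C -> 'M[R]_n.+4) l z u : 'M[C]_n.+4 :=
  u *: alpha_dz F1 z l + cconj u *: alpha_dzbar F1 z l.

(** The coefficients of dz and of d(conj z) in the p-part of alpha, the only part
that is affected by lambda. *)
Definition alpha_prime (F1 : C -> 'M[R]_n.+4) z : 'M[C]_n.+4 :=
  ppart (invmx (cmx (F1 z)) *m ddz F1 z).
Definition alpha_second (F1 : C -> 'M[R]_n.+4) z : 'M[C]_n.+4 :=
  ppart (invmx (cmx (F1 z)) *m ddzbar F1 z).

Lemma spectral_recombine (X Y X' Y' : 'M[C]_n.+4) l u :
  u *: (l^-1 *: X + X') + cconj u *: (l *: Y + Y') =
  u *: (1^-1 *: X + X') + cconj u *: (1 *: Y + Y') +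
    (((l^-1 - 1) * u) *: X + ((l - 1) * cconj u) *: Y).
Proof. by rewrite invr1; apply/matrixP => i j; rewrite !mxE; ring. Qed.

Lemma alpha_directionE (F1 : C -> 'M[R]_n.+4) l z u : alpha_direction F1 l z u =
  alpha_direction F1 1 z u + (((l^-1 - 1) * u) *: alpha_prime F1 z +
    ((l - 1) * cconj u) *: alpha_second F1 z).
Proof. exact: spectral_recombine. Qed.

Lemma ppart_recombine (X Y : 'M[C]_n.+4) u :
  ppart (u *: (1^-1 *: ppart X + kpart X) + cconj u *: (1 *: ppart Y + kpart Y)) =
  u *: ppart X + cconj u *: ppart Y.
Proof.
have E (Z W : 'M[C]_n.+4) a : W = ppart Z -> ppart (a *: (W + kpart Z)) = a *: ppart Z.
  move=> ->; rewrite [ppart Z + _]addrC -pk_split; exact: ppartZ.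
rewrite ppartD; congr (_ + _); apply: E; last exact: scale1r.
by rewrite invr1; exact: scale1r.
Qed.

Lemma ppart_alpha1 (F1 : C -> 'M[R]_n.+4) z u : ppart (alpha_direction F1 1 z u) =
  u *: alpha_prime F1 z + cconj u *: alpha_second F1 z.
Proof. exact: ppart_recombine. Qed.

Lemma mulmx_combination (M X Y : 'M[C]_n.+4) a b :
  a *: (M *m X) + b *: (M *m Y) = M *m (a *: X + b *: Y).
Proof. by rewrite mulmxDr -!scalemxAr. Qed.

Lemma gauge_recombine (H M a1 b1 Ap As Bp Bs : 'M[C]_n.+4) (s t u u' w w' : C) :
  u *: (M *m Ap) = w *: (Bp *m M) -> u' *: (M *m As) = w' *: (Bs *m M) ->
  H *m (b1 + ((s * w) *: Bp + (t * w') *: Bs)) *m M + H *m (M *m a1 - b1 *m M) =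
  H *m M *m (a1 + ((s * u) *: Ap + (t * u') *: As)).
Proof.
move=> h1 h2; rewrite -!mulmxA -mulmxDr; congr (_ *m _).
rewrite !mulmxDl !mulmxDr -!scalemxAl -!scalemxAr -!scalerA h1 h2 !scalerA.
by rewrite addrC addrA subrK.
Qed.

Lemma scaler_swap (X : 'M[C]_n.+4) (a b : C) : a *: (b *: X) = (b * a) *: X.
Proof. by rewrite scalerA mulrC. Qed.

(** Two relations for the tangent vectors 1 and i determine the relations for dz and
d(conj z). *)
Lemma type_separation (M A A' B B' : 'M[C]_n.+4) (c c' : C) :
  M *m (A + A') = (c *: B + c' *: B') *m M ->
  M *m ('i *: A - 'i *: A') = ((c * 'i) *: B - (c' * 'i) *: B') *m M ->
  M *m A = c *: (B *m M) /\ M *m A' = c' *: (B' *m M).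
Proof.
rewrite mulmxDr mulmxDl mulmxBr mulmxBl -!scalemxAl -!scalemxAr.
move: (M *m A) (M *m A') (B *m M) (B' *m M) => a a' b b' h1 h2.
have i0 : ('i : C) != 0 by apply/eqP => /(congr1 (@imcplx R)); rewrite !recimE => /eqP; rewrite oner_eq0.
have h3 : a - a' = c *: b - c' *: b'.
  apply: (scalerI i0); rewrite !scalerBr h2 !scalerA.
  by rewrite ['i * c]mulrC ['i * c']mulrC.
have two : (2 : C) != 0 by rewrite pnatr_eq0.
have dbl (x y : 'M[C]_n.+4) : x + x = y + y -> x = y.
  by move=> xy; apply: (scalerI two); rewrite !scaler_nat !mulr2n.
have aE : a = c *: b.
  apply: dbl; have -> : a + a = (a + a') + (a - a') by rewrite addrACA subrr addr0.
  by rewrite h1 h3 addrACA subrr addr0.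
by split => //; move: h1; rewrite aE => /addrI.
Qed.

Variables (D : set C) (f : C -> set 'M[R]_n.+4).
Hypotheses (oD : open D) (cD : connected D) (D0 : D 0).

Lemma frame_SOplus F z l : extended_frame D f F -> D z -> circle l -> @SOplus R n.+3 (F z l).
Proof. by move=> [[FL _] _ _ _ _] Dz; have [_ + _] := FL z Dz; exact. Qed.

Lemma frame_iso F z l : extended_frame D f F -> D z -> circle l -> lorentz_isometry (F z l).
Proof. by move=> hF Dz lc; have /SOplusP[] := frame_SOplus hF Dz lc. Qed.

Lemma frame_direction F l z u : extended_frame D f F -> circle l -> D z ->
  cmx (recplx u *: rder 1 (F^~ l) z + imcplx u *: rder 'i (F^~ l) z) =
  cmx (F z l) *m alpha_direction (F^~ 1) l z u.
Proof.
move=> [_ _ _ _ H] lc Dz; have [h1 h2] := H l lc z Dz.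
by rewrite cmx_direction [ddz _ _]h1 [ddzbar _ _]h2; exact: mulmx_combination.
Qed.

Lemma direction1 (X Y : 'M[R]_n.+4) : recplx (1 : C) *: X + imcplx (1 : C) *: Y = X.
Proof. by rewrite !recimE scale1r scale0r addr0. Qed.

Lemma directioni (X Y : 'M[R]_n.+4) : recplx ('i : C) *: X + imcplx ('i : C) *: Y = Y.
Proof. by rewrite !recimE scale1r scale0r add0r. Qed.

Lemma frame_partial F l z v : extended_frame D f F -> circle l -> D z -> v = 1 \/ v = 'i ->
  is_rder v (F^~ l) z (rder v (F^~ l) z) /\
  cmx (rder v (F^~ l) z) = cmx (F z l) *m alpha_direction (F^~ 1) l z v.
Proof.
move=> hF lc Dz hv; have [_ _ sm _ _] := hF.
have [_ F1 _ _] := smooth_partials (sm l lc); split; first exact: F1.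
rewrite -frame_direction//; congr cmx.
by case: hv => ->; [exact: esym (direction1 _ _)|exact: esym (directioni _ _)].
Qed.

Section Transform.
Variables (F F0 : C -> C -> 'M[R]_n.+4) (g : C -> C) (A : 'M[R]_n.+4) (b : bool).
Hypotheses (hF : extended_frame D f F) (hF0 : extended_frame D f F0).
Hypotheses (gD : forall z, D z -> D (g z)) (gd : forall z, D z -> derivable g z 1).
Hypothesis detA : \det A = (-1) ^+ b.
Hypothesis fg : forall z, D z -> f (g z) = act A (f z).

(** For f o gamma = A f, the map T with F0(gamma z) T(z) = A F(z) at lambda = 1. *)
Definition transition z : 'M[R]_n.+4 := lorentz_adj (F0 (g z) 1) *m A *m F z 1.

Lemma transition_Kgrp z : D z -> @Kgrp R n (transition z *m Pt R n b).
Proof.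
move=> Dz; have [_ [_ lF] _ _ _] := hF; have [_ [_ lF0] _ _ _] := hF0.
have [_ fz] := lF z Dz; have [_ fgz] := lF0 (g z) (gD Dz).
have := fg Dz; rewrite fz fgz (act_cosetK _ detA) => /esym /cosetK_eqP[k Kk E].
have -> : transition z *m Pt R n b = lorentz_adj (F0 (g z) 1) *m F0 (g z) 1 *m k.
  rewrite -(mulmxA _ _ k) -E /transition; move: (lorentz_adj _) => P.
  by rewrite !mulmxA.
rewrite (lorentz_isoP _).1 ?mul1mx//.
by apply: (frame_iso hF0 (gD Dz)); exact: circle1.
Qed.

(** Ptilde is fixed by sigma, and so are the elements of K. *)
Lemma transition_sigma z : D z -> sigma (transition z) = transition z.
Proof.
move=> Dz; have /KgrpP[_ sk _] := transition_Kgrp Dz.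
by rewrite -(mulPtK b (transition z)) sigmaM sk sigma_Pt.
Qed.

Lemma image_frame_partial l z v c : circle l -> D z -> is_derive z 1 g c ->
  exists2 H, is_rder v (fun z => F0 (g z) l) z H &
    cmx H = cmx (F0 (g z) l) *m alpha_direction (F0^~ 1) l (g z) (c * v).
Proof.
move=> lc Dz gz; have [_ _ sm _ _] := hF0.
exists (recplx (c * v) *: rder 1 (F0^~ l) (g z) + imcplx (c * v) *: rder 'i (F0^~ l) (g z)).
  exact: (smooth_chain v oD (sm l lc) (gD Dz) gz).
by apply: frame_direction => //; exact: gD.
Qed.

Lemma image_frame_iso z l : circle l -> D z -> lorentz_isometry (F0 (g z) l).
Proof. by move=> lc Dz; apply: (frame_iso hF0 (gD Dz)). Qed.

(** The equation dT = T alpha - (gamma^* beta) T of a gauge transformation. *)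
Lemma transition_partial z v c : D z -> v = 1 \/ v = 'i -> is_derive z 1 g c ->
  exists Tv, [/\ is_rder v transition z Tv, sigma (cmx Tv) = cmx Tv &
    cmx Tv = cmx (transition z) *m alpha_direction (F^~ 1) 1 z v -
      alpha_direction (F0^~ 1) 1 (g z) (c * v) *m cmx (transition z)].
Proof.
move=> Dz hv gz; have c1 := circle1 R.
have [hF1 EF1] := frame_partial hF c1 Dz hv.
have [H hH EH] := image_frame_partial v c1 Dz gz.
move: (alpha_direction (F0^~ 1) 1 _ _) (alpha_direction (F^~ 1) 1 z v) EH EF1 => be al EH EF1.
have near_iso : \forall t \near (0 : R), lorentz_isometry (F0 (g (z + tocplx t * v)) 1).
  by apply: filterS (line_near v oD Dz) => t; exact: image_frame_iso.
have adjH := adj_derivative hH near_iso.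
pose J := lorentz_form R n.+3.
have d1 := is_derive_mulmx (is_derive_mulmx (is_derive_cst J (0 : R) (1 : R)) (is_derive_trmx hH))
  (is_derive_cst J (0 : R) (1 : R)).
have d2 := is_derive_mulmx (is_derive_mulmx d1 (is_derive_cst A (0 : R) (1 : R))) hF1.
set Tv := (X in is_derive _ _ _ X) in d2.
have dT : is_rder v transition z Tv by exact: d2.
have TvR : Tv = lorentz_adj H *m A *m F z 1 + lorentz_adj (F0 (g z) 1) *m A *m rder v (F^~ 1) z.
  rewrite /Tv /cst !mul0mx !add0r !mulmx0 !addr0.
  by rewrite (rder_val hH) (rder_val hF1).
exists Tv; split => //.
  rewrite -cmx_sigma; congr cmx; apply: (sigma_derivative dT).
  by apply: filterS (line_near v oD Dz) => t; exact: transition_sigma.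
rewrite (rder_val hH) in adjH.
rewrite TvR adjH /transition.
have PQ : cmx (lorentz_adj (F0 (g z) 1)) *m cmx (F0 (g z) 1) = 1%:M.
  by rewrite -cmxM (lorentz_isoP _).1 ?cmx1//; exact: image_frame_iso.
move: EH EF1 PQ; move: (lorentz_adj (F0 (g z) 1)) => P.
move: (F0 (g z) 1) (F z 1) (rder v _ z) => Q F1 F1v EH EF1 PQ.
rewrite !cmxD !mulNmx !cmxN !cmxM EH EF1 !mulmxA PQ mul1mx addrC.
by [].
Qed.

(** T is fixed by sigma, so the p-part of its equation has no derivative left; as
gamma is holomorphic, gamma^* preserves the types (1,0) and (0,1). *)
Lemma transition_types z c : D z -> is_derive z 1 g c ->
  cmx (transition z) *m alpha_prime (F^~ 1) z =
    c *: (alpha_prime (F0^~ 1) (g z) *m cmx (transition z)) /\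
  cmx (transition z) *m alpha_second (F^~ 1) z =
    cconj c *: (alpha_second (F0^~ 1) (g z) *m cmx (transition z)).
Proof.
move=> Dz gz.
have sT : sigma (cmx (transition z)) = cmx (transition z) by rewrite -cmx_sigma transition_sigma.
have key v : v = 1 \/ v = 'i ->
  cmx (transition z) *m (v *: alpha_prime (F^~ 1) z + cconj v *: alpha_second (F^~ 1) z) =
  ((c * v) *: alpha_prime (F0^~ 1) (g z) + cconj (c * v) *: alpha_second (F0^~ 1) (g z))
     *m cmx (transition z).
  move=> hv; have [Tv [_ sTv ET]] := transition_partial Dz hv gz.
  rewrite ET in sTv.
  exact: (etrans (congr1 (mulmx _) (esym (ppart_alpha1 (F^~ 1) z v)))
    (etrans (ppart_intertwine sT sTv)
      (congr1 (mulmx^~ _) (ppart_alpha1 (F0^~ 1) (g z) (c * v))))).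
have k1 := key 1 (or_introl erefl); have ki := key 'i (or_intror erefl).
have c1 : cconj 1 = 1 by apply: cplx_eq; rewrite /cconj !recimE ?oppr0.
have ci : cconj 'i = - 'i by apply: cplx_eq; rewrite /cconj !recimE ?oppr0.
move: k1 ki; rewrite !cconjM c1 ci mulrN !mulr1.
move: (alpha_prime (F^~ 1) z) (alpha_second (F^~ 1) z) (alpha_prime (F0^~ 1) (g z))
  (alpha_second (F0^~ 1) (g z)) => a1 a2 b1 b2.
rewrite !scale1r !scaleNr; exact: type_separation.
Qed.

(** Introducing lambda multiplies the (1,0)- and (0,1)-parts of the p-parts by
scalars, which is compatible with the relations of transition_types. So F0(gamma z,
l) T(z) and F(z, l) satisfy the same equation. *)
Lemma frame_transform l z : circle l -> D z ->
  F0 (g z) l *m transition z = F0 (g 0) l *m transition 0 *m F z l.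
Proof.
move=> lc Dz.
suff : F0 (g z) l *m transition z *m lorentz_adj (F z l) =
   F0 (g 0) l *m transition 0 *m lorentz_adj (F 0 l).
  have -> : F 0 l = 1%:M by have [_ _ _ + _] := hF; exact.
  rewrite lorentz_adj1 mulmx1 => <-.
  by rewrite -[RHS]mulmxA (lorentz_isoP _).1 ?mulmx1//; exact: frame_iso.
apply: (@gauge_unique R n D (fun z => F0 (g z) l *m transition z) (F^~ l)
  (fun v z => alpha_direction (F^~ 1) l z v)) => //.
  by move=> w Dw; exact: frame_iso.
move=> {}z v {}Dz hv.
have gz : is_derive z 1 g ('D_1 g z) by apply/derivableP; exact: gd.
have [hFl EFl] := frame_partial hF lc Dz hv.
have [Hl hHl EHl] := image_frame_partial v lc Dz gz.
have [Tv [hT _ ET]] := transition_partial Dz hv gz.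
have [tp ts] := transition_types Dz gz.
exists (Hl *m transition z + F0 (g z) l *m Tv), (rder v (F^~ l) z).
split; [|exact: hFl| |exact: EFl].
  have := is_derive_mulmx hHl hT.
  by rewrite (rder_val hHl) (rder_val hT).
rewrite cmxD (cmxM Hl) (cmxM _ Tv) ET EHl (cmxM (F0 (g z) l)).
have := alpha_directionE (F0^~ 1) l (g z) ('D_1 g z * v).
have := alpha_directionE (F^~ 1) l z v.
move: (alpha_direction (F^~ 1) l z v) (alpha_direction (F0^~ 1) l (g z) _) => al be -> ->.
apply: gauge_recombine.
  by rewrite tp; exact: scaler_swap.
by rewrite ts cconjM; exact: scaler_swap.
Qed.

End Transform.
End Frames.

(** * Constant loops with values in K *)
Section ConstantLoops.
Variables (R : realType) (n : nat).

Lemma loops_cvg_cmx (U : Type) (F : set_system U) {FF : Filter F} (f : U -> loops R R n)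
    (a : loops R R n) : f x @[x --> F] --> a ->
  (fun l => cmx (f x l)) @[x --> F] --> ((fun l => cmx (a l)) : loops R (cplx R) n).
Proof.
move=> /cvg_loopsP fa; apply/cvg_loopsP => e e0; have [eE e0'] := gt0_cplx e0.
move: (fa _ e0'); apply: filterS => x h l lc i j.
rewrite !mxE -rmorphB norm_cplx recplxC imcplxC expr0n addr0 sqrtr_sqr eE ltcR_tocplx.
exact: h.
Qed.

Lemma cst_loop_component (X : set 'M[R]_n.+4) : connected X -> X 1%:M ->
  (forall k, X k -> @SOplus R n.+3 k /\ sigma k = k) -> forall k, X k ->
  @LambdaG0 R n (fun=> k) /\ @LambdaplusGC0 R n (fun=> cmx k).
Proof.
move=> cX X1 XP k Xk; split.
  apply: (@id_component_path _ _ _ _ _ X (fun k => (fun=> k) : loops R R n) 1%:M) => //.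
  - apply/subspace_continuousP => x Xx; apply: loops_cvg_cst; exact: cvg_within.
  - by move=> x /XP[h1 h2]; exact: LambdaG_cst.
  - exact: id_component1 (@LambdaG_group R n).
apply: (@id_component_path _ _ _ _ _ X (fun k => (fun=> cmx k) : loops R (cplx R) n) 1%:M) => //.
- apply/subspace_continuousP => x Xx; apply: loops_cvg_cst.
  apply: (@cvg_comp _ _ _ id (@cmx R n.+4) _ (nbhs x)); first exact: cvg_within.
  exact: cmx_continuous.
- by move=> x /XP[h1 h2]; apply: LambdaplusGC_cst; [exact: cmx_SOC|rewrite -cmx_sigma h2].
- by rewrite cmx1; exact: id_component1 (@LambdaplusGC_group R n).
Qed.

(** An isometry preserves the orthogonal complement of the vectors that it fixes, so
it is block diagonal. *)
Lemma Fix4_sigma (M : 'M[R]_n.+4) : @Fix R n.+3 4 M -> sigma M = M.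
Proof.
move=> [hM fM]; apply/matrixP => i j; rewrite sigma_entry.
have [ij|ij] := eqVneq (i < 4)%N (j < 4)%N.
  by rewrite ij mulrAC -expr2 sqrr_sign mul1r.
suff -> : M i j = 0 by rewrite mulr0 mul0r.
have ne : (i == j) = false by apply/negbTE; apply: contra ij => /eqP ->.
case: (ltnP j 4) ij => j4 ij.
  by have := fM j j4 => /colP /(_ i); rewrite -colE !mxE ne.
have i4 : (i < 4)%N by case: (i < 4)%N ij.
have := bil_iso (delta_mx j ord0) (delta_mx i ord0) hM.
rewrite (fM i i4) !bil_delta -colE !mxE ne /= mulr0.
by case: ifP => _; rewrite ?mulN1r ?mul1r// => /eqP; rewrite oppr_eq0 => /eqP.
Qed.

(** K is connected: its factor SO^+(1,3) is a component by definition, and SO(n) is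
contained in a component of Fix 4 by Fix_component. *)
Lemma Kgrp_cst_loop (k : 'M[R]_n.+4) : (1 <= n)%N -> @Kgrp R n k ->
  @LambdaG0 R n (fun=> k) /\ @LambdaplusGC0 R n (fun=> cmx k).
Proof.
move=> n1 [a ha [b hb <-]].
pose B1 (x : 'M[R]_4) : 'M[R]_n.+4 := block_mx x 0 0 (1%:M : 'M[R]_n).
pose B2 : 'M[R]_n.+4 := block_mx (1%:M : 'M[R]_4) 0 0 b.
have E : (block_mx a 0 0 b : 'M[R]_n.+4) = B1 a *m B2.
  rewrite /B1 /B2 (@mulmx_block R 4 n 4 n 4 n).
  by rewrite !(mulmx0, mul0mx, addr0, add0r, mulmx1, mul1mx).
have SO1 : @SO R n 1%:M by split; rewrite ?trmx1 ?mulmx1 ?det1.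
have one : B1 1%:M = 1%:M by rewrite /B1 -(@scalar_mx_block R 4 n 1).
have h1 x : @SOplus R 3 x -> @Kgrp R n (B1 x) by move=> hx; exists x => //; exists 1%:M.
have [L1 P1] : @LambdaG0 R n (fun=> B1 a) /\ @LambdaplusGC0 R n (fun=> cmx (B1 a)).
  apply: (@cst_loop_component (B1 @` @SOplus R 3)); last by exists a.
  - apply: connected_continuous_connected; first exact: component_connected.
    apply: continuous_subspaceT => x.
    apply: (@cvg_mxP _ _ _ _ (nbhs x) (nbhs_filter x) B1 (B1 x)).2 => i j.
    have ul y (i' j' : 'I_4) : B1 y (@lshift 4 n i') (@lshift 4 n j') = y i' j' by exact: block_mxEul.
    have ur y (i' : 'I_4) (j' : 'I_n) : B1 y (@lshift 4 n i') (@rshift 4 n j') = 0.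
      by rewrite /B1 (@block_mxEur R 4 n 4 n) mxE.
    have dl y (i' : 'I_n) (j' : 'I_4) : B1 y (@rshift 4 n i') (@lshift 4 n j') = 0.
      by rewrite /B1 (@block_mxEdl R 4 n 4 n) mxE.
    have dr y (i' j' : 'I_n) : B1 y (@rshift 4 n i') (@rshift 4 n j') = (1%:M : 'M[R]_n) i' j'.
      by exact: block_mxEdr.
    case: (@split_ordP 4 n i) => i' ->; case: (@split_ordP 4 n j) => j' ->.
    + by rewrite ul; under eq_fun do rewrite ul; exact: (@entry_continuous R 4 4).
    + by rewrite ur; under eq_fun do rewrite ur; exact: cvg_cst.
    + by rewrite dl; under eq_fun do rewrite dl; exact: cvg_cst.
    + by rewrite dr; under eq_fun do rewrite dr; exact: cvg_cst.
  - by exists 1%:M => //; exact: SOplus1.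
  - by move=> _ [x /h1 /KgrpP[k1 k2 _] <-].
have K2 : @Kgrp R n B2 by exists 1%:M; [exact: SOplus1|exists b].
have [L2 P2] : @LambdaG0 R n (fun=> B2) /\ @LambdaplusGC0 R n (fun=> cmx B2).
  have /KgrpP[/SOplusP[hB B00 dB] _ _] := K2.
  have n3 : (4 <= n.+3)%N by [].
  have FB : @Fix R n.+3 4 B2.
    split => // i i4; rewrite -colE; apply/colP => j; rewrite mxE [RHS]mxE andbT.
    have -> : i = @lshift 4 n (Ordinal i4) by exact: val_inj.
    case: (@split_ordP 4 n j) => j' ->.
      rewrite [LHS](@block_mxEul R 4 n 4 n) mxE; congr (nat_of_bool _)%:R.
    rewrite [LHS](@block_mxEdl R 4 n 4 n) mxE.
    by have -> : (@rshift 4 n j' == @lshift 4 n (Ordinal i4)) = false by exact: eq_rlshift.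
  have [X [X1 XF cX] XB] := Fix_component n3 FB B00 dB.
  apply: (cst_loop_component cX) => // x Xx.
  have Xiso : X `<=` @lorentz_isometry R n.+3 by move=> M /XF[].
  split; last exact/Fix4_sigma/XF.
  apply/SOplusP; split; first exact: Xiso.
    by rewrite (connected_iso_sign cX Xiso Xx X1) mxE eqxx.
  by rewrite (connected_iso_det cX Xiso Xx X1) det1.
rewrite E cmxM; split; first exact: (id_componentM (@LambdaG_group R n) L1 L2).
exact: (id_componentM (@LambdaplusGC_group R n) P1 P2).
Qed.

End ConstantLoops.

(** * Plus loops that are real on the circle *)
Section RealLoops.
Variables (R : realType) (n : nat).
Local Notation K := (cplx R).
Implicit Types (l : K).

Lemma eps_cmx (M : 'M[R]_n.+4) : eps (cmx M) = tocplx (eps M).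
Proof. by rewrite /eps -det_map_mx; congr (\det _); apply/matrixP => i j; rewrite !mxE. Qed.

(** Each entry of the extension is real on the circle, hence constant, so the loop
equals the value at 0 of its extension, to which extension_sigma and
eps_LambdaplusGC0 apply. *)
Lemma real_plus_loop (N : loops R R n) : @LambdaplusGC0 R n (fun l => cmx (N l)) ->
  forall l, circle l -> sigma (N l) = N l /\ eps (N l) = 1.
Proof.
move=> hN l lc; have [Nl [h hh]] := id_component_sub hN.
have aE : disc_extension (fun l => cmx (N l)) h by [].
have s0 := extension_sigma Nl aE; have e0 := eps_LambdaplusGC0 hN aE.
have [h1 h2 _ h4] := hh.
have hE : cmx (N l) = h 0.
  rewrite -h4//; apply/matrixP => i j.
  apply: (disc_real_circle (extension_entry i j h1 h2)) => // l' lc'.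
  by rewrite h4// mxE.
split; first by apply: cmx_inj; rewrite cmx_sigma hE.
by have := eps_cmx (N l); rewrite hE e0 => -[].
Qed.

End RealLoops.

Section Density.
Variables (R : realType) (n : nat).
Local Notation K := (cplx R).

(** It extends relations known at regular points to all of D. *)
Lemma constant_by_density (U : set K) (phi : K -> R) z c :
  (forall A, nbhs z A -> exists2 w, A w & U w) -> {for z, continuous phi} ->
  (forall w, U w -> phi w = c) -> phi z = c.
Proof.
move=> dU cphi Uc; apply/eqP; apply: contrapT => /negP ne.
have o : open [set x : R | x != c] by exact: open_neq.
have := cphi [set x | x != c] (open_nbhs_nbhs (conj o ne)).
by move=> /dU[w /= + /Uc E]; rewrite E eqxx.
Qed.

Lemma sigma_continuous (M : 'M[R]_n.+4) i j : {for M, continuous (fun A : 'M[R]_n.+4 => sigma A i j - A i j)}.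
Proof.
have c : A i j @[A --> M] --> M i j by exact: entry_continuous.
suff h : (sigma A i j - A i j) @[A --> M] --> sigma M i j - M i j by exact: h.
rewrite sigma_entry; under eq_fun do rewrite sigma_entry.
exact: (cvgB (cvgM (cvgM (cvg_cst _) c) (cvg_cst _)) c).
Qed.

End Density.

(** * Potentials and their solutions *)
Lemma cvg_lorentz_adj (T : Type) (K : numFieldType) m (A : set_system T) {FA : Filter A}
    (h : T -> 'M[K]_m.+1) (M : 'M[K]_m.+1) : h x @[x --> A] --> M ->
  lorentz_adj (h x) @[x --> A] --> lorentz_adj M.
Proof.
move=> hM; apply: cvg_mulmx; last exact: cvg_cst.
by apply: cvg_mulmx; [exact: cvg_cst|exact: cvg_trmx].
Qed.

Lemma cvg_quotient (T : Type) (K : numFieldType) m (A : set_system T) {FA : Filter A}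
    (g h : T -> 'M[K]_m.+1) (G H a b : 'M[K]_m.+1) :
  g x @[x --> A] --> G -> h x @[x --> A] --> H ->
  lorentz_adj (g x) *m a *m h x *m b @[x --> A] --> lorentz_adj G *m a *m H *m b.
Proof.
move=> /cvg_lorentz_adj gG hH; apply: cvg_mulmx; last exact: cvg_cst.
by apply: cvg_mulmx => //; apply: cvg_mulmx => //; exact: cvg_cst.
Qed.

Section PotentialTheory.
Variables (R : realType) (n : nat).
Local Notation K := (cplx R).
Variables (D S : set K) (f : K -> set 'M[R]_n.+4) (eta C : K -> K -> 'M[K]_n.+4).
Hypotheses (oD : open D) (cD : connected D) (D0 : D 0).
Hypotheses (S_poles : pole_set D S) (eta_potential : potential D S f eta)
  (C_solution : solution D S eta C).
Implicit Types (F : K -> K -> 'M[R]_n.+4) (z l : K).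

Lemma regular_base : (D `\` S) 0.
Proof. by have [_ _ nS0] := S_poles. Qed.

Lemma poles_discrete : no_limit_point D S.
Proof. by have [] := S_poles. Qed.

Lemma solution_derive C' l z : solution D S eta C' -> circle l -> (D `\` S) z ->
  is_derive z 1 (C'^~ l) (C' z l *m eta z l).
Proof.
move=> [[[_ _ dC] _] _ eC] lc Uz.
by apply: DeriveDef; [exact: dC|exact: eC].
Qed.

Lemma frame_at0 F l : extended_frame D f F -> circle l -> F 0 l = 1%:M.
Proof. by move=> [_ _ _ + _]; exact. Qed.

(** The case gamma = id, A = 1 of frame_transform. *)
Lemma frame_unique F F0 z : extended_frame D f F -> extended_frame D f F0 -> D z ->
  exists2 k, @Kgrp R n k & forall l, circle l -> F z l = F0 z l *m k.
Proof.
move=> hF hF0 Dz.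
have idD w : D w -> D (id w) by [].
have idd w : D w -> derivable (id : K -> K) w 1 by move=> _; exact: derivable_id.
have d1 : \det (1%:M : 'M[R]_n.+4) = (-1) ^+ false by rewrite det1.
have Pf : Pt R n false = 1%:M by [].
have f1 w : D w -> f (id w) = act 1%:M (f w).
  move=> Dw; have [_ [_ lF] _ _ _] := hF; have [_ ->] := lF w Dw.
  by rewrite (act_cosetK _ d1) Pf mulmx1 mul1mx.
exists (transition F F0 id 1%:M z).
  by have := transition_Kgrp hF hF0 idD d1 f1 Dz; rewrite Pf mulmx1.
move=> l lc; have := frame_transform oD cD D0 hF hF0 idD idd d1 f1 lc Dz.
have -> : transition F F0 id 1%:M 0 = 1%:M.
  by rewrite /transition !frame_at0//; [rewrite lorentz_adj1 !mulmx1|exact: circle1|exact: circle1].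
by move=> ->; rewrite /= frame_at0// !mul1mx.
Qed.

(** Both solutions start at I at the base point, which is not a pole. *)
Lemma solution_unique C' l z : solution D S eta C' ->
  (forall z, (D `\` S) z -> lorentz_isometry (C' z l)) -> circle l -> (D `\` S) z ->
  C z l = C' z l.
Proof.
move=> sC' isoC' lc Uz.
have [_ C0 _] := C_solution; have [_ C0' _] := sC'.
have oU : open (D `\` S) := no_limit_open oD poles_discrete.
have cU : connected (D `\` S) := connected_minus_discrete oD cD poles_discrete.
have := gauge_unique_holo oU cU isoC' (fun w => solution_derive C_solution lc)
  (fun w => solution_derive sC' lc) Uz regular_base.
rewrite (C0 l lc) (C0' l lc) lorentz_adj1 => E.
have h := (lorentz_isoP _).1 (isoC' z Uz).
move: (lorentz_adj _) E h => q E h.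
by rewrite -[RHS]mul1mx -(mulmx1 1%:M) -E -mulmxA h mulmx1.
Qed.

(** The decomposition, given for one solution and one frame in the definition of a
potential, holds for every solution and every frame: solutions are unique and frames
differ by elements of K, which are constant plus loops. *)
Lemma solution_split F z : extended_frame D f F -> (D `\` S) z ->
  exists2 W, @LambdaplusGC R n W & forall l, circle l -> C z l = cmx (F z l) *m W l.
Proof.
move=> hF Uz; have [_ _ _ [C' [F0 [sC' hF0 dec]]]] := eta_potential.
have CE l : circle l -> C z l = C' z l.
  move=> lc; apply: solution_unique => // w Uw.
  have [W [[_ W2 _] _] ->//] := dec w Uw.
  apply: lorentz_isoM; last by have [] := W2 l lc.
  by apply/cmx_iso; apply: (frame_iso hF0) => //; case: Uw.
have [W hW WE] := dec z Uz.
have [k Kk kE] := frame_unique hF hF0 (proj1 Uz).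
have [_ GM GV _ _] := @LambdaplusGC_group R n.
have /KgrpP[Sk sk _] := Kk; have hk := (SOplusP _).1 Sk.
exists (fun l => lorentz_adj (cmx k) *m W l).
  apply: GM hW; apply: GV; apply: LambdaplusGC_cst; first exact: cmx_SOC.
  by rewrite -cmx_sigma sk.
move=> l lc; rewrite CE// WE// kE// (cmxM _ k).
have ek : cmx k *m lorentz_adj (cmx k) = 1%:M.
  by apply: lorentz_adjV; apply/cmx_iso; case: hk.
move: (lorentz_adj _) ek => q ek.
by rewrite mulmxA -(mulmxA (cmx (F0 z l))) ek mulmx1.
Qed.

Lemma solution_loop_frame F z : extended_frame D f F -> (D `\` S) z ->
  @LambdaGC R n (C z) /\ @LambdaplusGC R n (fun l => lorentz_adj (cmx (F z l)) *m C z l).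
Proof.
move=> hF Uz; have [W hW WE] := solution_split hF Uz.
have [FL _ _ _ _] := hF; have hFz := FL.1 z (proj1 Uz).
have [_ GM _ _ GE] := @LambdaGC_group R n.
have [_ _ _ _ PE] := @LambdaplusGC_group R n.
split.
  apply: (GE (fun l => cmx (F z l) *m W l)); first by move=> l lc; rewrite WE.
  by apply: GM; [exact: LambdaG_cmx|case: hW].
apply: (PE W) => // l lc; rewrite WE//.
have := (lorentz_isoP _).1 ((cmx_iso _).1 (frame_iso hF (proj1 Uz) lc)).
by move: (lorentz_adj _) => q qE; rewrite mulmxA qE mul1mx.
Qed.

Lemma solution_continuous : {within D `\` S, continuous (C : K -> loops R K n)}.
Proof. by have [[[_ c _] _] _ _] := C_solution. Qed.

(** Both families are continuous on the connected set D minus S and start at the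
constant loop I at the base point. *)
Lemma solution_loop0 F z : extended_frame D f F -> (D `\` S) z ->
  @LambdaGC0 R n (C z) /\ @LambdaplusGC0 R n (fun l => lorentz_adj (cmx (F z l)) *m C z l).
Proof.
move=> hF; move: z.
have [_ C0 _] := C_solution.
have cU : connected (D `\` S) := connected_minus_discrete oD cD poles_discrete.
have gG := @LambdaGC_group R n; have gP := @LambdaplusGC_group R n.
suff [h1 h2] : (forall z, (D `\` S) z -> @LambdaGC0 R n (C z)) /\
    forall z, (D `\` S) z -> @LambdaplusGC0 R n (fun l => lorentz_adj (cmx (F z l)) *m C z l).
  by move=> z Uz; split; [exact: h1|exact: h2].
split.
  apply: (id_component_path cU solution_continuous _ regular_base).
    by move=> z Uz; case: (solution_loop_frame hF Uz).
  apply: (id_component_eq gG (a := fun=> 1%:M)); first by move=> l lc; rewrite C0.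
  exact: id_component1.
apply: (@id_component_path _ _ _ _ _ (D `\` S)
  (fun z => (fun l => lorentz_adj (cmx (F z l)) *m C z l) : loops R K n) _ cU _ _ regular_base).
- apply/subspace_continuousP => z Uz.
  have [FL _ _ _ _] := hF; have hFz := FL.1 z (proj1 Uz).
  have [_ _ GV GI _] := gG.
  have b1 := (GI _ (GV _ (LambdaG_cmx hFz))).1.
  have b2 := (GI _ (solution_loop_frame hF Uz).1).1.
  have cF : (F : K -> loops R R n) w @[w --> within (D `\` S) (nbhs z)] --> (F z : loops R R n).
    move/subspace_continuousP: FL.2 => /(_ z (proj1 Uz)); apply: cvg_trans; apply: cvg_app.
    by apply: cvg_within_filter_sub || apply: within_subset => // w [].
  have cC := (subspace_continuousP _ _).1 solution_continuous z Uz.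
  exact: (loops_cvgM b1 b2 (loops_cvg_adj (loops_cvg_cmx cF)) cC).
- by move=> z Uz; case: (solution_loop_frame hF Uz).
- apply: (id_component_eq gP (a := fun=> 1%:M)); last exact: id_component1.
  by move=> l lc; rewrite C0// frame_at0// cmx1 lorentz_adj1 mulmx1.
Qed.

(** * Monodromy of a gauge-invariant potential *)

Variable gamma : K -> K.
Hypotheses (gamma_aut : conformal_automorphism D gamma) (n1 : (1 <= n)%N).
Local Notation U := (regular_points D S gamma).
Implicit Types (V : K -> K -> 'M[K]_n.+4).

Lemma gammaD z : D z -> D (gamma z).
Proof. by have [delta [h _ _ _]] := gamma_aut; move=> /h[]. Qed.

Lemma gamma_derivable z : D z -> derivable gamma z 1.
Proof. by have [delta [_ _ h _]] := gamma_aut; exact: h. Qed.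

Lemma gamma_is_derive z : D z -> is_derive z 1 gamma (derive1 gamma z).
Proof. by move=> Dz; rewrite derive1E; apply/derivableP; exact: gamma_derivable. Qed.

Lemma gamma_continuous z : D z -> {for z, continuous gamma}.
Proof.
by move=> /gamma_derivable /derivable1_diffP; exact: differentiable_continuous.
Qed.

(** gamma is injective and continuous, so the preimage of S has no limit points in D
either. *)
Lemma regular_discrete : no_limit_point D (S `|` gamma @^-1` S).
Proof.
have nlS := poles_discrete; have [delta [_ dg _ _]] := gamma_aut.
move=> z Dz lim.
have h1 := no_limit_near nlS Dz.
have h2 := gamma_continuous Dz (no_limit_near nlS (gammaD Dz)).
have h3 : nbhs z D by exact: open_nbhs_nbhs.
have [y [/eqP yz Sy [[n1y n2y] Dy]]] := lim _ (filterI (filterI h1 h2) h3).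
case: Sy => Sy; first exact: n1y Sy.
apply: (n2y _ Sy) => gyz; apply: yz.
by rewrite -(dg y Dy).1 gyz (dg z Dz).1.
Qed.

Lemma regular_open : open U.
Proof. exact: no_limit_open oD regular_discrete. Qed.

Lemma regular_connected : connected U.
Proof. exact: connected_minus_discrete oD cD regular_discrete. Qed.

Lemma regular_source z : U z -> (D `\` S) z.
Proof. by move=> [Dz /not_orP[]]. Qed.

Lemma regular_target z : U z -> (D `\` S) (gamma z).
Proof. by move=> [Dz /not_orP[_ nS]]; split => //; exact: gammaD. Qed.

Lemma regular_dense z A : D z -> nbhs z A -> exists2 w, A w & U w.
Proof. exact: no_limit_dense oD regular_discrete. Qed.

Lemma regular_nonempty : exists z, U z.
Proof. by have [z _ Uz] := regular_dense D0 filterT; exists z. Qed.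

Lemma solution_iso l z : circle l -> (D `\` S) z -> lorentz_isometry (C z l).
Proof.
move=> lc Uz; have [_ _ _ [_ [F0 [_ hF0 _]]]] := eta_potential.
have [[_ h _] _] := solution_loop_frame hF0 Uz.
by case: (h l lc).
Qed.

Lemma solution_GC0 z : (D `\` S) z -> @LambdaGC0 R n (C z).
Proof.
move=> Uz; have [_ _ _ [_ [F0 [_ hF0 _]]]] := eta_potential.
exact: (solution_loop0 hF0 Uz).1.
Qed.

Lemma Vplus_iso b V l z : Vplus_class D S gamma b V -> circle l -> U z ->
  lorentz_isometry (V z l).
Proof.
move=> hV lc Uz; have [[_ h _] _] := id_component_sub (hV z Uz).
rewrite -(PtK b (V z l)); apply: lorentz_isoM; first exact: Pt_iso.
by case: (h l lc).
Qed.

Lemma image_solution_derive l z : circle l -> U z ->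
  is_derive z 1 (fun z => C (gamma z) l)
    (C (gamma z) l *m (derive1 gamma z *: eta (gamma z) l)).
Proof.
move=> lc Uz; rewrite -scalemxAr.
apply: (is_derive_chain (gamma_is_derive (proj1 Uz)) (F := C^~ l)).
exact: solution_derive C_solution lc (regular_target Uz).
Qed.

(** C o gamma and C V solve the same equation on the regular set; rho is their
quotient, and its class can be read off at a single point z0. *)
Theorem monodromy_exists b V :
  Vplus_class D S gamma b V -> gauge_equation D S gamma eta V ->
  exists2 rho : K -> 'M[K]_n.+4,
    @LambdaGC0 R n (fun l => rho l *m Ptilde K n ^+ b) & monodromy_equation D S gamma C V rho.
Proof.
move=> hV gV; have [z0 Uz0] := regular_nonempty.
exists (fun l => C (gamma z0) l *m lorentz_adj (C z0 l *m V z0 l)).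
  have gG := @LambdaGC_group R n.
  have h1 := solution_GC0 (regular_target Uz0).
  have h2 := id_componentV gG (LambdaplusGC0_GC0 (hV z0 Uz0)).
  have h3 := id_componentV gG (solution_GC0 (regular_source Uz0)).
  have h4 := id_componentJ (@LambdaGC_PtJ R n b) h3.
  apply: (id_component_eq gG _ (id_componentM gG (id_componentM gG h1 h2) h4)) => l lc.
  rewrite -[Ptilde K n ^+ b]/(Pt K n b) !lorentz_adjM Pt_adj.
  move: (lorentz_adj (V z0 l)) (lorentz_adj (C z0 l)) => a c.
  by rewrite !mulmxA mulPtK.
move=> l lc z Uz.
have isoY w : U w -> lorentz_isometry (C w l *m V w l).
  by move=> Uw; apply: lorentz_isoM; [apply: solution_iso lc (regular_source Uw)|exact: Vplus_iso hV lc Uw].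
have dY w : U w -> is_derive w 1 (fun w => C w l *m V w l)
    (C w l *m V w l *m (derive1 gamma w *: eta (gamma w) l)).
  move=> Uw; have [dV E] := gV l lc w Uw.
  have dC := solution_derive C_solution lc (regular_source Uw).
  have h := is_derive_mulmx dC ((derivableP dV)).
  have Vu : V w l \in unitmx by apply: lorentz_iso_unit; exact: Vplus_iso hV lc Uw.
  rewrite E; move: h; move: ('D_1 _ w) => V'.
  suff -> : C w l *m eta w l *m V w l + C w l *m V' =
      C w l *m V w l *m (invmx (V w l) *m eta w l *m V w l + invmx (V w l) *m V') by [].
  rewrite mulmxDr -!mulmxA; congr (_ + _); last by rewrite mulKVmx.
  by rewrite mulKVmx.
have := gauge_unique_holo regular_open regular_connected isoY
  (fun w => image_solution_derive lc) dY Uz Uz0.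
move=> <-; have := (lorentz_isoP _).1 (isoY z Uz).
by move: (lorentz_adj _) => q qE; rewrite -!mulmxA qE mulmx1.
Qed.

Section RealMonodromy.
Variables (V : K -> K -> 'M[K]_n.+4) (rho : K -> 'M[R]_n.+4) (b : bool).
Variable F : K -> K -> 'M[R]_n.+4.
Hypotheses (hF : extended_frame D f F) (hV : Vplus_class D S gamma b V).
Hypothesis hrho : @LambdaG0 R n (fun l => rho l *m Ptilde R n ^+ b).
Hypothesis mono : monodromy_equation D S gamma C V (fun l => cmx (rho l)).

(** It lies in K exactly when rho(l) maps the coset of F(z, l) to that of F(gamma z,
l). *)
Definition frame_quotient z l : 'M[R]_n.+4 :=
  lorentz_adj (F (gamma z) l) *m rho l *m F z l *m Pt R n b.

Lemma frame_quotient_SOplus z l : D z -> circle l -> @SOplus R n.+3 (frame_quotient z l).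
Proof.
move=> Dz lc; rewrite /frame_quotient.
have -> : lorentz_adj (F (gamma z) l) *m rho l *m F z l *m Pt R n b =
  lorentz_adj (F (gamma z) l) *m (rho l *m Pt R n b) *m (Pt R n b *m F z l *m Pt R n b).
  by move: (lorentz_adj _) => q; rewrite !mulmxA mulPtK.
have [_ hr _] := id_component_sub hrho.
apply: SOplusM; last by apply: SOplusJ; exact: (frame_SOplus hF).
apply: SOplusM; last exact: (hr l lc).
by apply: SOplusV; apply: (frame_SOplus hF) => //; exact: gammaD.
Qed.

(** With W = F^-1 C at z and at gamma z, the product of W(gamma z), (Ptilde^b V)^-1
and the conjugate of W(z)^-1 by Ptilde^b. *)
Lemma quotient_algebra (F1 F2 C1 C2 V1 r P : 'M[K]_n.+4) :
  lorentz_isometry F1 -> lorentz_isometry C1 -> lorentz_isometry V1 ->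
  P *m P = 1%:M -> lorentz_adj P = P -> C2 = r *m C1 *m V1 ->
  lorentz_adj F2 *m C2 *m lorentz_adj (P *m V1) *m
    (P *m lorentz_adj (lorentz_adj F1 *m C1) *m P) = lorentz_adj F2 *m r *m F1 *m P.
Proof.
move=> hF1 hC1 hV1 PP aP ->.
rewrite (lorentz_adjM P V1) (lorentz_adjM _ C1) lorentz_adjK aP.
have := lorentz_adjV hV1; have := lorentz_adjV hC1.
move: (lorentz_adj F2) (lorentz_adj C1) (lorentz_adj V1) => f2 c1 v1 hc hv.
by rewrite !mulmxA -(mulmxA _ V1) hv mulmx1 -(mulmxA _ P P) PP mulmx1 -(mulmxA _ C1) hc mulmx1.
Qed.

(** The frame quotient is a product of plus loops, and it is real. *)
Lemma frame_quotient_regular z : U z ->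
  forall l, circle l -> sigma (frame_quotient z l) = frame_quotient z l /\
    eps (frame_quotient z l) = 1.
Proof.
move=> Uz; apply: real_plus_loop.
have gP := @LambdaplusGC_group R n.
have h1 := (solution_loop0 hF (regular_target Uz)).2.
have h2 := id_componentV gP (hV Uz).
have h3 := id_componentV gP (solution_loop0 hF (regular_source Uz)).2.
have h4 := id_componentJ (@LambdaplusGC_PtJ R n b) h3.
apply: (id_component_eq gP _ (id_componentM gP (id_componentM gP h1 h2) h4)) => l lc.
rewrite /frame_quotient (cmxM _ (Pt R n b)) (cmxM _ (F z l)) (cmxM _ (rho l)) cmx_adj cmx_Pt.
apply: (quotient_algebra _ _ _ _ (Pt_sqr K n b) (Pt_adj K n b) (mono lc Uz)).
- by apply/cmx_iso; apply: (frame_iso hF) => //; case: Uz.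
- exact: solution_iso lc (regular_source Uz).
- exact: Vplus_iso hV lc Uz.
Qed.

Lemma frame_continuous l z : circle l -> D z -> F w l @[w --> z] --> F z l.
Proof.
move=> lc Dz; have [_ _ sm _ _] := hF; have [cF _ _ _] := smooth_partials (sm l lc).
by rewrite continuous_open_subspace// in cF; apply: (cF z); rewrite inE.
Qed.

Lemma frame_quotient_continuous l z : circle l -> D z ->
  frame_quotient w l @[w --> z] --> frame_quotient z l.
Proof.
move=> lc Dz.
have cg : F (gamma w) l @[w --> z] --> F (gamma z) l.
  exact: (cvg_comp _ _ (gamma_continuous Dz) (frame_continuous lc (gammaD Dz))).
exact: (cvg_quotient cg (frame_continuous lc Dz)).
Qed.

Lemma frame_quotient_Kgrp z l : D z -> circle l -> @Kgrp R n (frame_quotient z l).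
Proof.
move=> Dz lc; have cM := frame_quotient_continuous lc Dz.
have dU A : nbhs z A -> exists2 w, A w & U w by exact: regular_dense.
apply/KgrpP; split; first exact: frame_quotient_SOplus.
- apply/matrixP => i j; apply/eqP; rewrite -subr_eq0; apply/eqP.
  apply: (constant_by_density (phi := fun w => sigma (frame_quotient w l) i j - frame_quotient w l i j) dU).
    exact: (cvg_comp _ _ cM (@sigma_continuous R n (frame_quotient z l) i j)).
  by move=> w Uw; rewrite (frame_quotient_regular Uw lc).1 subrr.
- apply: (constant_by_density (phi := fun w => eps (frame_quotient w l)) dU).
    exact: (cvg_comp _ _ cM (@eps_continuous R n (frame_quotient z l))).
  by move=> w Uw; rewrite (frame_quotient_regular Uw lc).2.
Qed.

Lemma rho_Oplus l : circle l -> Oplus (rho l).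
Proof.
move=> lc; have [_ /(_ l lc) hr _] := id_component_sub hrho.
by rewrite -(mulPtK b (rho l)); apply: OplusM; [exact: SOplus_Oplus|exact: Pt_Oplus].
Qed.

Lemma rho_det l : circle l -> \det (rho l) = (-1) ^+ b.
Proof.
move=> lc; have [_ /(_ l lc)/SOplusP[_ _ hr] _] := id_component_sub hrho.
by rewrite -(mulPtK b (rho l)) det_mulmx [\det (_ *m _)]hr mul1r det_Pt.
Qed.

Theorem monodromy_symmetry l z : circle l -> D z ->
  cosetK (F (gamma z) l) = act (rho l) (cosetK (F z l)).
Proof.
move=> lc Dz; rewrite (act_cosetK _ (rho_det lc)); apply/esym/cosetK_eqP.
exists (frame_quotient z l); first exact: frame_quotient_Kgrp.
rewrite /frame_quotient.
have := lorentz_adjV (frame_iso hF (gammaD Dz) lc).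
by move: (lorentz_adj _) => q qE; rewrite !mulmxA qE mul1mx.
Qed.

End RealMonodromy.

Theorem real_monodromy_induces V rho :
  real_monodromy D S gamma eta C V rho -> induces_symmetry D f gamma.
Proof.
move=> [[b [hV hr]] _ mono]; have [_ _ _ [_ [F [_ hF _]]]] := eta_potential.
have c1 := circle1 R; have [_ [_ lF] _ _ _] := hF.
exists (rho 1); [exact (rho_Oplus hr c1)|].
move=> p Dp; rewrite (lF _ Dp).2 (lF _ (gammaD Dp)).2.
exact (monodromy_symmetry hF hV hr mono c1 Dp).
Qed.

Section SymmetryMonodromy.
Variables (A : 'M[R]_n.+4) (b : bool) (F : K -> K -> 'M[R]_n.+4).
Hypotheses (hF : extended_frame D f F) (detA : \det A = (-1) ^+ b).
Hypothesis fA : forall z, D z -> f (gamma z) = act A (f z).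
Local Notation T := (transition F F gamma A).

(** F(0) = I and D is connected. *)
Lemma frame_loop0 z : D z -> @LambdaG0 R n (F z).
Proof.
have gG := @LambdaG_group R n; have [FL _ _ _ _] := hF.
apply: (id_component_path cD FL.2 FL.1 D0).
apply: (id_component_eq gG (a := fun=> 1%:M)); last exact: id_component1.
by move=> l lc; rewrite (frame_at0 hF).
Qed.

Lemma transition_loop0 z : D z ->
  @LambdaG0 R n (fun=> T z *m Pt R n b) /\ @LambdaplusGC0 R n (fun=> cmx (T z *m Pt R n b)).
Proof.
move=> Dz; apply: Kgrp_cst_loop => //.
exact: (transition_Kgrp hF hF gammaD detA fA Dz).
Qed.

Definition symmetry_monodromy l : 'M[R]_n.+4 := F (gamma 0) l *m T 0.
(** The monodromy equation solved for V. *)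
Definition symmetry_gauge z l : 'M[K]_n.+4 :=
  lorentz_adj (C z l) *m lorentz_adj (cmx (symmetry_monodromy l)) *m C (gamma z) l.

Lemma symmetry_monodromy_G0 : @LambdaG0 R n (fun l => symmetry_monodromy l *m Ptilde R n ^+ b).
Proof.
have gG := @LambdaG_group R n.
have h := id_componentM gG (frame_loop0 (gammaD D0)) (transition_loop0 D0).1.
by apply: (id_component_eq gG _ h) => l lc; rewrite /symmetry_monodromy -mulmxA.
Qed.

Lemma symmetry_monodromy_iso l : circle l -> lorentz_isometry (cmx (symmetry_monodromy l)).
Proof.
move=> lc; apply/cmx_iso.
have /OplusP[] := rho_Oplus symmetry_monodromy_G0 lc; first by [].
Qed.

(** V = W(z)^-1 T^-1 W(gamma z), rewritten so that each factor is a plus loop after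
the multiplication by Ptilde^b. *)
Lemma gauge_algebra (F1 F2 C1 C2 T0 r P : 'M[K]_n.+4) : lorentz_isometry F1 ->
  P *m P = 1%:M -> lorentz_adj P = P -> F2 *m T0 = r *m F1 ->
  P *m lorentz_adj (lorentz_adj F1 *m C1) *m P *m lorentz_adj (T0 *m P) *m
    (lorentz_adj F2 *m C2) = P *m (lorentz_adj C1 *m lorentz_adj r *m C2).
Proof.
move=> hF1 PP aP E; have := congr1 (@lorentz_adj _ _) E.
rewrite (lorentz_adjM F2 T0) (lorentz_adjM r F1) (lorentz_adjM T0 P) (lorentz_adjM _ C1).
rewrite lorentz_adjK aP; have := lorentz_adjV hF1.
move: (lorentz_adj F2) (lorentz_adj C1) (lorentz_adj T0) (lorentz_adj r) (lorentz_adj F1).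
move=> f2 c1 t0 r' f1 h1 h2.
rewrite !mulmxA -(mulmxA _ P P) PP mulmx1 -!mulmxA (mulmxA t0) h2.
by rewrite -(mulmxA f1) (mulmxA F1) h1 mul1mx.
Qed.

Lemma symmetry_gauge_class : Vplus_class D S gamma b symmetry_gauge.
Proof.
move=> z Uz; have gP := @LambdaplusGC_group R n; have Dz : D z by case: Uz.
have h1 := id_componentV gP (solution_loop0 hF (regular_source Uz)).2.
have h2 := id_componentJ (@LambdaplusGC_PtJ R n b) h1.
have h3 := id_componentV gP (transition_loop0 Dz).2.
have h4 := (solution_loop0 hF (regular_target Uz)).2.
apply: (id_component_eq gP _ (id_componentM gP (id_componentM gP h2 h3) h4)) => l lc.
rewrite (cmxM (T z)) cmx_Pt; apply: (gauge_algebra _ _ _ (Pt_sqr K n b) (Pt_adj K n b)).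
  by apply/cmx_iso; exact: frame_iso hF Dz lc.
rewrite -(cmxM (F (gamma z) l)) -(cmxM (symmetry_monodromy l)); congr cmx.
exact: (frame_transform oD cD D0 hF hF gammaD gamma_derivable detA fA lc Dz).
Qed.

Lemma symmetry_monodromy_equation :
  monodromy_equation D S gamma C symmetry_gauge (fun l => cmx (symmetry_monodromy l)).
Proof.
move=> l lc z Uz; rewrite /symmetry_gauge.
have := lorentz_adjV (symmetry_monodromy_iso lc).
have := lorentz_adjV (solution_iso lc (regular_source Uz)).
move: (lorentz_adj (C z l)) (lorentz_adj (cmx _)) => c r hc hr.
by rewrite !mulmxA -(mulmxA _ (C z l)) hc mulmx1 hr mul1mx.
Qed.

(** The gauge equation is the derivative of the monodromy equation, with C and V
cancelled. *)
Lemma gauge_from_derivative (C1 V1 V' e e' : 'M[K]_n.+4) :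
  lorentz_isometry C1 -> lorentz_isometry V1 ->
  C1 *m e *m V1 + C1 *m V' = C1 *m V1 *m e' ->
  e' = invmx V1 *m e *m V1 + invmx V1 *m V'.
Proof.
move=> /lorentz_iso_unit uC /lorentz_iso_unit uV.
rewrite -!mulmxA -mulmxDr => /(congr1 (mulmx (invmx C1))).
by rewrite !mulKmx// -mulmxDr => ->; rewrite mulKmx.
Qed.

Lemma gauge_cancel (r C1 V1 : 'M[K]_n.+4) : lorentz_isometry r ->
  C1 *m V1 = lorentz_adj r *m (r *m C1 *m V1).
Proof.
move=> /lorentz_isoP; move: (lorentz_adj r) => q qE.
by rewrite !mulmxA qE mul1mx.
Qed.

Lemma symmetry_gauge_equation : gauge_equation D S gamma eta symmetry_gauge.
Proof.
move=> l lc z Uz.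
have dC := solution_derive C_solution lc (regular_source Uz).
have dCg := image_solution_derive lc Uz.
have da : derivable (fun w => lorentz_adj (C w l)) z 1 by apply: derivable_adj; case: dC.
have dV : derivable (fun w => symmetry_gauge w l) z 1.
  apply: derivable_mulmx; last by case: dCg.
  by apply: derivable_mulmx; [exact: da|exact: derivable_cst].
split=> //.
apply: (gauge_from_derivative (solution_iso lc (regular_source Uz))
  (Vplus_iso symmetry_gauge_class lc Uz)).
have h1 := is_derive_mulmx dC (derivableP dV).
have h2 := is_derive_mulmx (is_derive_cst (lorentz_adj (cmx (symmetry_monodromy l))) z 1) dCg.
have CV w : U w -> C w l *m symmetry_gauge w l =
    lorentz_adj (cmx (symmetry_monodromy l)) *m C (gamma w) l.
  move=> Uw; rewrite (symmetry_monodromy_equation lc Uw).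
  exact: gauge_cancel (symmetry_monodromy_iso lc).
have near1 : \forall w \near z, C w l *m symmetry_gauge w l =
    lorentz_adj (cmx (symmetry_monodromy l)) *m C (gamma w) l.
  by apply: filterS (open_nbhs_nbhs (conj regular_open Uz)) => w; exact: CV.
have [_ h3] := near_eq_is_derive near1 h1; have [_ h4] := h2.
apply: (etrans (esym h3) (etrans h4 _)).
by rewrite (CV z Uz) /cst mul0mx add0r; exact: mulmxA.
Qed.

End SymmetryMonodromy.

(** The sign b is read off from the determinant of the symmetry A. *)
Theorem induces_real_monodromy : induces_symmetry D f gamma ->
  exists V rho, real_monodromy D S gamma eta C V rho.
Proof.
move=> [A OA fA]; have [_ _ _ [_ [F [_ hF _]]]] := eta_potential.
have /OplusP[hA _] := OA.
have [b detA] : exists b : bool, \det A = (-1) ^+ b.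
  have /eqP := lorentz_iso_det hA; rewrite sqrf_eq1 => /orP[/eqP ->|/eqP ->].
    by exists false.
  by exists true.
exists (symmetry_gauge A F), (symmetry_monodromy A F); split.
- exists b; split; first exact: symmetry_gauge_class.
  exact: symmetry_monodromy_G0.
- exact: symmetry_gauge_equation hF detA fA.
- exact: symmetry_monodromy_equation hF detA fA.
Qed.

End PotentialTheory.

Theorem theorem4p6 (R : realType) (n : nat) (hn : (1 <= n)%N)
    (D S : set (cplx R)) (f : cplx R -> set 'M[R]_n.+4)
    (eta C : cplx R -> cplx R -> 'M[cplx R]_n.+4)
    (gamma : cplx R -> cplx R)
    (D_open : open D) (D_contractible : contractible_set R D) (D0 : D 0)
    (S_poles : pole_set D S)
    (f_harmonic : harmonic_map D f) (f0 : f 0 = cosetK 1%:M)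
    (eta_potential : potential D S f eta)
    (C_solution : solution D S eta C)
    (gamma_aut : conformal_automorphism D gamma) :
  [/\ forall (b : bool) (V : cplx R -> cplx R -> 'M[cplx R]_n.+4),
        Vplus_class D S gamma b V ->
        gauge_equation D S gamma eta V ->
        exists2 rho : cplx R -> 'M[cplx R]_n.+4,
          @LambdaGC0 R n (fun l => rho l *m Ptilde (cplx R) n ^+ b) &
          monodromy_equation D S gamma C V rho,
      induces_symmetry D f gamma <->
        exists (V : cplx R -> cplx R -> 'M[cplx R]_n.+4)
               (rho : cplx R -> 'M[R]_n.+4),
          real_monodromy D S gamma eta C V rho &
      forall (V : cplx R -> cplx R -> 'M[cplx R]_n.+4)
             (rho : cplx R -> 'M[R]_n.+4),
        real_monodromy D S gamma eta C V rho ->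
        forall F : cplx R -> cplx R -> 'M[R]_n.+4, extended_frame D f F ->
        forall l, circle l -> forall z, D z ->
          cosetK (F (gamma z) l) = act (rho l) (cosetK (F z l))].
Proof.
have cD := contractible_connected D_contractible.
split.
- move=> b V hV gV.
  exact: (monodromy_exists D_open cD D0 S_poles eta_potential C_solution gamma_aut hV gV).
- split; first exact: (induces_real_monodromy D_open cD D0 S_poles eta_potential C_solution gamma_aut hn).
  move=> [V [rho h]].
  exact: (real_monodromy_induces D_open cD D0 S_poles eta_potential C_solution gamma_aut hn h).
- move=> V rho [[b [hV hr]] _ mono] F hF l lc z Dz.
  exact: (monodromy_symmetry D_open cD D0 S_poles eta_potential C_solution gamma_aut hn hF hV hr mono lc Dz).
Qed.
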